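(* Let $n\ge1$ and $k\in\{1,\ldots,n\}$. For all $u\in S(\mathbb{R}^n_{k,+})$, $$\rho_1(u)\;\ge\;\frac12\inf_{\omega\in\tilde E}\left\{\int_{\mathbb{R}^n_{k,+}}|u(x)-\omega(x)|^2dx\;:\;\int_{\mathbb{R}^n_{k,+}}|u(x)|^2dx=\int_{\mathbb{R}^n_{k,+}}|\omega(x)|^2dx\right\}.$$ Moreover, the inequality is sharp, and equality can be attained by nontrivial functions $u$ (i.e. functions $u\notin\tilde E$).
   Context: $\mathbb{R}^n_{k,+}:=\mathbb{R}^{n-k}\times(0,\infty)^k$. $S(\mathbb{R}^n_{k,+})$ is the completion of $C_c^\infty(\mathbb{R}^n_{k,+})$ (smooth functions with compact support in the open orthant) under the norm $\left(\int_{\mathbb{R}^n_{k,+}}|\nabla u|^2dx\right)^{1/2}+\left(\int_{\mathbb{R}^n_{k,+}}|x|^2|u|^2dx\right)^{1/2}$. Functions are real-valued. The Heisenberg deficit is $$\rho_1(u)=\left(\int_{\mathbb{R}^n_{k,+}}|\nabla u(x)|^2dx\right)^{1/2}\left(\int_{\mathbb{R}^n_{k,+}}|x|^2|u(x)|^2dx\right)^{1/2}-\frac{n+2k}{2}\int_{\mathbb{R}^n_{k,+}}|u(x)|^2dx,$$ and $\tilde E=\left\{\left(\prod_{i=n-k+1}^{n}x_i\right)\alpha e^{-\beta|x|^2}:\alpha\in\mathbb{R},\ \beta>0\right\}$. ''Sharp'' means that the constant $\frac12$ cannot be replaced by a larger one.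
   Formalization: Sharpness of 1/2 and attainment of equality by some u outside Ẽ are stated only for k < n; for k = n they are false, since there the inequality holds with constant 1 in place of 1/2 (the inequality itself is kept for all 1 ≤ k ≤ n). *)

(* Defs.v *)
From HB Require Import structures.
From mathcomp Require Import all_boot all_order all_algebra.
From mathcomp Require Import all_classical all_reals all_analysis.

Set Implicit Arguments.
Unset Strict Implicit.
Unset Printing Implicit Defensive.

Import Order.TTheory GRing.Theory Num.Theory.
Import numFieldNormedType.Exports.

Local Open Scope classical_set_scope.
Local Open Scope ring_scope.

(* R^n is 'rV[R]_n, with the sigma-algebra generated by the coordinates, as
   the library does for n.-tuple. *)
Section measurable_rV.
Context {d} {T : sigmaRingType d}.
Variable n : nat.

Let coors : 'I_n -> 'rV[T]_n -> T := fun i x => x ord0 i.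

Let rV_set0 : g_sigma_preimage coors set0.
Proof. exact: sigma_algebra0. Qed.

Let rV_setC A : g_sigma_preimage coors A -> g_sigma_preimage coors (~` A).
Proof. exact: sigma_algebraC. Qed.

Let rV_bigcup (F : _^nat) : (forall i, g_sigma_preimage coors (F i)) ->
  g_sigma_preimage coors (\bigcup_i (F i)).
Proof. exact: sigma_algebra_bigcup. Qed.

HB.instance Definition _ := @isMeasurable.Build (measure_tuple_display d)
  'rV[T]_n (g_sigma_preimage coors) rV_set0 rV_setC rV_bigcup.

Lemma measurable_coor (i : 'I_n) :
  measurable_fun [set: 'rV[T]_n] (fun x : 'rV[T]_n => x ord0 i).
Proof.
move=> _ A mA; rewrite setTI; apply: sub_sigma_algebra => /=.
rewrite -bigcup_seq/=; exists i => /=; first by rewrite mem_index_enum.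
by exists A => //; rewrite setTI.
Qed.

End measurable_rV.

Lemma measurable_fun_rVP d1 d2 (T1 : measurableType d1) (T2 : measurableType d2)
    n (f : T1 -> 'rV[T2]_n) :
  (forall i, measurable_fun [set: T1] (fun x => f x ord0 i)) ->
  measurable_fun [set: T1] f.
Proof.
move=> mf.
have : g_sigma_preimage (fun (i : 'I_n) x => f x ord0 i) `<=` measurable.
  apply: smallest_sub; first exact: sigma_algebra_measurable.
  case: n => [|n] in f mf *; first by rewrite big_ord0.
  rewrite -bigcup_mkord_ord; apply: bigcup_sub => i Ii.
  by move=> A [B mB <-]; exact: mf.
rewrite (g_sigma_preimage_comp (fun (i : 'I_n) (x : 'rV[T2]_n) => x ord0 i) f).
by move=> prefS _ A mA; apply: prefS; exists A.
Qed.

Section lebesgue_rV.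
Context {R : realType}.
Local Open Scope ereal_scope.

Definition rV_cons n (p : measurableTypeR R * 'rV[R]_n) : 'rV[R]_n.+1 :=
  \row_i if unlift ord0 i is Some j then p.2 ord0 j else p.1.

Definition rV_uncons n (x : 'rV[R]_n.+1) : measurableTypeR R * 'rV[R]_n :=
  (x ord0 ord0, \row_j x ord0 (lift ord0 j)).

Lemma rV_consK n : @rV_uncons n \o @rV_cons n = id.
Proof.
apply/funext => -[a x]; rewrite /rV_uncons /rV_cons /= mxE unlift_none.
by congr (_, _); apply/rowP => j; rewrite !mxE liftK.
Qed.

Lemma measurable_rV_cons n : measurable_fun [set: measurableTypeR R * 'rV[R]_n] (@rV_cons n).
Proof.
apply: measurable_fun_rVP => i; under eq_fun do rewrite mxE.
case: (unlift ord0 i) => [j|]; last exact: measurable_fst.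
exact: (measurableT_comp (measurable_coor j) measurable_snd).
Qed.

Section step.
Context n (mu : {sigma_finite_measure set 'rV[R]_n -> \bar R}).

Definition lebesgue_step : set 'rV[R]_n.+1 -> \bar R :=
  pushforward (@lebesgue_measure R \x mu) (@rV_cons n).

HB.instance Definition _ := Measure.copy lebesgue_step
  (measure_function_pushforward__canonical__measure_function_Measure
     (@lebesgue_measure R \x mu) (@measurable_rV_cons n)).

Let lebesgue_step_sigma_finite : sigma_finite [set: 'rV[R]_n.+1] lebesgue_step.
Proof.
have /sigma_finiteP[F [TF ndF Foo]] := sigma_finiteT (@lebesgue_measure R).
have /sigma_finiteP[G [TG ndG Goo]] := sigma_finiteT mu.
have mg : measurable_fun [set: 'rV[R]_n.+1] (@rV_uncons n).
  apply/measurable_fun_pairP; split; first exact: measurable_coor.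
  apply: measurable_fun_rVP => i /=; under eq_fun do rewrite mxE.
  exact: measurable_coor.
exists (fun i => @rV_uncons n @^-1` (F i `*` G i)).
  rewrite -preimage_bigcup -[LHS](preimage_setT (@rV_uncons n)); congr (_ @^-1` _).
  rewrite -setXTT TF TG predeqE => -[x y]; split.
    move=> [/= [i _ Fix] [k _ Gky]]; exists (maxn i k) => //; split.
    - by move: x Fix; exact/subsetPset/ndF/leq_maxl.
    - by move: y Gky; exact/subsetPset/ndG/leq_maxr.
  by move=> [i _ []/= ? ?]; split; exists i.
move=> i; have [mF Fioo] := Foo i; have [mG Gioo] := Goo i; split.
  by rewrite -[X in measurable X]setTI; apply: mg => //; exact: measurableX.
rewrite /lebesgue_step /pushforward -comp_preimage rV_consK preimage_id.
by rewrite product_measure1E// lte_mul_pinfty// ge0_fin_numE.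
Qed.

HB.instance Definition _ := Measure_isSigmaFinite.Build _ _ _ lebesgue_step
  lebesgue_step_sigma_finite.

End step.

Fixpoint lebesgue_rV n : {sigma_finite_measure set 'rV[R]_n -> \bar R} :=
  if n is m.+1 then lebesgue_step (lebesgue_rV m) else \d_(0%R : 'rV[R]_0).

(* Characterises lebesgue_rV as n-dimensional Lebesgue measure. *)
Lemma lebesgue_rV_box n (A : 'I_n -> set (measurableTypeR R)) :
  (forall i, measurable (A i)) ->
  lebesgue_rV n [set x : 'rV[R]_n | forall i, A i (x ord0 i)] =
    \prod_(i < n) lebesgue_measure (A i).
Proof.
elim: n A => [|n IHn] A mA /=.
  rewrite big_ord0 diracE mem_set//= => -[]//.
rewrite big_ord_recl -IHn; last by move=> i; exact: mA.
have -> : [set x : 'rV[R]_n.+1 | forall i, A i (x ord0 i)] =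
    @rV_uncons n @^-1` (A ord0 `*`
      [set x : 'rV[R]_n | forall i : 'I_n, A (lift ord0 i) (x ord0 i)]).
  apply/seteqP; split => [x Ax|x [/= A0 Al] i].
    by split=> [|i] /=; rewrite ?mxE; exact: Ax.
  by case: (unliftP ord0 i) => [j|] -> //; have := Al j; rewrite mxE.
rewrite /lebesgue_step /pushforward -comp_preimage rV_consK preimage_id.
apply: product_measure1E; first exact: mA.
rewrite (_ : [set x | _] =
    \bigcap_i ((fun x : 'rV[R]_n => x ord0 i) @^-1` A (lift ord0 i))); last first.
  by apply/seteqP; split => [x Ax i _|x Ax i]; exact: Ax.
apply: fin_bigcap_measurable => // i _.
by rewrite -[X in measurable X]setTI; apply: measurable_coor => //; exact: mA.
Qed.

End lebesgue_rV.

Section heisenberg.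
Context {R : realType} {n : nat}.
Implicit Types (k : nat) (u w phi : 'rV[R]_n -> R) (G : 'rV[R]_n -> 'rV[R]_n).

Local Notation leb := (@lebesgue_rV R n).

(* |x|^2 for the Euclidean norm; the library norm `|x| on 'rV[R]_n is the
   sup norm. *)
Definition sqnorm (x : 'rV[R]_n) : R := \sum_i x ord0 i ^+ 2.

(* R^{n-k} x (0, oo)^k; indices start at 0, so the positive coordinates are
   those with n - k <= i < n. *)
Definition orthant k : set 'rV[R]_n :=
  [set x | forall i : 'I_n, (n - k <= i)%N -> 0 < x ord0 i].

Definition partial (i : 'I_n) (f : 'rV[R]_n -> R) : 'rV[R]_n -> R :=
  fun x => 'D_(delta_mx ord0 i) f x.

Definition grad f (x : 'rV[R]_n) : 'rV[R]_n := \row_i partial i f x.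

Definition smooth (f : 'rV[R]_n -> R) :=
  forall s : seq 'I_n, let g := foldr partial f s in
    continuous g /\ forall i x, derivable g x (delta_mx ord0 i).

(* C_c^oo of the open orthant, its elements being extended by 0 to R^n. *)
Definition test_fun k phi :=
  smooth phi /\ exists K : set 'rV[R]_n,
    [/\ compact K, K `<=` orthant k & forall x, ~ K x -> phi x = 0].

(* (u, G) is the limit of a sequence (phi_j, grad phi_j) of test functions in
   the norm of the completion: an element of the completion is such a pair
   up to a.e. equality. The gradient is closable, so u determines G a.e., and
   G is the weak gradient of u. *)
Definition completion_pair k u G :=
  [/\ measurable_fun (orthant k) u, measurable_fun (orthant k) G &
   exists phi : nat -> 'rV[R]_n -> R, [/\ forall j, test_fun k (phi j),
     (fun j => \int[leb]_(x in orthant k)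
        (sqnorm (grad (phi j) x - G x))%:E)%E @ \oo --> 0%E &
     (fun j => \int[leb]_(x in orthant k)
        (sqnorm x * (phi j x - u x) ^+ 2)%:E)%E @ \oo --> 0%E]].

Definition S_space k : set ('rV[R]_n -> R) :=
  [set u | exists G, completion_pair k u G].

Definition S_grad k u : 'rV[R]_n -> 'rV[R]_n :=
  xget (fun=> 0) [set G | completion_pair k u G].

(* For u in S_space k (k >= 1) the integrals below are finite, so the
   real-valued integral is the intended one. *)
Definition rho1 k u : R :=
  Num.sqrt (\int[leb]_(x in orthant k) sqnorm (S_grad k u x)) *
  Num.sqrt (\int[leb]_(x in orthant k) (sqnorm x * u x ^+ 2)) -
  (n + 2 * k)%:R / 2 * \int[leb]_(x in orthant k) (u x ^+ 2).

Definition Etilde k : set ('rV[R]_n -> R) :=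
  [set w | exists a b : R, 0 < b /\
    w = fun x : 'rV[R]_n => (\prod_(i < n | (n - k <= i)%N) x ord0 i) *
                 (a * expR (- b * sqnorm x))].

Definition dist_Etilde k u : R :=
  inf [set \int[leb]_(x in orthant k) ((u x - w x) ^+ 2) | w in
    [set w | Etilde k w /\
      \int[leb]_(x in orthant k) (u x ^+ 2) =
      \int[leb]_(x in orthant k) (w x ^+ 2)]].

End heisenberg.

(* Main.v *)
Require Import Defs.
From mathcomp Require Import all_boot all_order all_algebra.
From mathcomp Require Import all_classical all_reals all_analysis.
From mathcomp Require Import measurable_realfun zify ring lra.

(** For test functions, the ground state [g] of the harmonic oscillator with
frequency [2 c] on the orthant (a normalized Gaussian times the positive
coordinates) gives, by integration by parts, the spectral gap inequality
[int |grad u|^2 + 4 c^2 int |x|^2 u^2 >=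
 2 c (n + 2 k) |u|^2 + 4 c (|u|^2 - <u, g>^2)]: one-dimensional spectral gaps
tensorize.  For the best [c] the left side is [4 c]
times the product of the two square roots in [rho1], hence
[rho1 u >= |u|^2 - <u, g>^2], and the multiple of [g] that has the norm of [u]
is at squared distance at most [2 (|u|^2 - <u, g>^2)] from [u].

If [k < n], the function [u = x_1 g], for the first coordinate [x_1], is
orthogonal to all of [Etilde], so its squared distance is [2 |u|^2]; as it is
the next eigenfunction, the virial identity and the inequality of arithmetic
and geometric means give [rho1 u <= |u|^2]. *)

Set Implicit Arguments.
Unset Strict Implicit.
Unset Printing Implicit Defensive.

Import Order.TTheory GRing.Theory Num.Theory.
Import numFieldNormedType.Exports.
Local Open Scope classical_set_scope.
Local Open Scope ring_scope.

(** * Square integrable functions *)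

(** Dilating [u] scales the two factors of [rho1] inversely, so the Gaussian must be fitted to [u];
    hence the free frequency.

    The oscillator of frequency [2 c] has gap [4 c] on the line and [8 c] on the half line under the
    Dirichlet condition. The smaller one governs as soon as a full line occurs among the
    coordinates. For [k = n] only half lines remain and the constant improves, which is why
    sharpness and equality are stated for [k < n].

    The gap is reached without eigenfunction expansions: in one dimension [f] is compared with the
    multiple of [g] that agrees with it at the maximum of [g], and the projection onto [g] enters
    only at the end.

    The main obstacle is that the norm of the completion does not control [u ^+ 2] near the origin,
    where the weight [|x|^2] vanishes. Square integrability of [u] comes out of the gap inequality
    itself, applied with truncated weights; pairings with [g] pass to the limit because [g / |x|] is
    square integrable, one positive coordinate in [g] cancelling [1 / |x|]. For the equality case,
    [S_grad] is an arbitrary choice of gradient, so its norm has to be shown independent of the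
    choice. *)

Section square_integrable.
Context d (T : measurableType d) (R : realType).
Variables (mu : {measure set T -> \bar R}) (D : set T).
Hypothesis mD : measurable D.
Implicit Types f g h : T -> R.

Definition square_integrable f :=
  measurable_fun D f /\ mu.-integrable D (fun x => (f x ^+ 2)%:E).

Lemma integrable_addr f g :
  mu.-integrable D (fun x => (f x)%:E) -> mu.-integrable D (fun x => (g x)%:E) ->
  mu.-integrable D (fun x => (f x + g x)%:E).
Proof.
move=> f1 g1; rewrite (_ : (fun _ => _) = ((fun x => (f x)%:E) \+ (fun x => (g x)%:E))%E).
  exact: integrableD.
by apply/funext => x /=; rewrite EFinD.
Qed.

Lemma integrable_scaler c f :
  mu.-integrable D (fun x => (f x)%:E) -> mu.-integrable D (fun x => (c * f x)%:E).
Proof.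
move=> f1; under eq_fun do rewrite EFinM.
exact: integrableZl.
Qed.

Lemma integrable_subr f g :
  mu.-integrable D (fun x => (f x)%:E) -> mu.-integrable D (fun x => (g x)%:E) ->
  mu.-integrable D (fun x => (f x - g x)%:E).
Proof.
move=> f1 g1; under eq_fun do rewrite -mulN1r.
by apply: integrable_addr => //; exact: integrable_scaler.
Qed.

Lemma integrable_dominated f g :
  measurable_fun D f -> mu.-integrable D (fun x => (g x)%:E) ->
  (forall x, D x -> `|f x| <= g x) -> mu.-integrable D (fun x => (f x)%:E).
Proof.
move=> mf ig fg; apply: (le_integrable mD _ _ ig); first exact/measurable_EFinP.
move=> x Dx /=; rewrite lee_fin (le_trans (fg x Dx))//.
by rewrite ler_norm.
Qed.

Lemma square_integrable_dot f g : square_integrable f -> square_integrable g ->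
  mu.-integrable D (fun x => (f x * g x)%:E).
Proof.
move=> [mf f2] [mg g2].
apply: (@integrable_dominated _ (fun x => f x ^+ 2 + g x ^+ 2)).
- exact: measurable_funM.
- exact: integrable_addr.
- move=> x _; rewrite ler_norml; apply/andP; split; nra.
Qed.

Lemma square_integrableD f g : square_integrable f -> square_integrable g ->
  square_integrable (fun x => f x + g x).
Proof.
move=> Lf Lg; have fg := square_integrable_dot Lf Lg.
have [mf f2] := Lf; have [mg g2] := Lg.
split; first exact: measurable_funD.
rewrite (_ : (fun _ => _) = fun x => (f x ^+ 2 + (2 * (f x * g x) + g x ^+ 2))%:E).
  by apply: integrable_addr => //; apply: integrable_addr => //; exact: integrable_scaler.
by apply/funext => x; congr (_%:E); ring.
Qed.

Lemma square_integrableZ c f : square_integrable f ->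
  square_integrable (fun x => c * f x).
Proof.
move=> [mf f2]; split; first exact: measurable_funM.
under eq_fun do rewrite exprMn; exact: integrable_scaler.
Qed.

Lemma square_integrableB f g : square_integrable f -> square_integrable g ->
  square_integrable (fun x => f x - g x).
Proof.
move=> Lf Lg; under eq_fun do rewrite -mulN1r.
by apply: square_integrableD => //; exact: square_integrableZ.
Qed.

Lemma square_integrable_dominated f g : measurable_fun D f ->
  square_integrable g -> (forall x, D x -> `|f x| <= `|g x|) -> square_integrable f.
Proof.
move=> mf [mg g2] fg; split => //; apply: integrable_dominated g2 _.
  exact: measurable_funX.
move=> x Dx; rewrite -(real_normK (num_real (g x))) normrX.
by rewrite lerXn2r ?nnegrE// fg.
Qed.

Lemma Rintegral_sqrB c e f g : square_integrable f -> square_integrable g ->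
  \int[mu]_(x in D) ((c * f x - e * g x) ^+ 2) =
  c ^+ 2 * (\int[mu]_(x in D) (f x ^+ 2)) - 2 * c * e * (\int[mu]_(x in D) (f x * g x))
  + e ^+ 2 * (\int[mu]_(x in D) (g x ^+ 2)).
Proof.
move=> Lf Lg; have fg := square_integrable_dot Lf Lg.
have [mf f2] := Lf; have [mg g2] := Lg.
rewrite (@eq_Rintegral _ _ _ _ _ (fun x => c ^+ 2 * f x ^+ 2 + (- (2 * c * e) * (f x * g x) + e ^+ 2 * g x ^+ 2))); last first.
  by move=> x _; ring.
rewrite !RintegralD ?RintegralZl//; first by ring.
all: try exact: integrable_scaler.
apply: integrable_addr; exact: integrable_scaler.
Qed.

Lemma Rintegral_sqr_ge0 f : 0 <= \int[mu]_(x in D) (f x ^+ 2).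
Proof. by apply: Rintegral_ge0 => x _; exact: sqr_ge0. Qed.

Lemma Rintegral_cauchy_schwarz f g : square_integrable f -> square_integrable g ->
  (\int[mu]_(x in D) (f x * g x)) ^+ 2 <=
  \int[mu]_(x in D) (f x ^+ 2) * \int[mu]_(x in D) (g x ^+ 2).
Proof.
move=> Lf Lg.
have H c e : 0 <= c ^+ 2 * (\int[mu]_(x in D) (f x ^+ 2)) -
    2 * c * e * (\int[mu]_(x in D) (f x * g x)) + e ^+ 2 * (\int[mu]_(x in D) (g x ^+ 2)).
  by rewrite -Rintegral_sqrB//; apply: Rintegral_ge0 => x _; exact: sqr_ge0.
move: H (Rintegral_sqr_ge0 f) (Rintegral_sqr_ge0 g).
set A := \int[mu]_(x in D) (f x ^+ 2); set B := \int[mu]_(x in D) (f x * g x).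
set C := \int[mu]_(x in D) (g x ^+ 2) => H A0 C0.
(* The form is evaluated where it factors through [A * C - B ^+ 2]. If both norms vanish, its values
   at [(1, 1)] and [(1, -1)] force [B = 0]. *)
have [C_gt0|] := ltP 0 C.
  have := H C B; rewrite (_ : _ + _ = C * (A * C - B ^+ 2)); last by ring.
  by rewrite pmulr_rge0// subr_ge0.
move=> Cle0; have C00 : C = 0 by apply/eqP; rewrite eq_le Cle0.
have [A_gt0|] := ltP 0 A.
  have := H B A; rewrite (_ : _ + _ = A * (A * C - B ^+ 2)); last by ring.
  by rewrite pmulr_rge0// subr_ge0.
move=> Ale0; have A00 : A = 0 by apply/eqP; rewrite eq_le Ale0.
have := H 1 1; have := H 1 (-1); rewrite A00 C00; move=> h1 h2.
have -> : B = 0 by lra.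
by rewrite expr0n mul0r.
Qed.

Section limit.
Variables (f_ : nat -> T -> R) (f : T -> R).
Hypothesis Lf_ : forall j, square_integrable (f_ j).

(** An extended-real integral that tends to 0 is eventually finite, so [f] is a difference of two
    square integrable functions, some [f_ j] and [f_ j - f]. The majorant [c * e_ j] allows one
    convergent quantity to control several functions: each component of a gradient, or [u] under
    various weights. *)
Lemma square_integrable_lim (e_ : nat -> T -> R) c :
  measurable_fun D f -> (forall j, measurable_fun D (e_ j)) ->
  (forall j x, D x -> (f_ j x - f x) ^+ 2 <= c * e_ j x) ->
  (fun j => \int[mu]_(x in D) (e_ j x)%:E)%E @ \oo --> 0%E -> 0 <= c ->
  (forall j x, D x -> 0 <= e_ j x) ->
  square_integrable f /\ (fun j => \int[mu]_(x in D) ((f_ j x - f x) ^+ 2)) @ \oo --> 0.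
Proof.
move=> mf me fe e0 c0 e_ge0.
have mdf j : measurable_fun D (fun x => (f_ j x - f x) ^+ 2).
  by apply: measurable_funX; apply: measurable_funB => //; case: (Lf_ j).
have lim0 : (fun j => \int[mu]_(x in D) ((f_ j x - f x) ^+ 2)%:E)%E @ \oo --> 0%E.
  apply: (@squeeze_cvge _ _ _ _ (fun=> 0%E) _ (fun j => c%:E * \int[mu]_(x in D) (e_ j x)%:E)%E).
  - apply: nearW => j; apply/andP; split.
      by apply: integral_ge0 => x _; rewrite lee_fin sqr_ge0.
    rewrite -ge0_integralZl//; last 2 first.
      by apply/measurable_EFinP.
      by move=> x Dx; rewrite lee_fin e_ge0.
    apply: ge0_le_integral => //.
    + by move=> x _; rewrite lee_fin sqr_ge0.
    + exact/measurable_EFinP.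
    + by apply/measurable_EFinP; exact: measurable_funM.
    + by move=> x Dx; rewrite lee_fin fe.
  - exact: cvg_cst.
  - by rewrite -(mule0 c%:E); apply: cvgeZl.
split; last by move/fine_cvg : lim0.
have [j _ /(_ j)] : \forall j \near \oo,
    (\int[mu]_(x in D) ((f_ j x - f x) ^+ 2)%:E < 1%:E)%E.
  move/fine_cvgP : (lim0) => [fin /cvgrPdist_lt /(_ 1 ltr01)]; move: fin.
  apply: filterS2 => j /= fin; rewrite sub0r normrN => h.
  rewrite -(fineK fin) lte_fin; exact: le_lt_trans (ler_norm _) h.
move=> /(_ (leqnn j))/= hj.
have Ld : square_integrable (fun x => f_ j x - f x).
  split; first by apply: measurable_funB => //; case: (Lf_ j).
  apply/integrableP; split; first exact/measurable_EFinP.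
  under eq_integral do rewrite /= ger0_norm ?sqr_ge0//.
  by rewrite (lt_trans hj)// ltry.
rewrite (_ : f = fun x => f_ j x - (f_ j x - f x)).
  exact: square_integrableB.
by apply/funext => x; ring.
Qed.

Hypothesis Lf : square_integrable f.
Hypothesis f_f : (fun j => \int[mu]_(x in D) ((f_ j x - f x) ^+ 2)) @ \oo --> 0.

Lemma cvg_dot h : square_integrable h ->
  (fun j => \int[mu]_(x in D) (f_ j x * h x)) @ \oo --> \int[mu]_(x in D) (f x * h x).
Proof.
move=> Lh; apply/cvgrPdist_le => e e0.
set C := \int[mu]_(x in D) (h x ^+ 2).
have C0 : 0 <= C := Rintegral_sqr_ge0 h.
(* The [+ 1] covers the case where [h] has norm 0. *)
have d0 : 0 < e ^+ 2 / (C + 1) by rewrite divr_gt0 ?exprn_gt0 ?ltr_wpDl.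
move/cvgrPdist_le : f_f => /(_ _ d0); apply: filterS => j.
rewrite sub0r normrN ger0_norm ?Rintegral_sqr_ge0// => hj.
have Ld := square_integrableB (Lf_ j) Lf.
have -> : \int[mu]_(x in D) (f x * h x) - \int[mu]_(x in D) (f_ j x * h x) =
   - \int[mu]_(x in D) ((f_ j x - f x) * h x).
  under [X in _ = - X]eq_Rintegral do rewrite mulrBl.
  by rewrite RintegralB ?opprB//; exact: square_integrable_dot.
rewrite normrN -ler_sqr ?nnegrE ?(ltW e0)// real_normK ?num_real//.
apply: (le_trans (Rintegral_cauchy_schwarz Ld Lh)).
rewrite -/C; apply: (@le_trans _ _ (e ^+ 2 / (C + 1) * C)).
  exact: ler_wpM2r.
by rewrite -mulrA ler_piMr ?sqr_ge0// ler_pdivrMl ?ltr_wpDl// mulr1 lerDl.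
Qed.

Lemma cvg_sqnorm :
  (fun j => \int[mu]_(x in D) (f_ j x ^+ 2)) @ \oo --> \int[mu]_(x in D) (f x ^+ 2).
Proof.
have -> : (fun j => \int[mu]_(x in D) (f_ j x ^+ 2)) =
  (fun j => \int[mu]_(x in D) ((f_ j x - f x) ^+ 2) +
     (2 * \int[mu]_(x in D) (f_ j x * f x) - \int[mu]_(x in D) (f x ^+ 2))).
  apply/funext => j; have := Rintegral_sqrB 1 1 (Lf_ j) Lf.
  under eq_Rintegral do rewrite !mul1r.
  move=> ->; ring.
rewrite [X in _ --> X](_ : _ = 0 + (2 * \int[mu]_(x in D) (f x * f x) - \int[mu]_(x in D) (f x ^+ 2))); last first.
  under [in RHS]eq_Rintegral do rewrite -expr2.
  ring.
apply: cvgD => //; apply: cvgB; last exact: cvg_cst.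
by apply: cvgMr; exact: cvg_dot.
Qed.

End limit.
End square_integrable.

(** * A one-dimensional spectral gap *)

Section derivation_rules.
Context {R : realType} {V : normedModType R}.
Implicit Types (f g : V -> R) (x v : V).

Lemma is_derive_mul f g x v df dg : is_derive x v f df -> is_derive x v g dg ->
  is_derive x v (fun y => f y * g y) (df * g x + f x * dg).
Proof.
move=> hf hg; apply: is_derive_eq; rewrite addrC mulrC.
by congr (_ + _); rewrite /GRing.scale/= mulrC.
Qed.

Lemma is_derive_inv f x v df : f x != 0 -> is_derive x v f df ->
  is_derive x v (fun y => (f y)^-1) (- (df / f x ^+ 2)).
Proof.
move=> fx0 [hf <-]; apply: DeriveDef; first exact: derivableV.
by rewrite deriveV//= /GRing.scale/= mulNr mulrC.
Qed.

Lemma is_derive_add f g x v df dg : is_derive x v f df -> is_derive x v g dg ->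
  is_derive x v (fun y => f y + g y) (df + dg).
Proof. exact: is_deriveD. Qed.

Lemma is_derive_opp f x v df : is_derive x v f df ->
  is_derive x v (fun y => - f y) (- df).
Proof. exact: is_deriveN. Qed.

End derivation_rules.

Section real_derivation.
Context {R : realType}.
Implicit Types (f g : R -> R) (t c : R).

Lemma is_derive_comp1 f g t df dg :
  is_derive t (1 : R) f df -> is_derive (f t) (1 : R) g dg ->
  is_derive t (1 : R) (fun s => g (f s)) (dg * df).
Proof. by move=> hf hg; exact: is_derive1_comp. Qed.

Lemma is_derive_quadratic c t :
  is_derive t (1 : R) (fun s : R => c * s ^+ 2) (c * (2 * t)).
Proof.
have h : is_derive t (1 : R) (fun s : R => s * s) (1 * t + t * 1).
  exact: (is_derive_mul (is_derive_id t 1) (is_derive_id t 1)).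
under eq_fun do rewrite expr2.
by apply: (is_derive_eq (is_derive_mul (is_derive_cst c t 1) h)); rewrite /=; ring.
Qed.

Lemma is_derive_gauss c t : is_derive t (1 : R)
  (fun s => expR (- c * s ^+ 2)) (expR (- c * t ^+ 2) * (- c * (2 * t))).
Proof.
exact: (@is_derive_comp1 _ expR _ _ _ (is_derive_quadratic _ _) (is_derive_expR _)).
Qed.

Lemma is_derive_linear c t : is_derive t (1 : R) (fun s : R => c * s) c.
Proof.
by apply: (is_derive_eq (is_derive_mul (is_derive_cst c t 1) (is_derive_id t 1)));
  rewrite /=; ring.
Qed.

End real_derivation.

Section pointwise_continuity.
Context {R : realType} {T : topologicalType}.
Implicit Types f g : T -> R.

Lemma for_continuous_cst (c : R) (t : T) : {for t, continuous (fun _ : T => c)}.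
Proof. exact: cst_continuous. Qed.

Lemma for_continuousD f g (t : T) : {for t, continuous f} -> {for t, continuous g} ->
  {for t, continuous (fun s => f s + g s)}.
Proof. exact: cvgD. Qed.

Lemma for_continuousN f (t : T) : {for t, continuous f} ->
  {for t, continuous (fun s => - f s)}.
Proof. exact: cvgN. Qed.

Lemma for_continuousM f g (t : T) : {for t, continuous f} -> {for t, continuous g} ->
  {for t, continuous (fun s => f s * g s)}.
Proof. exact: cvgM. Qed.

Lemma for_continuousX f (t : T) : {for t, continuous f} ->
  {for t, continuous (fun s => f s ^+ 2)}.
Proof. by move=> cf; exact: cvgM. Qed.

End pointwise_continuity.

Ltac solve_continuous := repeat
  lazymatch goal with
  | |- {for _, continuous (fun s => @?h s + @?k s)} => apply: (@for_continuousD _ _ h k)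
  | |- {for _, continuous (fun s => - @?h s)} => apply: (@for_continuousN _ _ h)
  | |- {for _, continuous (fun s => @?h s ^+ 2)} => apply: (@for_continuousX _ _ h)
  | |- {for _, continuous (fun s => @?h s * @?k s)} => apply: (@for_continuousM _ _ h k)
  | |- {for _, continuous (fun _ => ?c)} => exact: for_continuous_cst
  | |- _ => assumption
  end.

Section FTC.
Context {R : realType}.
Local Notation mu := (@lebesgue_measure R).
Implicit Types f : R -> R.

Lemma integrable_segment f a b : {in `[a, b], forall x : R, {for x, continuous f}} ->
  mu.-integrable `[a, b] (fun x => (f x)%:E).
Proof.
move=> cf; apply: continuous_compact_integrable; first exact: segment_compact.
by apply: continuous_in_subspaceT => x xab; apply: cf; rewrite inE in xab.
Qed.

Lemma Rintegral_derive f f' a b : a < b ->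
  {in `[a, b], forall x : R, is_derive x 1 f (f' x)} ->
  {in `[a, b], forall x : R, {for x, continuous f'}} ->
  \int[mu]_(x in `[a, b]) f' x = f b - f a.
Proof.
move=> ab df cf'.
have cf : {in `[a, b], forall x : R, {for x, continuous f}}.
  by move=> x xab; apply/differentiable_continuous/derivable1_diffP; case: (df x xab).
rewrite /Rintegral (@continuous_FTC2 _ f' f)//.
- by apply: continuous_in_subspaceT => x xab; apply: cf'; rewrite inE in xab.
- split.
  + by move=> x xab; have [] := df x (subset_itv_oo_cc xab).
  + by apply: cvg_at_right_filter; apply: cf; rewrite in_itv/= lexx ltW.
  + by apply: cvg_at_left_filter; apply: cf; rewrite in_itv/= lexx ltW.
- move=> x xab; rewrite derive1E.
  by have [_ ->] := df x (subset_itv_oo_cc xab).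
Qed.

(* With [v = f / g], [V = v - v t0] and [z] the difference quotient of [v] at
   [t0], the integrand on the right exceeds the one on the left by at least the
   derivative of [z V g^2 + f^2 L]; the margin is [(v' - z)^2 g^2]. *)
Lemma segment_spectral_gap (f f' g L L' q : R -> R) (gam a b t0 : R) :
  a < t0 < b ->
  {in `[a, b], forall t : R, is_derive t 1 f (f' t)} ->
  {in `[a, b], forall t : R, {for t, continuous f'}} ->
  {in `[a, b], forall t, 0 < g t} ->
  {in `[a, b], forall t : R, is_derive t 1 g (L t * g t)} ->
  {in `[a, b], forall t : R, is_derive t 1 L (L' t)} ->
  {in `[a, b], forall t : R, {for t, continuous L'}} ->
  {in `[a, b], forall t, L' t + L t ^+ 2 = q t} ->
  {in `[a, b], forall t, (t - t0) * (2 * L t + gam * (t - t0)) <= 0} ->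
  f a = 0 -> f b = 0 ->
  gam * \int[mu]_(t in `[a, b]) ((f t - f t0 / g t0 * g t) ^+ 2) <=
  \int[mu]_(t in `[a, b]) (f' t ^+ 2 + q t * f t ^+ 2).
Proof.
move=> /andP[at0 t0b] df cf' g0 dg dL cL' Lq Lneg fa fb.
have ab : a < b := lt_trans at0 t0b.
have contW (h h' l l' y w w' k : R -> R) (c t : R) :
    {for t, continuous h} -> {for t, continuous h'} -> {for t, continuous l} ->
    {for t, continuous l'} -> {for t, continuous y} -> {for t, continuous w} ->
    {for t, continuous w'} -> {for t, continuous k} ->
    {for t, continuous (fun t => 2 * y t * w' t * k t ^+ 2 - y t ^+ 2 * k t ^+ 2 +
      y t * (w t - c) * (2 * l t * k t ^+ 2) +
      (2 * h t * h' t * l t + h t ^+ 2 * l' t))}.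
  by move=> c1 c2 c3 c4 c5 c6 c7 c8; solve_continuous.
have derC h dh : {in `[a, b], forall t : R, is_derive t 1 h (dh t)} ->
    {in `[a, b], forall t : R, {for t, continuous (h : R -> R)}}.
  move=> dhh x xab; apply/differentiable_continuous/derivable1_diffP.
  by case: (dhh x xab).
have cf := derC _ _ df; have cg := derC _ _ dg; have cL := derC _ _ dL.
have t0ab : t0 \in `[a, b] by rewrite in_itv/= !ltW.
pose v t := f t / g t.
pose v' t := f' t / g t - f t * L t / g t.
have dv : {in `[a, b], forall t : R, is_derive t 1 v (v' t)}.
  move=> t tab; have gt := g0 t tab; have gn : g t != 0 by rewrite gt_eqF.
  rewrite /v; apply: (is_derive_eq (is_derive_mul (df t tab) (is_derive_inv gn (dg t tab)))).
  by rewrite /v'; field.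
have cv := derC _ _ dv.
have cv' : {in `[a, b], forall t : R, {for t, continuous v'}}.
  move=> t tab; have gn : g t != 0 by rewrite gt_eqF ?g0.
  apply: cvgB; apply: cvgM; try (by apply: cvgV => //; exact: cg).
    exact: cf'.
  by apply: cvgM; [exact: cf|exact: cL].
(* Caratheodory's form of the derivative extends the difference quotient continuously to [t0], with
   value [v' t0]. *)
have /is_derive1_caratheodory[z [zE zC zt0]] := dv _ t0ab.
have dz t : t \in `[a, b] -> t != t0 ->
    is_derive t 1 z ((v' t - z t) / (t - t0)).
  move=> tab tt0; have tt0' : t - t0 != 0 by rewrite subr_eq0.
  apply: (@near_eq_is_derive _ _ _ (fun s => (v s - v t0) * (s - t0)^-1)).
    have : \forall s \near t, s - t0 != 0.
      have c : (fun s => s - t0) @ t --> t - t0 by apply: cvgB; [exact: cvg_id|exact: cvg_cst].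
      exact: cvgr_neq0 c tt0'.
    by apply: filterS => s st0; rewrite zE mulfK.
  have d1 : is_derive t 1 (fun s => v s - v t0) (v' t).
    by apply: is_derive_eq; [apply: is_deriveB; exact: dv|rewrite subr0].
  have d2 : is_derive t 1 (fun s : R => s - t0) 1.
    by apply: is_derive_eq; rewrite subr0.
  have d3 := @is_derive_inv _ _ (fun s => s - t0) _ _ _ tt0' d2.
  apply: (is_derive_eq (is_derive_mul d1 d3)).
  by rewrite zE; field.
have cz : {in `[a, b], forall t : R, {for t, continuous z}}.
  move=> t tab; have [->//|tt0] := eqVneq t t0.
  apply/differentiable_continuous/derivable1_diffP.
  by case: (dz t tab tt0).
pose U t := z t * (v t - v t0) * g t ^+ 2.
pose U' t := 2 * z t * v' t * g t ^+ 2 - z t ^+ 2 * g t ^+ 2 +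
  z t * (v t - v t0) * (2 * L t * g t ^+ 2).
have dg2 t : t \in `[a, b] -> is_derive t 1 (fun s => g s ^+ 2) (2 * L t * g t ^+ 2).
  move=> tab; under eq_fun do rewrite expr2.
  apply: (is_derive_eq (is_derive_mul (dg t tab) (dg t tab))); ring.
have dU : {in `[a, b], forall t : R, is_derive t 1 U (U' t)}.
  move=> t tab; have [->|tt0] := eqVneq t t0.
    (* [f'] is only continuous, so [z] need not be differentiable at [t0]; but [U] is
       [z ^+ 2 * g ^+ 2] times [t - t0], which is. *)
    apply/is_derive1_caratheodory; exists (fun s => z s * z s * g s ^+ 2); split.
    - by move=> s; rewrite /U subrr !(mulr0, mul0r) subr0 zE; ring.
    - apply: cvgM; first by apply: cvgM; exact: cz.
      by apply: cvgM; exact: cg.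
    - by rewrite /U' subrr zt0; ring.
  have tt0' : t - t0 != 0 by rewrite subr_eq0.
  have d1 : is_derive t 1 (fun s => v s - v t0) (v' t).
    by apply: is_derive_eq; [apply: is_deriveB; exact: dv|rewrite subr0].
  apply: (is_derive_eq (is_derive_mul (is_derive_mul (dz t tab tt0) d1) (dg2 t tab))).
  by rewrite /U' zE; field.
pose W t := U t + f t * f t * L t.
pose W' t := U' t + (2 * f t * f' t * L t + f t ^+ 2 * L' t).
have dW : {in `[a, b], forall t : R, is_derive t 1 W (W' t)}.
  move=> t tab; apply: is_derive_eq.
    apply: is_deriveD; first exact: dU.
    exact: is_derive_mul (is_derive_mul (df t tab) (df t tab)) (dL t tab).
  by rewrite /W'; ring.
have cW' : {in `[a, b], forall t : R, {for t, continuous W'}}.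
  move=> t tab.
  by apply: contW; [exact: cf|exact: cf'|exact: cL|exact: cL'|exact: cz|exact: cv|exact: cv'|exact: cg].
have intW := Rintegral_derive ab dW cW'.
pose E t := f' t ^+ 2 + (L' t + L t ^+ 2) * f t ^+ 2.
pose F t := (f t - f t0 / g t0 * g t) ^+ 2.
have iF : mu.-integrable `[a, b] (fun x => (F x)%:E).
  apply: integrable_segment => t tab; have := (cf t tab, cg t tab) => -[c1 c2].
  by rewrite /F; solve_continuous.
have iE : mu.-integrable `[a, b] (fun x => (E x)%:E).
  apply: integrable_segment => t tab.
  have := (cf t tab, cf' t tab, cL t tab, cL' t tab) => -[[[c1 c2] c3] c4].
  by rewrite /E; solve_continuous.
have -> : \int[mu]_(t in `[a, b]) (f' t ^+ 2 + q t * f t ^+ 2) = \int[mu]_(t in `[a, b]) E t.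
  by apply: eq_Rintegral => t; rewrite inE/= => tab; rewrite /E Lq.
have iW : mu.-integrable `[a, b] (fun x => (W' x)%:E) by exact: integrable_segment.
(* At both ends [f] vanishes, so [W] equals [(z * g) ^+ 2 * (t - t0)] there: nonnegative at [b],
   nonpositive at [a]. *)
have W0 : 0 <= W b - W a.
  rewrite /W /U /v fa fb !mul0r !addr0 sub0r.
  have za : z a * (a - t0) = - v t0 by rewrite -zE /v fa mul0r sub0r.
  have zb : z b * (b - t0) = - v t0 by rewrite -zE /v fb mul0r sub0r.
  rewrite -{1}zb -za.
  have -> : z b * (z b * (b - t0)) * g b ^+ 2 - z a * (z a * (a - t0)) * g a ^+ 2 =
    (z b * g b) ^+ 2 * (b - t0) + (z a * g a) ^+ 2 * (t0 - a) by ring.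
  by rewrite addr_ge0// mulr_ge0// ?sqr_ge0// subr_ge0 ltW.
have mab : measurable (`[a, b] : set (measurableTypeR R)) by exact: measurable_itv.
have igF := integrable_scaler mab gam iF.
have iD := integrable_subr mab iE igF.
rewrite -subr_ge0; apply: (le_trans W0); rewrite -intW -RintegralZl//.
rewrite -RintegralB//.
apply: le_Rintegral => //.
move=> t tab; have gt := g0 t tab; have gn : g t != 0 by rewrite gt_eqF.
have g0n : g t0 != 0 by rewrite gt_eqF ?g0.
have Vz : v t = v t0 + z t * (t - t0) by rewrite -zE; ring.
rewrite -/(F t) -/(W' t).
have -> : F t = (z t * (t - t0)) ^+ 2 * g t ^+ 2.
  rewrite /F -zE /v; by field; rewrite gn g0n.
have -> : E t = v' t ^+ 2 * g t ^+ 2 + (2 * f t * f' t * L t + f t ^+ 2 * L' t).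
  by rewrite /E /v'; field.
(* Besides the square of [v' - z], the difference of the integrands contains only a multiple of
   [z ^+ 2 * g ^+ 2]; [Lneg] is the sign of its coefficient. *)
have Ln := Lneg t tab.
have h1 : 0 <= (v' t - z t) ^+ 2 * g t ^+ 2 by rewrite mulr_ge0 ?sqr_ge0.
have h2 : 0 <= z t ^+ 2 * g t ^+ 2 * - ((t - t0) * (2 * L t + gam * (t - t0))).
  by apply: mulr_ge0; [rewrite mulr_ge0 ?sqr_ge0|rewrite oppr_ge0].
rewrite /W' /U' (zE t) -subr_ge0.
rewrite [leRHS](_ : _ = (v' t - z t) ^+ 2 * g t ^+ 2 +
  z t ^+ 2 * g t ^+ 2 * - ((t - t0) * (2 * L t + gam * (t - t0)))); last by ring.
exact: addr_ge0.
Qed.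

End FTC.

(** * Gaussian integrals and one-dimensional ground states *)

Section gaussian.
Context {R : realType}.
Local Notation mu := (@lebesgue_measure R).
Local Notation RR := (measurableTypeR R).
Implicit Types (c t : R) (b : bool).

Lemma integrable_expRN_sqr c : 0 < c ->
  mu.-integrable [set: RR] (fun t => (expR (- c * t ^+ 2))%:E).
Proof.
move=> c0; pose s := Num.sqrt (2 * c)^-1.
have s2 : s ^+ 2 = (2 * c)^-1 by rewrite sqr_sqrtr// invr_ge0 mulr_ge0 ?ltW.
have s0 : s != 0 by rewrite -sqrf_eq0 s2 invr_eq0 mulf_eq0 pnatr_eq0/= gt_eqF.
have pk : normal_peak s != 0 by rewrite gt_eqF ?normal_peak_gt0.
have := @integrable_normal_pdf R 0 s.
move=> /(integrable_scaler measurableT (normal_peak s)^-1).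
apply: eq_integrable => // t _; congr (_%:E).
rewrite /normal_pdf (negbTE s0) /normal_fun mulrA mulVf// mul1r subr0 s2.
congr expR; rewrite -mulr_natr; field.
by rewrite gt_eqF.
Qed.

(** Half of the exponent absorbs the polynomial: [1 + t ^+ 2] is at most [K0 * expR y] for a small
    multiple [y] of [t ^+ 2], and the [m]-th power of [expR y] stays below
    [expR (c / 2 * t ^+ 2)]. *)
Lemma poly_expRN_sqr_ub c m : 0 < c -> exists2 K, 0 <= K &
  forall t, (1 + t ^+ 2) ^+ m * expR (- c * t ^+ 2) <= K * expR (- (c / 2) * t ^+ 2).
Proof.
(* [m + 1] instead of [m], because [y] divides by it and [m] may be 0. *)
move=> c0; set N : R := m.+1%:R; have N0 : 0 < N by rewrite ltr0n.
pose K0 := 1 + 2 * N / c.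
have K00 : 0 <= K0 by rewrite addr_ge0// divr_ge0 ?mulr_ge0 ?(ltW c0) ?(ltW N0).
exists (K0 ^+ m); first exact: exprn_ge0.
move=> t; pose y := c * t ^+ 2 / (2 * N).
have y0 : 0 <= y.
  by apply: divr_ge0; [apply: mulr_ge0; [exact: ltW|exact: sqr_ge0]|rewrite mulr_ge0].
have h1 : 1 + t ^+ 2 <= K0 * expR y.
  apply: (@le_trans _ _ (K0 * (1 + y))); last by rewrite ler_wpM2l// expR_ge1Dx.
  have ty : t ^+ 2 = 2 * N / c * y.
    by rewrite /y; field; rewrite !gt_eqF.
  rewrite ty /K0.
  have : 0 <= 2 * N / c by rewrite divr_ge0 ?mulr_ge0 ?(ltW c0) ?(ltW N0).
  by move: (_ / c) => z z0; nra.
have h2 : (1 + t ^+ 2) ^+ m <= K0 ^+ m * expR (c / 2 * t ^+ 2).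
  apply: (@le_trans _ _ ((K0 * expR y) ^+ m)).
    by rewrite lerXn2r// nnegrE ?addr_ge0 ?sqr_ge0// mulr_ge0// expR_ge0.
  rewrite exprMn ler_wpM2l ?exprn_ge0// -expRM_natl ler_expR.
  apply: (@le_trans _ _ (N * y)); first by rewrite ler_wpM2r// ler_nat.
  rewrite le_eqVlt; apply/orP; left; apply/eqP; rewrite /y; field.
  by rewrite gt_eqF.
apply: (@le_trans _ _ (K0 ^+ m * expR (c / 2 * t ^+ 2) * expR (- c * t ^+ 2))).
  by rewrite ler_wpM2r// expR_ge0.
by rewrite -mulrA -expRD ler_wpM2l ?exprn_ge0// ler_expR; lra.
Qed.

Lemma continuous_measurable_RR (f : R -> R) : continuous f ->
  measurable_fun [set: RR] (f : RR -> RR).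
Proof. exact: continuous_measurable_fun. Qed.

Lemma integrable_gaussian_bound (f : R -> R) K c m : 0 < c ->
  measurable_fun [set: RR] (f : RR -> RR) ->
  (forall t, `|f t| <= K * ((1 + t ^+ 2) ^+ m * expR (- c * t ^+ 2))) ->
  mu.-integrable [set: RR] (fun t => (f t)%:E).
Proof.
move=> c0 mf fb; have [C C0 Cb] := poly_expRN_sqr_ub m c0.
have c20 : 0 < c / 2 by rewrite divr_gt0.
have iK := integrable_scaler measurableT (`|K| * C) (integrable_expRN_sqr c20).
apply: (integrable_dominated measurableT mf iK) => t _.
apply: (le_trans (fb t)); rewrite -mulrA.
have h0 : 0 <= (1 + t ^+ 2) ^+ m * expR (- c * t ^+ 2).
  by rewrite mulr_ge0 ?expR_ge0 ?exprn_ge0 ?addr_ge0 ?sqr_ge0.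
apply: (@le_trans _ _ (`|K| * ((1 + t ^+ 2) ^+ m * expR (- c * t ^+ 2)))).
  by rewrite ler_wpM2r// ler_norm.
by rewrite ler_wpM2l.
Qed.

Lemma Rintegral_odd (f : R -> R) : mu.-integrable [set: RR] (fun t => (f t)%:E) ->
  (forall t, f (- t) = - f t) -> \int[mu]_t f t = 0.
Proof.
move=> intf fN.
have mN : measurable_fun [set: RR] (-%R : RR -> RR) by exact: oppr_measurable.
have mf := measurable_int mu intf.
have intfN : mu.-integrable [set: RR] ((fun t => (f t)%:E) \o (-%R : RR -> RR)).
  apply: (@eq_integrable _ _ _ _ _ measurableT (fun t : RR => (-1 * f t)%:E)).
    by move=> t _ /=; rewrite fN mulN1r.
  exact: integrable_scaler.
have h : (\int[mu]_t (f t)%:E = \int[mu]_t (- f t)%:E)%E.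
  transitivity (\int[pushforward mu (-%R : RR -> RR)]_t (f t)%:E)%E.
    by apply: eq_measure_integral => //= A mA _; apply/esym/lebesgue_measureN.
  rewrite integral_pushforward//.
  by apply: eq_integral => t _ /=; rewrite fN.
have : \int[mu]_t f t = - \int[mu]_t f t.
  rewrite -mulN1r -RintegralZl// {1}/Rintegral h /Rintegral.
  by congr fine; apply: eq_integral => t _; rewrite mulN1r.
by lra.
Qed.

Lemma continuous_gauss c : continuous (fun t : R => expR (- c * t ^+ 2)).
Proof.
move=> t; apply: (@continuous_comp _ _ _ (fun t => - c * t ^+ 2) expR).
  by apply: cvgM; [exact: cvg_cst|exact: exprn_continuous].
exact: continuous_expR.
Qed.

(* The factor [t] is cut off at negative [t], so that integrals over the half
   line become integrals over the whole line. *)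
Definition profile b c t : R := (if b then Num.max t 0 else 1) * expR (- c * t ^+ 2).

Lemma continuous_profile b c : continuous (profile b c).
Proof.
move=> t; apply: cvgM; last exact: continuous_gauss.
case: b; last exact: cvg_cst.
by apply: continuous_max; [exact: cvg_id|exact: cvg_cst].
Qed.

Lemma profile_ge0 b c t : 0 <= profile b c t.
Proof. by rewrite mulr_ge0 ?expR_ge0//; case: b; rewrite // le_max lexx orbT. Qed.

Lemma profile_le b c t : profile b c t <= (1 + t ^+ 2) * expR (- c * t ^+ 2).
Proof.
rewrite ler_wpM2r ?expR_ge0//; case: b.
  rewrite ge_max; apply/andP; split; nra.
by rewrite lerDl sqr_ge0.
Qed.

Lemma profile_pos b c t : (b -> 0 < t) ->
  profile b c t = (if b then t else 1) * expR (- c * t ^+ 2).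
Proof. by rewrite /profile; case: b => //= /(_ isT) t0; rewrite max_l// ltW. Qed.

Lemma profile_gt0 b c t : (b -> 0 < t) -> 0 < profile b c t.
Proof.
move=> bt; rewrite profile_pos// mulr_gt0 ?expR_gt0//.
by case: b bt => //; exact.
Qed.

Lemma profile_le0 c t : t <= 0 -> profile true c t = 0.
Proof. by move=> t0; rewrite /profile max_r// mul0r. Qed.

Lemma sqr_gaussian c (x K t : R) : 0 <= x <= K * expR (- c * t ^+ 2) ->
  x ^+ 2 <= K ^+ 2 * expR (- (2 * c) * t ^+ 2).
Proof.
move=> /andP[x0 xK]; apply: (@le_trans _ _ ((K * expR (- c * t ^+ 2)) ^+ 2)).
  by rewrite lerXn2r// nnegrE// (le_trans x0).
rewrite exprMn -expRM_natl (_ : 2%:R * (- c * t ^+ 2) = - (2 * c) * t ^+ 2)//; ring.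
Qed.

Lemma square_integrable_profile b c : 0 < c -> square_integrable mu [set: RR] (profile b c).
Proof.
move=> c0; have mp := continuous_measurable_RR (@continuous_profile b c).
split=> //; apply: (@integrable_gaussian_bound _ 1 (2 * c) 2).
- by rewrite mulr_gt0.
- exact: measurable_funX.
- move=> t; rewrite mul1r ger0_norm ?sqr_ge0//; apply: sqr_gaussian.
  by rewrite profile_ge0 profile_le.
Qed.

Lemma profile_sqnorm_gt0 b c : 0 < c -> 0 < \int[mu]_t (profile b c t ^+ 2).
Proof.
move=> c0; have [mp ip] := square_integrable_profile b c0.
(* On [[1, 2]] the linear factor is at least 1 and [t ^+ 2] is at most 4, so the profile is at least
   [expR (- (4 * c))]. *)
have c1 : 0 < expR (- (4 * c)) ^+ 2 by rewrite exprn_gt0 ?expR_gt0.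
have m12 : measurable (`[1, 2] : set RR) by exact: measurable_itv.
apply: (@lt_le_trans _ _ (expR (- (4 * c)) ^+ 2 * (\int[mu]_(t in `[1, 2]) 1))).
  rewrite mulr_gt0// /Rintegral integral_cst// mul1e.
  have := @lebesgue_measure_itv R `[1, 2]; rewrite /= lte_fin ltr1n.
  by move=> ->; rewrite -EFinB/= subr_gt0 ltr1n.
have i1 : mu.-integrable `[1, 2] (fun=> 1%:E).
  by apply: integrable_segment => t _; exact: for_continuous_cst.
rewrite -RintegralZl//.
apply: (@le_trans _ _ (\int[mu]_(t in `[1, 2]) (profile b c t ^+ 2))).
  apply: le_Rintegral => //.
  - exact: integrable_scaler.
  - exact: integrableS ip.
  - move=> t /=; rewrite in_itv/= => /andP[t1 t2].
    rewrite mulr1 lerXn2r ?nnegrE ?expR_ge0 ?profile_ge0// profile_pos; last first.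
      by move=> _; exact: lt_le_trans t1.
    apply: (@le_trans _ _ (1 * expR (- c * t ^+ 2))).
      have t4 : t ^+ 2 <= 4 by nra.
      by rewrite mul1r ler_expR; nra.
    by rewrite ler_wpM2r ?expR_ge0//; case: (b).
rewrite [leRHS](_ : _ = \int[mu]_t (profile b c t ^+ 2))//.
rewrite Rintegral_mkcond; apply: le_Rintegral => //.
  rewrite -restrict_EFin; apply: (integrable_mkcond _ m12).1.
  exact: (integrableS measurableT m12 (@subsetT _ _) ip).
by move=> t _; rewrite /patch; case: ifP => // _; exact: sqr_ge0.
Qed.

End gaussian.

(** * The spectral gap on the line and on the half line *)

Section profile_gap.
Context {R : realType}.
Local Notation mu := (@lebesgue_measure R).
Local Notation RR := (measurableTypeR R).

Lemma integrable_compact_support (h : R -> R) M : continuous h ->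
  (forall t, h t != 0 -> `|t| <= M) -> mu.-integrable [set: RR] (fun t => (h t)%:E).
Proof.
move=> ch hM; have mM : measurable (`[- M, M] : set RR) by exact: measurable_itv.
have -> : (fun t : RR => (h t)%:E) = (fun t : RR => (h t)%:E) \_ `[- M, M].
  apply/funext => t; rewrite /patch; case: ifPn => //.
  rewrite notin_setE/= in_itv/= => tM; have [->//|/hM] := eqVneq (h t) 0.
  by rewrite ler_norml.
apply/(integrable_mkcond _ mM); apply: integrable_segment => t _; exact: ch.
Qed.

(* The ground state energy of [- d^2/dt^2 + (2 c t)^2] is [2 c] on the line and
   [6 c] on the half line with Dirichlet condition. *)
Definition ground_energy (b : bool) (c : R) : R := if b then 6 * c else 2 * c.

(** The profile does not have compact support, so the estimate on a segment is applied to an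
    exhausting sequence. Once a segment contains the support of [f], its right side no longer
    changes, while its left side grows to the integral over the line or half line by monotone
    convergence. On the half line the segments keep away from 0, where the logarithmic derivative of
    the profile is singular. *)
Theorem profile_gap (b : bool) (c M d : R) (f f' : R -> R) : 0 < c -> 0 < d ->
  (forall t : R, is_derive t 1 f (f' t)) -> continuous f' ->
  (forall t, f t != 0 -> `|t| <= M /\ (b -> d <= t)) ->
  (forall t, f' t != 0 -> `|t| <= M /\ (b -> d <= t)) ->
  4 * c * (\int[mu]_t (f t ^+ 2) -
     (\int[mu]_t (f t * profile b c t)) ^+ 2 / \int[mu]_t (profile b c t ^+ 2)) <=
  \int[mu]_t (f' t ^+ 2 + ((2 * c * t) ^+ 2 - ground_energy b c) * f t ^+ 2).
Proof.
move=> c0 d0 df cf' fM f'M.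
have cf : continuous f.
  by move=> t; apply/differentiable_continuous/derivable1_diffP; case: (df t).
set g := profile b c; set Z := \int[mu]_t (g t ^+ 2).
have Z0 : 0 < Z := profile_sqnorm_gt0 b c0.
have Lg : square_integrable mu [set: RR] g := square_integrable_profile b c0.
have Lf : square_integrable mu [set: RR] f.
  split; first exact: continuous_measurable_RR.
  apply: (@integrable_compact_support _ M).
    by move=> t; apply: for_continuousX; exact: cf.
  by move=> t; rewrite sqrf_eq0 => /fM[].
(* The maximum point of [g], where its logarithmic derivative [L] vanishes. *)
pose t0 : R := if b then (Num.sqrt (2 * c))^-1 else 0.
have sc0 : 0 < Num.sqrt (2 * c) by rewrite sqrtr_gt0 mulr_gt0.
have sc2 : Num.sqrt (2 * c) ^+ 2 = 2 * c by rewrite sqr_sqrtr// mulr_ge0// ltW.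
pose kap := f t0 / g t0.
pose E t := f' t ^+ 2 + ((2 * c * t) ^+ 2 - ground_energy b c) * f t ^+ 2.
pose am (m : nat) : R := if b then m.+1%:R^-1 else - m.+1%:R.
pose bm (m : nat) : R := m.+1%:R.
pose L (t : R) := (if b then t^-1 else 0) - 2 * c * t.
pose L' (t : R) := (if b then - (t ^+ 2)^-1 else 0) - 2 * c.
have seg m : am m < t0 < bm m -> M < bm m -> am m < (if b then d else - M) ->
    4 * c * \int[mu]_(t in `[am m, bm m]) ((f t - kap * g t) ^+ 2) <= \int[mu]_t E t.
  move=> mt0 mM md.
  have pos t : t \in `[am m, bm m] -> b -> 0 < t.
    rewrite in_itv/= /am => /andP[+ _]; case: (b) => // h _.
    by apply: lt_le_trans h; rewrite invr_gt0.
  have mab : measurable (`[am m, bm m] : set RR) by exact: measurable_itv.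
  have supp t : `|t| <= M /\ (b -> d <= t) -> t \in `[am m, bm m].
    move=> [tM bd]; rewrite in_itv/=; apply/andP; split.
      apply/(le_trans (ltW md)); case: (b) bd => [->//|_].
      by move: tM; rewrite ler_norml => /andP[].
    by rewrite (le_trans _ (ltW mM))// (le_trans _ tM)// ler_norm.
  have E_out t : t \notin `[am m, bm m] -> f t = 0 /\ f' t = 0.
    move=> tm; split; apply/eqP; apply: contraNT tm.
      by move=> /fM; exact: supp.
    by move=> /f'M; exact: supp.
  have fab : f (am m) = 0 /\ f (bm m) = 0.
    split; apply/eqP; apply/negPn/negP => /fM[].
      move=> + bd; move: md; case: (b) bd => [/(_ isT)|_].
        by move=> h1 h2; lra.
      by rewrite ler_norml => h1 /andP[h2 h3]; lra.
    by move=> /(le_trans (ler_norm _)); rewrite leNgt mM.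
  have -> : \int[mu]_t E t = \int[mu]_(t in `[am m, bm m]) E t.
    rewrite [RHS]Rintegral_mkcond; apply: eq_Rintegral => t _.
    rewrite /patch; case: ifPn => //; rewrite notin_setE/= => /negP/E_out[h1 h2].
    by rewrite /E h1 h2 !expr0n/= mulr0 addr0.
  have t0ab : t0 \in `[am m, bm m] by case/andP: mt0 => h1 h2; rewrite in_itv/= !ltW.
  have dg0 (t : R) : is_derive t 1 (fun s => (if b then s else 1) * expR (- c * s ^+ 2))
      ((if b then 1 else 0) * expR (- c * t ^+ 2) +
       (if b then t else 1) * (expR (- c * t ^+ 2) * (- c * (2 * t)))).
    apply: is_derive_mul.
      by case: (b); [exact: is_derive_id|exact: is_derive_cst].
    exact: is_derive_gauss.
  have dg (t : R) : t \in `[am m, bm m] -> is_derive t (1 : R) g (L t * g t).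
    move=> tab; have tpos := pos t tab.
    apply: (@near_eq_is_derive _ _ _ (fun s : R => (if b then s else 1) * expR (- c * s ^+ 2))).
      case bE : b tpos => tpos; last by near=> s; rewrite /g profile_pos ?bE.
      near=> s; rewrite /g profile_pos bE// => _.
      by near: s; apply: lt_nbhsr; exact: tpos.
    apply: (is_derive_eq (dg0 t)); rewrite /g profile_pos// /L.
    case bE : b tpos => tpos; last by ring.
    by field; rewrite gt_eqF// tpos.
  have := @segment_spectral_gap R f f' g L L' (fun t => (2 * c * t) ^+ 2 - ground_energy b c)
    (4 * c) (am m) (bm m) t0 mt0.
  apply.
  - by move=> t tab; exact: df.
  - by move=> t tab; exact: cf'.
  - by move=> t tab; apply: profile_gt0; exact: pos.
  - by move=> t tab; exact: dg.
  - move=> t tab; have tpos := pos t tab.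
    have d1 : is_derive t (1 : R) (fun s : R => if b then s^-1 else 0)
        (if b then - (t ^+ 2)^-1 else 0).
      case bE : b tpos => tpos; last exact: is_derive_cst.
      have tn : t != 0 by rewrite gt_eqF// tpos.
      have h := @is_derive_inv _ _ id _ _ _ tn (is_derive_id t 1).
      by apply: (is_derive_eq h); rewrite mul1r.
    exact: (is_derive_add d1 (is_derive_opp (is_derive_linear (2 * c) t))).
  - move=> t tab; have tpos := pos t tab; rewrite /L'.
    apply: for_continuousD; last by exact: for_continuous_cst.
    case bE : b tpos => tpos; last exact: for_continuous_cst.
    have tn : t != 0 by rewrite gt_eqF// tpos.
    apply: for_continuousN; apply: cvgV; first by rewrite sqrf_eq0.
    by apply: for_continuousX; exact: cvg_id.
  - move=> t tab; have tpos := pos t tab; rewrite /L' /L /ground_energy.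
    case bE : b tpos => tpos; last by ring.
    by field; rewrite gt_eqF// tpos.
  (* On the line the two terms cancel identically, which is what limits the gap to [4 * c]; on the
     half line a negative multiple of [(t - t0) ^+ 2 / t] is left. *)
  - move=> t tab; have tpos := pos t tab; rewrite /L /t0.
    case bE : b tpos => tpos; last first.
      by rewrite subr0 le_eqVlt; apply/orP; left; apply/eqP; ring.
    have tp : 0 < t by exact: tpos.
    move: sc0 sc2; set s := Num.sqrt _ => s0 s2.
    have -> : c = s ^+ 2 / 2 by rewrite s2; field.
    have -> : (t - s^-1) * (2 * (t^-1 - 2 * (s ^+ 2 / 2) * t) + 4 * (s ^+ 2 / 2) * (t - s^-1)) =
        - (2 * s * (t - s^-1) ^+ 2 / t).
      by field; rewrite !gt_eqF.
    rewrite oppr_le0; apply: divr_ge0; last exact: ltW.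
    by rewrite mulr_ge0 ?sqr_ge0// mulr_ge0// ltW.
  - by case: fab.
  - by case: fab.
have ev : \forall m \near \oo, am m < t0 < bm m /\ (M < bm m /\ am m < (if b then d else - M)).
  have big (x : R) : \forall m \near \oo, x < m.+1%:R :> R.
    near=> m; rewrite -natr1; apply: (@lt_trans _ _ (m%:R)); last by rewrite ltrDl.
    by near: m; exact: nbhs_infty_gtr.
  have small (x : R) : 0 < x -> \forall m \near \oo, m.+1%:R^-1 < x :> R.
    by move=> x0; exact: near_infty_natSinv_lt (PosNum x0).
  near=> m; split; [apply/andP; split|split].
  - rewrite /am /t0; case bE : b.
      by near: m; apply: small; rewrite invr_gt0.
    by rewrite oppr_lt0.
  - by near: m; exact: big.
  - by near: m; exact: big.
  - rewrite /am; case bE : b; first by near: m; exact: small.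
    by rewrite ltrN2; near: m; exact: big.
have LfB : square_integrable mu [set: RR] (fun t => f t - kap * g t).
  by apply: square_integrableB => //; exact: square_integrableZ.
have bigE : \bigcup_m `[am m, bm m]%classic = [set t | b -> 0 < t].
  apply/seteqP; split => t /=.
    move=> [m _]; rewrite /= in_itv/= => /andP[h _]; move: h; rewrite /am; case: (b) => // h _.
    by apply: lt_le_trans h; rewrite invr_gt0.
  move=> tpos; have big (x : R) : \forall m \near \oo, x < m.+1%:R :> R.
    near=> m; rewrite -natr1; apply: (@lt_trans _ _ (m%:R)); last by rewrite ltrDl.
    by near: m; exact: nbhs_infty_gtr.
  have amt : \forall m \near \oo, am m <= t.
    rewrite /am; case bE : b; last first.
      by near=> m; rewrite lerNl ltW//; near: m; exact: big.
    have tp := tpos bE.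
    by near=> m; rewrite ltW//; near: m; exact: (near_infty_natSinv_lt (PosNum tp)).
  have tbm : \forall m \near \oo, t <= bm m.
    by near=> m; rewrite ltW//; near: m; exact: big.
  have : \forall m \near \oo, am m <= t <= bm m.
    by near=> m; apply/andP; split; near: m.
  move=> [m _ /(_ m (leqnn _)) h]; exists m => //.
have lim_le : \int[mu]_t ((f t - kap * g t) ^+ 2) <= (\int[mu]_t E t) / (4 * c).
  have mf2 : measurable_fun [set: RR] (fun t => ((f t - kap * g t) ^+ 2)%:E).
    by apply/measurable_EFinP; apply: measurable_funX; case: LfB.
  have half : (\int[mu]_t ((f t - kap * g t) ^+ 2)%:E =
      \int[mu]_(t in \bigcup_m `[am m, bm m]%classic) ((f t - kap * g t) ^+ 2)%:E)%E.
    rewrite [RHS]integral_mkcond; apply: eq_integral => t _.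
    rewrite bigE /patch; case: ifPn => //; rewrite notin_setE/= => tneg.
    have [bT t_le0] : b /\ t <= 0.
      case bE : b tneg => tneg; last by exfalso; apply: tneg.
      by split => //; rewrite leNgt; apply/negP => tp; apply: tneg.
    have -> : f t = 0.
      by apply/eqP; apply/negPn/negP => /fM[_ /(_ bT)] dt; lra.
    by rewrite /g bT profile_le0// mulr0 subr0 expr0n.
  rewrite -lee_fin {1}/Rintegral fineK; last first.
    exact: integrable_fin_num (LfB.2).
  rewrite half; apply: (@cvge_le _ _ eventually_filter _ (fun m => \int[mu]_(t in `[am m, bm m]) ((f t - kap * g t) ^+ 2)%:E)%E); last first.
    apply: ge0_nondecreasing_set_cvg_integral => //.
    - move=> m m' mm'; apply/subsetPset; apply: subset_itvScc => //; rewrite ?bnd_simp /am /bm.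
        case: (b); first by rewrite lef_pV2 ?posrE// ler_nat.
        by rewrite lerN2 ler_nat.
      by rewrite ler_nat.
    - by move=> m; apply: (measurable_funS _ _ mf2).
    - by move=> m t _; rewrite lee_fin sqr_ge0.
  near=> m.
  have [h1 [h2 h3]] : am m < t0 < bm m /\ (M < bm m /\ am m < (if b then d else - M)).
    by near: m.
  have := seg m h1 h2 h3; rewrite mulrC -ler_pdivlMr ?mulr_gt0// -lee_fin {1}/Rintegral fineK//.
  by apply: integrable_fin_num => //; apply: integrableS LfB.2.
have := Rintegral_sqrB measurableT 1 kap Lf Lg.
under eq_Rintegral do rewrite mul1r.
rewrite -/Z -/E => h; move: lim_le; rewrite h ler_pdivlMr ?mulr_gt0//.
set I2 := \int[mu]_t (f t ^+ 2); set B := \int[mu]_t (f t * g t) => le1.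
apply: le_trans le1; rewrite mulrC ler_pM2r ?mulr_gt0//.
(* The coefficient [kap] read off at [t0] gives way to the optimal one, [B / Z], which minimizes the
   distance from [f] to the multiples of [g]. *)
rewrite -subr_ge0 [leRHS](_ : _ = (kap * Z - B) ^+ 2 / Z); last by field; rewrite gt_eqF.
by rewrite divr_ge0 ?sqr_ge0 ?(ltW Z0).
Unshelve. all: by end_near. Qed.

End profile_gap.

(** * Tensorization *)

Section dot_product.
Context d (T : measurableType d) (R : realType).
Variables (mu : {measure set T -> \bar R}) (D : set T).
Hypothesis mD : measurable D.
Implicit Types f g h : T -> R.

Lemma Rintegral_dotBl f g h : square_integrable mu D f -> square_integrable mu D g ->
  square_integrable mu D h ->
  \int[mu]_(x in D) ((f x - g x) * h x) =
  \int[mu]_(x in D) (f x * h x) - \int[mu]_(x in D) (g x * h x).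
Proof.
move=> Lf Lg Lh; under eq_Rintegral do rewrite mulrBl.
by rewrite RintegralB//; exact: square_integrable_dot.
Qed.

Lemma Rintegral_dotZl c f h : square_integrable mu D f -> square_integrable mu D h ->
  \int[mu]_(x in D) (c * f x * h x) = c * \int[mu]_(x in D) (f x * h x).
Proof.
move=> Lf Lh; under eq_Rintegral do rewrite -mulrA.
by rewrite RintegralZl//; exact: square_integrable_dot.
Qed.

Lemma Rintegral_dotC f h :
  \int[mu]_(x in D) (f x * h x) = \int[mu]_(x in D) (h x * f x).
Proof. by apply: eq_Rintegral => x _; rewrite mulrC. Qed.

End dot_product.

Section product.
Context d1 d2 (T1 : measurableType d1) (T2 : measurableType d2) (R : realType).
Variable m1 : {sigma_finite_measure set T1 -> \bar R}.
Variable m2 : {sigma_finite_measure set T2 -> \bar R}.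
Implicit Types (F : T1 * T2 -> R).

Local Notation m := (m1 \x m2)%E.

(** Every slice, not only almost every one, is assumed integrable, so that the real-valued inner
    integral agrees with the extended one at each point and the two forms of Fubini's theorem
    coincide literally. *)
Lemma Rintegral_prod1 F : m.-integrable setT (fun z => (F z)%:E) ->
  (forall x, m2.-integrable setT (fun y => (F (x, y))%:E)) ->
  m1.-integrable setT (fun x => (\int[m2]_y F (x, y))%:E) /\
  \int[m]_z F z = \int[m1]_x \int[m2]_y F (x, y).
Proof.
move=> iF iFx.
have e : fubini_F m2 (fun z => (F z)%:E) = fun x => (\int[m2]_y F (x, y))%:E.
  apply/funext => x; rewrite /fubini_F /Rintegral fineK//.
  exact: integrable_fin_num.
split; first by rewrite -e; exact: integrable_fubini_F.
by rewrite {1}/Rintegral -integral12_prod_meas1// e.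
Qed.

Lemma Rintegral_prod2 F : m.-integrable setT (fun z => (F z)%:E) ->
  (forall y, m1.-integrable setT (fun x => (F (x, y))%:E)) ->
  m2.-integrable setT (fun y => (\int[m1]_x F (x, y))%:E) /\
  \int[m]_z F z = \int[m2]_y \int[m1]_x F (x, y).
Proof.
move=> iF iFy.
have e : fubini_G m1 (fun z => (F z)%:E) = fun y => (\int[m1]_x F (x, y))%:E.
  apply/funext => y; rewrite /fubini_G /Rintegral fineK//.
  exact: integrable_fin_num.
have mF := measurable_int m iF.
split; last by rewrite {1}/Rintegral -integral21_prod_meas1// e.
rewrite -e; apply/integrableP; split; first exact: (measurable_fubini_G iF).
apply: le_lt_trans ((integrable21ltyP m1 m2 mF).1 iF).
apply: ge0_le_integral => //.
- by apply: measurableT_comp => //; exact: (measurable_fubini_G iF).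
- apply: (@measurable_fun_fubini_tonelli_G _ _ _ _ _ m1 (fun z => `|(F z)%:E|%E)) => //.
  exact: measurableT_comp.
- move=> y _; apply: le_abse_integral => //.
  exact: measurable_int (iFy y).
Qed.

Lemma integrable_tensor (f : T1 -> R) (g : T2 -> R) :
  m1.-integrable setT (fun x => (f x)%:E) -> m2.-integrable setT (fun y => (g y)%:E) ->
  m.-integrable setT (fun z => (f z.1 * g z.2)%:E) /\
  \int[m]_z (f z.1 * g z.2) = (\int[m1]_x f x) * (\int[m2]_y g y).
Proof.
move=> if1 ig.
have mf : measurable_fun setT f by apply/measurable_EFinP; exact: measurable_int if1.
have mg : measurable_fun setT g by apply/measurable_EFinP; exact: measurable_int ig.
have mF : measurable_fun setT (fun z : T1 * T2 => (f z.1 * g z.2)%:E).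
  apply/measurable_EFinP; apply: measurable_funM.
    exact: (measurableT_comp mf measurable_fst).
  exact: (measurableT_comp mg measurable_snd).
have iF : m.-integrable setT (fun z => (f z.1 * g z.2)%:E).
  apply/integrable12ltyP => //=.
  have -> : (\int[m1]_x \int[m2]_y `|f x * g y|%:E)%E =
      ((\int[m1]_x `|f x|%:E) * (\int[m2]_y `|g y|%:E))%E.
    have g0 : (0 <= \int[m2]_y `|g y|%:E)%E by apply: integral_ge0 => y _; rewrite lee_fin.
    rewrite -ge0_integralZr//; last by apply/measurable_EFinP; exact: measurableT_comp.
    apply: eq_integral => x _; rewrite -ge0_integralZl//; last first.
      by apply/measurable_EFinP; exact: measurableT_comp.
    by apply: eq_integral => y _; rewrite -EFinM normrM.
  move/integrableP : if1 => [_ if1]; move/integrableP : ig => [_ ig].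
  by rewrite lte_mul_pinfty//; [exact: integral_ge0|rewrite ge0_fin_numE//; exact: integral_ge0].
split=> //; have [|_ ->] := Rintegral_prod1 iF; first by move=> x /=; exact: (integrable_scaler measurableT).
rewrite (@eq_Rintegral _ _ _ m1 _ (fun x => f x * \int[m2]_y g y)) ?RintegralZr// => x _.
by rewrite /= RintegralZl.
Qed.

Lemma square_integrable_tensor (f : T1 -> R) (g : T2 -> R) :
  square_integrable m1 setT f -> square_integrable m2 setT g ->
  square_integrable m setT (fun z => f z.1 * g z.2).
Proof.
move=> [mf f2] [mg g2]; split.
  apply: measurable_funM.
    exact: (measurableT_comp mf measurable_fst).
  exact: (measurableT_comp mg measurable_snd).
under eq_fun do rewrite exprMn.
by case: (integrable_tensor f2 g2).
Qed.

Section tensorization.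
Variables (F : T1 * T2 -> R) (g : T1 -> R) (h : T2 -> R).
Hypothesis LF : square_integrable m setT F.
Hypothesis LF1 : forall x, square_integrable m2 setT (fun y => F (x, y)).
Hypothesis LF2 : forall y, square_integrable m1 setT (fun x => F (x, y)).
Hypothesis Lg : square_integrable m1 setT g.
Hypothesis Lh : square_integrable m2 setT h.
Hypothesis g1 : \int[m1]_x (g x ^+ 2) = 1.
Hypothesis h1 : \int[m2]_y (h y ^+ 2) = 1.

Let chi x := \int[m2]_y (F (x, y) * h y).
Let psi y := \int[m1]_x (F (x, y) * g x).

Lemma square_integrable_partial1 : square_integrable m1 setT chi /\
  \int[m1]_x (chi x ^+ 2) <= \int[m1]_x \int[m2]_y (F (x, y) ^+ 2).
Proof.
have [iF2 _] := Rintegral_prod1 LF.2 (fun x => (LF1 x).2).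
have mF := LF.1.
have mchi : measurable_fun setT chi.
  (* Polarization: [chi] is a difference of integrals of squares, to which the measurability part of
     Tonelli's theorem applies. *)
  have chiE : chi = fun x => 4^-1 * \int[m2]_y ((1 * F (x, y) - (-1) * h y) ^+ 2) -
      4^-1 * \int[m2]_y ((1 * F (x, y) - 1 * h y) ^+ 2).
    by apply/funext => x; rewrite !(Rintegral_sqrB measurableT _ _ (LF1 x) Lh) /chi; field.
  have mh2 : measurable_fun setT (fun z : T1 * T2 => h z.2) := measurableT_comp Lh.1 measurable_snd.
  rewrite chiE; apply: measurable_funB; apply: measurable_funM => //; apply: measurableT_comp => //.
    apply: (@measurable_fun_fubini_tonelli_F _ _ _ _ _ m2 (fun z => ((1 * F z - (-1) * h z.2) ^+ 2)%:E)).
      apply/measurable_EFinP; apply: measurable_funX; apply: measurable_funB; exact: measurable_funM.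
    by move=> z; rewrite lee_fin sqr_ge0.
  apply: (@measurable_fun_fubini_tonelli_F _ _ _ _ _ m2 (fun z => ((1 * F z - 1 * h z.2) ^+ 2)%:E)).
    apply/measurable_EFinP; apply: measurable_funX; apply: measurable_funB; exact: measurable_funM.
  by move=> z; rewrite lee_fin sqr_ge0.
have cs x : chi x ^+ 2 <= \int[m2]_y (F (x, y) ^+ 2).
  by have := Rintegral_cauchy_schwarz measurableT (LF1 x) Lh; rewrite h1 mulr1.
have ichi : m1.-integrable setT (fun x => (chi x ^+ 2)%:E).
  apply: (integrable_dominated measurableT _ iF2); first exact: measurable_funX.
  by move=> x _; rewrite ger0_norm ?sqr_ge0.
by split => //; apply: le_Rintegral.
Qed.

Lemma square_integrable_partial2 : square_integrable m2 setT psi /\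
  \int[m2]_y (psi y ^+ 2) <= \int[m2]_y \int[m1]_x (F (x, y) ^+ 2).
Proof.
have [iF2 _] := Rintegral_prod2 LF.2 (fun y => (LF2 y).2).
have mF := LF.1.
have mpsi : measurable_fun setT psi.
  have psiE : psi = fun y => 4^-1 * \int[m1]_x ((1 * F (x, y) - (-1) * g x) ^+ 2) -
      4^-1 * \int[m1]_x ((1 * F (x, y) - 1 * g x) ^+ 2).
    by apply/funext => y; rewrite !(Rintegral_sqrB measurableT _ _ (LF2 y) Lg) /psi; field.
  have mg2 : measurable_fun setT (fun z : T1 * T2 => g z.1) := measurableT_comp Lg.1 measurable_fst.
  rewrite psiE; apply: measurable_funB; apply: measurable_funM => //; apply: measurableT_comp => //.
    apply: (@measurable_fun_fubini_tonelli_G _ _ _ _ _ m1 (fun z => ((1 * F z - (-1) * g z.1) ^+ 2)%:E)).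
      apply/measurable_EFinP; apply: measurable_funX; apply: measurable_funB; exact: measurable_funM.
    by move=> z; rewrite lee_fin sqr_ge0.
  apply: (@measurable_fun_fubini_tonelli_G _ _ _ _ _ m1 (fun z => ((1 * F z - 1 * g z.1) ^+ 2)%:E)).
    apply/measurable_EFinP; apply: measurable_funX; apply: measurable_funB; exact: measurable_funM.
  by move=> z; rewrite lee_fin sqr_ge0.
have cs y : psi y ^+ 2 <= \int[m1]_x (F (x, y) ^+ 2).
  by have := Rintegral_cauchy_schwarz measurableT (LF2 y) Lg; rewrite g1 mulr1.
have ipsi : m2.-integrable setT (fun y => (psi y ^+ 2)%:E).
  apply: (integrable_dominated measurableT _ iF2); first exact: measurable_funX.
  by move=> y _; rewrite ger0_norm ?sqr_ge0.
by split => //; apply: le_Rintegral.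
Qed.

(* With [P] and [Q] the orthogonal projections onto the functions of the form
   [g x * psi y] and [chi x * h y], the right side minus the left side is the
   square of the norm of [(1 - P) (1 - Q) F]. *)
Lemma tensorization :
  \int[m1]_x (chi x ^+ 2) + \int[m2]_y (psi y ^+ 2) <=
  \int[m]_z (F z ^+ 2) + (\int[m]_z (F z * (g z.1 * h z.2))) ^+ 2.
Proof.
have [Lchi _] := square_integrable_partial1; have [Lpsi _] := square_integrable_partial2.
have Lgp := square_integrable_tensor Lg Lpsi.
have Lch := square_integrable_tensor Lchi Lh.
have Lgh := square_integrable_tensor Lg Lh.
have mT := @measurableT _ (T1 * T2)%type.
set K := \int[m]_z (F z * (g z.1 * h z.2)).
have dotE (p p' : T1 -> R) (q q' : T2 -> R) :
    square_integrable m1 setT p -> square_integrable m1 setT p' ->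
    square_integrable m2 setT q -> square_integrable m2 setT q' ->
    \int[m]_z ((p z.1 * q z.2) * (p' z.1 * q' z.2)) =
    (\int[m1]_x (p x * p' x)) * (\int[m2]_y (q y * q' y)).
  move=> Lp Lp' Lq Lq'.
  rewrite -(integrable_tensor (square_integrable_dot measurableT Lp Lp')
    (square_integrable_dot measurableT Lq Lq')).2.
  by apply: eq_Rintegral => z _; ring.
have Fg q : square_integrable m2 setT q ->
    \int[m]_z (F z * (g z.1 * q z.2)) = \int[m2]_y (psi y * q y).
  move=> Lq; have Lgq := square_integrable_tensor Lg Lq.
  have [|_ ->] := Rintegral_prod2 (square_integrable_dot mT LF Lgq).
    move=> y /=; have := square_integrable_dot measurableT (LF2 y) Lg.
    move=> /(integrable_scaler measurableT (q y)); apply: eq_integrable => // x _.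
    by congr (_%:E); ring.
  apply: eq_Rintegral => y _ /=; rewrite mulrC -RintegralZl//; last exact: square_integrable_dot.
  by apply: eq_Rintegral => x _; ring.
have Fh p : square_integrable m1 setT p ->
    \int[m]_z (F z * (p z.1 * h z.2)) = \int[m1]_x (chi x * p x).
  move=> Lp; have Lph := square_integrable_tensor Lp Lh.
  have [|_ ->] := Rintegral_prod1 (square_integrable_dot mT LF Lph).
    move=> x /=; have := square_integrable_dot measurableT (LF1 x) Lh.
    move=> /(integrable_scaler measurableT (p x)); apply: eq_integrable => // y _.
    by congr (_%:E); ring.
  apply: eq_Rintegral => x _ /=; rewrite mulrC -RintegralZl//; last exact: square_integrable_dot.
  by apply: eq_Rintegral => y _; ring.
have sqE (e : measure_display) (S : measurableType e) (nu : {measure set S -> \bar R}) (p : S -> R) :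
    \int[nu]_x (p x * p x) = \int[nu]_x (p x ^+ 2).
  by apply: eq_Rintegral => x _; rewrite expr2.
set X := \int[m1]_x (chi x ^+ 2); set Y := \int[m2]_y (psi y ^+ 2).
set N := \int[m]_z (F z ^+ 2).
have Fgp : \int[m]_z (F z * (g z.1 * psi z.2)) = Y by rewrite Fg// sqE.
have Fch : \int[m]_z (F z * (chi z.1 * h z.2)) = X by rewrite Fh// sqE.
have Kpsi : \int[m2]_y (psi y * h y) = K by rewrite -Fg.
have Kchi : \int[m1]_x (chi x * g x) = K by rewrite -Fh.
(* [A] is [(1 - P) F], and [B] is [(1 - P) Q F], since [P Q F] is [K] times the product of [g] and
   [h]. *)
pose A z := F z - g z.1 * psi z.2; pose B z := chi z.1 * h z.2 - K * (g z.1 * h z.2).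
have LA : square_integrable m setT A by exact: square_integrableB.
have LB : square_integrable m setT B.
  by apply: square_integrableB => //; exact: square_integrableZ.
have A2 : \int[m]_z (A z ^+ 2) = N - Y.
  have := Rintegral_sqrB mT 1 1 LF Lgp; under eq_Rintegral do rewrite !mul1r.
  rewrite Fgp; under [X in _ + _ * X]eq_Rintegral do rewrite expr2.
  rewrite dotE// !sqE g1 => ->; rewrite -/N -/Y; ring.
have B2 : \int[m]_z (B z ^+ 2) = X - K ^+ 2.
  have := Rintegral_sqrB mT 1 K Lch Lgh; under eq_Rintegral do rewrite !mul1r.
  under [\int[m]_z ((chi z.1 * h z.2) ^+ 2)]eq_Rintegral do rewrite expr2.
  under [\int[m]_z ((g z.1 * h z.2) ^+ 2)]eq_Rintegral do rewrite expr2.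
  rewrite !dotE// !sqE g1 h1 Kchi => ->; rewrite -/X; ring.
have AB : \int[m]_z (A z * B z) = X - K ^+ 2.
  rewrite Rintegral_dotBl// !(Rintegral_dotC _ _ _ B).
  rewrite !Rintegral_dotBl ?Rintegral_dotZl//; try exact: square_integrableZ.
  rewrite (Rintegral_dotC _ _ _ F) Fch (Rintegral_dotC _ _ (fun z => g z.1 * h z.2) F) -/K.
  rewrite !dotE// sqE g1 mul1r Kchi.
  rewrite !(Rintegral_dotC _ _ h psi) Kpsi; ring.
have := Rintegral_sqrB mT 1 1 LA LB; under eq_Rintegral do rewrite !mul1r.
rewrite A2 B2 AB => h0.
have : 0 <= \int[m]_z ((A z - B z) ^+ 2) by apply: Rintegral_ge0 => z _; exact: sqr_ge0.
by rewrite h0; lra.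
Qed.

End tensorization.
End product.

(** * Open sets and continuous functions for the product sigma-algebra *)

Section measurability.
Context {R : realType} {n : nat}.
Implicit Types (f g : 'rV[R]_n -> R).

Lemma rV_ballP (x y : 'rV[R]_n) (e : R) : 0 < e ->
  (forall i, `|x ord0 i - y ord0 i| < e) -> ball x e y.
Proof. by move=> e0 xy; split => // i j; rewrite ord1; exact: xy. Qed.

Lemma measurable_cube (q : 'rV[R]_n) (e : R) :
  measurable [set x : 'rV[R]_n | forall i, `|x ord0 i - q ord0 i| < e].
Proof.
rewrite (_ : [set x | _] = \bigcap_(i in [set: 'I_n])
    ((fun x : 'rV[R]_n => x ord0 i) @^-1` ball (q ord0 i) e)); last first.
  apply/seteqP; split => [x h i _|x h i].
    by rewrite /= /ball/= distrC; exact: h.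
  by have := h i I; rewrite /= /ball/= distrC.
apply: fin_bigcap_measurable => // i _.
rewrite -[X in measurable X]setTI; apply: measurable_coor => //.
by rewrite ball_itv; exact: measurable_itv.
Qed.

(* Open sets are countable unions of cubes with rational centers. *)
Lemma open_measurable_rV (U : set 'rV[R]_n) : open U -> measurable U.
Proof.
move=> oU.
pose cube (p : 'rV[rat]_n * nat) :=
  [set x : 'rV[R]_n | forall i, `|x ord0 i - ratr (p.1 ord0 i)| < p.2.+1%:R^-1].
pose F p := if `[< cube p `<=` U >] then cube p else set0.
have -> : U = \bigcup_p F p.
  apply/seteqP; split => [x Ux|x [p _]]; last first.
    by rewrite /F; case: asboolP => // pU; exact: pU.
  have [e /= e0 xU] : exists2 e : R, 0 < e & ball x e `<=` U.
    by have /nbhs_ballP[e e0 h] := oU x Ux; exists e.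
  have [m _ /(_ m (leqnn _)) me] := near_infty_natSinv_lt (PosNum (divr_gt0 e0 (ltr0n R 2))).
  have m0 : 0 < m.+1%:R^-1 :> R by rewrite invr_gt0.
  have /choice[q qx] (i : 'I_n) : exists q : rat, `|x ord0 i - ratr q| < m.+1%:R^-1.
    have xm : x ord0 i < x ord0 i + m.+1%:R^-1 by rewrite ltrDl.
    have [q] := rat_in_itvoo xm; rewrite in_itv/= => /andP[q1 q2]; exists q.
    rewrite ltr_norml; move: q1 q2; move: m.+1%:R^-1 m0 (ratr q : R) => z z0 r q1 q2.
    by apply/andP; split; lra.
  exists (\row_i q i, m) => //; rewrite /F.
  case: asboolP => [_ i|]; first by rewrite /= mxE.
  case=> y /= h; apply: xU; apply: rV_ballP => // i.
  have := h i; rewrite mxE => hi; have := qx i => hx.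
  rewrite -(subrKA (ratr (q i))); apply: (le_lt_trans (ler_normD _ _)).
  rewrite [ltRHS](splitr e) ltrD// ?(lt_trans hx)// distrC.
  exact: lt_trans hi me.
apply: countable_bigcupT_measurable; first exact: countableP.
move=> p; rewrite /F; case: asboolP => // _.
rewrite (_ : cube p = [set x : 'rV[R]_n | forall i, `|x ord0 i - (\row_j (ratr (p.1 ord0 j) : R)) ord0 i| < p.2.+1%:R^-1]).
  exact: measurable_cube.
by apply/seteqP; split => x h i; have := h i; rewrite mxE.
Qed.

Lemma continuous_measurable_rV f : continuous f -> measurable_fun [set: 'rV[R]_n] f.
Proof.
move=> /continuousP cf; apply: (measurability (@RGenOpens.G R)).
  exact: RGenOpens.measurableE.
move=> _ [_ [a [b ->] <-]]; rewrite setTI.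
by apply: open_measurable_rV; exact: cf.
Qed.

End measurability.

(** * Integration on R^n *)

Section lebesgue_rV_integral.
Context {R : realType}.
Local Notation mu := (@lebesgue_measure R).
Local Notation leb := (@lebesgue_rV R).
Local Notation RR := (measurableTypeR R).

(** A quantitative form of compact support in an orthant whose positive coordinates are flagged by
    [b]. The bounds [M] and [d] pass unchanged to slices and to partial derivatives, as induction on
    the dimension requires. *)
Definition boxed n (b : 'I_n -> bool) (M d : R) (f : 'rV[R]_n -> R) :=
  forall x, f x != 0 -> forall i, `|x ord0 i| <= M /\ (b i -> d <= x ord0 i).

Definition cube n (M : R) : set 'rV[R]_n := [set x | forall i, x ord0 i \in `[- M, M]].

Lemma compact_cube n M : compact (@cube n M).
Proof.
apply: (@rV_compact R n (fun=> `[- M, M]%classic)) => _.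
exact: segment_compact.
Qed.

Lemma closed_cube n M : closed (@cube n M).
Proof.
apply: compact_closed; last exact: compact_cube.
exact: norm_hausdorff.
Qed.

Lemma measurable_cubeM n M : measurable (@cube n M).
Proof.
by rewrite -[cube _]setCK; apply: measurableC; apply: open_measurable_rV;
  rewrite openC; exact: closed_cube.
Qed.

Lemma lebesgue_cube_lty n M : (leb n (@cube n M) < +oo)%E.
Proof.
have := @lebesgue_rV_box R n (fun=> `[- M, M]%classic) (fun=> measurable_itv _).
rewrite -/(cube M) => ->.
set I : set RR := `[- M, M]%classic.
suff : (0 <= \prod_(i < n) mu I)%E /\ (\prod_(i < n) mu I < +oo)%E by case.
elim/big_ind : _ => [|x y [x0 xoo] [y0 yoo]|i _].
- by rewrite lee_fin ltry.
- by rewrite mule_ge0// lte_mul_pinfty// ge0_fin_numE.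
- by rewrite measure_ge0 /I lebesgue_measure_itv/=; case: ifP => // _; rewrite -EFinB ltry.
Qed.

Lemma boxed_cube n (b : 'I_n -> bool) M d f x : boxed b M d f -> ~ cube M x -> f x = 0.
Proof.
move=> fb; apply: contra_notP => /eqP fx i; have [+ _] := fb x fx i.
by rewrite in_itv/= ler_norml.
Qed.

Lemma boxed_integrable n (b : 'I_n -> bool) M d f : continuous f -> boxed b M d f ->
  (leb n).-integrable setT (fun x => (f x)%:E).
Proof.
move=> cf fb; have mf := continuous_measurable_rV cf.
have -> : (fun x => (f x)%:E) = (fun x => (f x)%:E) \_ (cube M).
  apply/funext => x; rewrite /patch; case: ifPn => //; rewrite notin_setE.
  by move=> /(boxed_cube fb) ->.
apply/(integrable_mkcond _ (@measurable_cubeM n M)).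
apply: measurable_bounded_integrable.
- exact: measurable_cubeM.
- exact: lebesgue_cube_lty.
- exact: measurable_funTS.
- have : bounded_set (f @` cube M).
    apply: compact_bounded; apply: continuous_compact; last exact: compact_cube.
    exact: continuous_subspaceT.
  by move=> [K [Kr h]]; exists K; split => // r Kr' x cx; apply: (h r Kr'); exists x.
Qed.

Lemma Rintegral_rV0 (f : 'rV[R]_0 -> R) : continuous f -> \int[leb 0]_x f x = f 0.
Proof.
move=> /continuous_measurable_rV mf; rewrite /Rintegral integral_dirac//.
  by rewrite diracT mul1e.
exact/measurable_EFinP.
Qed.

Lemma integrable_rV_cons n (f : 'rV[R]_n.+1 -> R) :
  (leb n.+1).-integrable setT (fun x => (f x)%:E) ->
  (mu \x leb n)%E.-integrable setT (fun z => (f (rV_cons z))%:E) /\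
  \int[leb n.+1]_x f x = \int[(mu \x leb n)%E]_z f (rV_cons z).
Proof.
move=> intf; have mf := measurable_int _ intf.
have mc := @measurable_rV_cons R n.
have iF : (mu \x leb n)%E.-integrable setT (fun z => (f (rV_cons z))%:E).
  apply/integrableP; split; first exact: (measurableT_comp mf mc).
  move/integrableP : intf => [_]; rewrite ge0_integral_pushforward//.
  exact: measurableT_comp.
by split=> //; rewrite /Rintegral integral_pushforward.
Qed.

Lemma integrable_rV_consP n (f : 'rV[R]_n.+1 -> R) :
  measurable_fun setT f ->
  (mu \x leb n)%E.-integrable setT (fun z => (f (rV_cons z))%:E) ->
  (leb n.+1).-integrable setT (fun x => (f x)%:E).
Proof.
move=> mf iF; apply/integrableP; split; first exact/measurable_EFinP.
move/integrableP : iF => [_]; rewrite ge0_integral_pushforward//.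
- exact: measurable_rV_cons.
- by apply: measurableT_comp => //; exact/measurable_EFinP.
Qed.

Definition tensor n (h : 'I_n -> R -> R) (x : 'rV[R]_n) := \prod_i h i (x ord0 i).

Lemma rV_cons0 n (z : RR * 'rV[R]_n) : rV_cons z ord0 ord0 = z.1.
Proof. by rewrite mxE unlift_none. Qed.

Lemma rV_cons_lift n (z : RR * 'rV[R]_n) j : rV_cons z ord0 (lift ord0 j) = z.2 ord0 j.
Proof. by rewrite mxE liftK. Qed.

Lemma tensor_cons n (h : 'I_n.+1 -> R -> R) (z : RR * 'rV[R]_n) :
  tensor h (rV_cons z) = h ord0 z.1 * tensor (fun j => h (lift ord0 j)) z.2.
Proof.
rewrite /tensor big_ord_recl rV_cons0; congr (_ * _).
by apply: eq_bigr => j _; rewrite rV_cons_lift.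
Qed.

Lemma measurable_tensor n (h : 'I_n -> R -> R) :
  (forall i, measurable_fun [set: RR] (h i : RR -> RR)) ->
  measurable_fun [set: 'rV[R]_n] (tensor h).
Proof.
move=> mh; apply: measurable_prod => i _.
exact: (measurableT_comp (mh i) (measurable_coor i)).
Qed.

Lemma integrable_tensorn n (h : 'I_n -> R -> R) :
  (forall i, mu.-integrable [set: RR] (fun t => (h i t)%:E)) ->
  (leb n).-integrable setT (fun x => (tensor h x)%:E) /\
  \int[leb n]_x tensor h x = \prod_i \int[mu]_t h i t.
Proof.
elim: n h => [|n IHn] h ih.
  have e : tensor h = fun=> 1 by apply/funext => x; rewrite /tensor big_ord0.
  rewrite e; split; last by rewrite Rintegral_rV0 ?big_ord0//; exact: cst_continuous.
  apply/integrableP; split; first exact: measurable_cst.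
  by rewrite integral_dirac// diracT mul1e /= normr1 ltry.
have mh i : measurable_fun [set: RR] (h i : RR -> RR).
  by apply/measurable_EFinP; exact: measurable_int (ih i).
have [i1 e1] := IHn (fun j => h (lift ord0 j)) (fun j => ih (lift ord0 j)).
have [i2 e2] := integrable_tensor (ih ord0) i1.
have iT : (leb n.+1).-integrable setT (fun x => (tensor h x)%:E).
  apply: integrable_rV_consP; first exact: measurable_tensor.
  by under eq_fun do rewrite tensor_cons.
split=> //; rewrite (integrable_rV_cons iT).2.
under eq_Rintegral do rewrite tensor_cons.
by rewrite e2 e1 big_ord_recl.
Qed.

Lemma continuous_rV_cons_snd n (t : R) : continuous (fun y : 'rV[R]_n => rV_cons (t : RR, y)).
Proof.
move=> y s /= /nbhs_ballP[e /= e0 es]; apply/nbhs_ballP; exists e => // y' [_ yy'].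
apply: es; apply: rV_ballP => // i.
have [j ->|->] := unliftP ord0 i; last by rewrite !rV_cons0 subrr normr0.
by rewrite !rV_cons_lift/=; exact: yy'.
Qed.

Lemma continuous_rV_cons_fst n (y : 'rV[R]_n) : continuous (fun t : R => rV_cons (t : RR, y)).
Proof.
move=> t s /= /nbhs_ballP[e /= e0 es]; apply/nbhs_ballP; exists e => // t' tt'.
apply: es; apply: rV_ballP => // i.
have [j ->|->] := unliftP ord0 i; first by rewrite !rV_cons_lift/= subrr normr0.
by rewrite !rV_cons0.
Qed.

Lemma boxed_slice_snd n (b : 'I_n.+1 -> bool) M d f t : boxed b M d f ->
  boxed (fun j => b (lift ord0 j)) M d (fun y => f (rV_cons (t : RR, y))).
Proof.
by move=> fb y fy j; have := fb _ fy (lift ord0 j); rewrite rV_cons_lift.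
Qed.

Lemma boxed_slice_fst n (b : 'I_n.+1 -> bool) M d f y : boxed b M d f ->
  forall t, f (rV_cons (t : RR, y)) != 0 -> `|t| <= M /\ (b ord0 -> d <= t).
Proof. by move=> fb t fy; have := fb _ fy ord0; rewrite rV_cons0. Qed.

Lemma delta_mx_cons0 n (t h : R) (y : 'rV[R]_n) :
  h *: delta_mx ord0 ord0 + rV_cons (t : RR, y) = rV_cons (h + t : RR, y).
Proof.
apply/rowP => i; rewrite [LHS]mxE.
have -> : (h *: delta_mx ord0 ord0 : 'rV_n.+1) ord0 i = h * (i == ord0)%:R by rewrite !mxE.
have [j ->|->] := unliftP ord0 i; first by rewrite !rV_cons_lift/= mulr0 add0r.
by rewrite !rV_cons0 eqxx mulr1.
Qed.

Lemma delta_mx_cons_lift n (t h : R) (y : 'rV[R]_n) j :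
  h *: delta_mx ord0 (lift ord0 j) + rV_cons (t : RR, y) =
  rV_cons (t : RR, h *: delta_mx ord0 j + y).
Proof.
apply/rowP => i; rewrite [LHS]mxE.
have -> : (h *: delta_mx ord0 (lift ord0 j) : 'rV_n.+1) ord0 i =
    h * (i == lift ord0 j)%:R by rewrite !mxE.
have [k ->|->] := unliftP ord0 i; last by rewrite !rV_cons0 mulr0 add0r.
by rewrite !rV_cons_lift/= !mxE (inj_eq lift_inj).
Qed.

Definition C1 n (f : 'rV[R]_n -> R) := continuous f /\
  forall i, (forall x, derivable f x (delta_mx ord0 i)) /\ continuous (partial i f).

Lemma is_derive_slice_fst n (f : 'rV[R]_n.+1 -> R) y (t : R) : C1 f ->
  is_derive t (1 : R) (fun s : R => f (rV_cons (s : RR, y))) (partial ord0 f (rV_cons (t : RR, y))).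
Proof.
move=> [_ /(_ ord0)[df _]].
have e : (fun h : R => h^-1 *: (f (h *: delta_mx ord0 ord0 + rV_cons (t : RR, y)) - f (rV_cons (t : RR, y)))) =
    (fun h : R => h^-1 *: (f (rV_cons (h *: (1 : R) + t : RR, y)) - f (rV_cons (t : RR, y)))).
  by apply/funext => h; rewrite delta_mx_cons0 /GRing.scale/= mulr1.
apply: DeriveDef; last by rewrite /partial /derive; congr (lim _); rewrite /= e.
by have := df (rV_cons (t : RR, y)); rewrite /derivable /= e.
Qed.

Lemma C1_slice_snd n (f : 'rV[R]_n.+1 -> R) (t : R) : C1 f ->
  C1 (fun y : 'rV[R]_n => f (rV_cons (t : RR, y))) /\
  forall j y, partial j (fun y : 'rV[R]_n => f (rV_cons (t : RR, y))) y =
    partial (lift ord0 j) f (rV_cons (t : RR, y)).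
Proof.
move=> [cf df].
have e y j : (fun h : R => h^-1 *: (f (h *: delta_mx ord0 (lift ord0 j) + rV_cons (t : RR, y)) - f (rV_cons (t : RR, y)))) =
    (fun h : R => h^-1 *: (f (rV_cons (t : RR, h *: delta_mx ord0 j + y)) - f (rV_cons (t : RR, y)))).
  by apply/funext => h; rewrite delta_mx_cons_lift.
have pE j y : partial j (fun y : 'rV[R]_n => f (rV_cons (t : RR, y))) y =
    partial (lift ord0 j) f (rV_cons (t : RR, y)).
  by rewrite /partial /derive; congr (lim _); rewrite /= e.
split=> //; split=> [y|j].
  by apply: continuous_comp; [exact: continuous_rV_cons_snd|exact: cf].
split=> [y|].
  by have [/(_ (rV_cons (t : RR, y))) + _] := df (lift ord0 j); rewrite /derivable /= e.
rewrite (_ : partial j _ = fun y => partial (lift ord0 j) f (rV_cons (t : RR, y))).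
  move=> y; apply: continuous_comp; first exact: continuous_rV_cons_snd.
  by have [_] := df (lift ord0 j); exact.
by apply/funext => y; exact: pE.
Qed.

(** The box is closed, so [f] vanishes in a neighbourhood of every point outside it. *)
Lemma boxed_partial n (b : 'I_n -> bool) M d f i : boxed b M d f -> boxed b M d (partial i f).
Proof.
move=> fb x; apply: contraNP => /existsNP[j nj].
have near0 : nbhs x [set y | f y = 0].
  have cj := @coord_continuous R 1 n ord0 j x.
  have : nbhs x [set y : 'rV[R]_n | ~ (`|y ord0 j| <= M /\ (b j -> d <= y ord0 j))].
    have [xM|xM] := leP `|x ord0 j| M; last first.
      have : nbhs x [set y : 'rV[R]_n | M < `|y ord0 j|].
        apply: (cj [set z | M < `|z|]).
        apply/nbhs_ballP; exists (`|x ord0 j| - M); first by rewrite /= subr_gt0.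
        move=> z; rewrite /ball/= => xz.
        by have := ler_normD (x ord0 j - z) z; rewrite subrK; lra.
      by apply: filterS => y /= + [h _]; rewrite ltNge h.
    have [bj xd] : b j /\ x ord0 j < d.
      apply: contrapT => h; apply: nj; split=> // bj.
      by rewrite leNgt; apply/negP => xd; apply: h.
    have : nbhs x [set y : 'rV[R]_n | y ord0 j < d] 
      by apply: (cj [set z | z < d]); exact: lt_nbhsl.
    by apply: filterS => y /= yd [_ /(_ bj)]; rewrite leNgt yd.
  apply: filterS => y; apply: contra_notP => /eqP fy.
  exact: fb.
rewrite /partial (@near_eq_derive _ _ _ _ (cst 0))//.
  by rewrite derive_cst.
Qed.

End lebesgue_rV_integral.

(** * Integration by parts and the spectral gap in several variables *)

Section orthant_gap.
Context {R : realType}.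
Local Notation mu := (@lebesgue_measure R).
Local Notation leb := (@lebesgue_rV R).
Local Notation RR := (measurableTypeR R).

Lemma Rintegral_derive_compact (f f' : R -> R) M :
  (forall t : R, is_derive t (1 : R) f (f' t)) -> continuous f' ->
  (forall t, f t != 0 -> `|t| <= M) -> (forall t, f' t != 0 -> `|t| <= M) ->
  \int[mu]_t f' t = 0.
Proof.
(* [M] may be negative, and the support may reach [M]; the interval from [- N] to [N] is
   nondegenerate and [f] vanishes at its ends. *)
move=> df cf' fM f'M; pose N := `|M| + 1.
have MN : M < N by rewrite (le_lt_trans (ler_norm M))// ltrDl.
have N0 : 0 < N by rewrite ltr_wpDl.
have out t : ~~ (- N < t < N) -> f t = 0 /\ f' t = 0.
  rewrite -ltr_norml => tN; split; apply/eqP; apply: contraNT tN.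
    by move=> /fM tM; exact: le_lt_trans MN.
  by move=> /f'M tM; exact: le_lt_trans MN.
have NN : - N < N by rewrite gtrN.
have := @Rintegral_derive _ f f' (- N) N NN.
have fN : f N = 0 by apply: (out N _).1; rewrite ltxx andbF.
have fNN : f (- N) = 0 by apply: (out (- N) _).1; rewrite ltxx.
rewrite fN fNN subrr => <-; [|by move=> t _; exact: df|by move=> t _; exact: cf'].
rewrite [RHS]Rintegral_mkcond; apply: eq_Rintegral => t _.
rewrite /patch; case: ifPn => //; rewrite notin_setE/= in_itv/= => tN.
apply: (out t _).2; apply/negP => /andP[t1 t2]; apply: tN.
by rewrite !ltW.
Qed.

Lemma C1_partial_continuous n (f : 'rV[R]_n -> R) i : C1 f -> continuous (partial i f).
Proof. by move=> [_ /(_ i)[]]. Qed.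

Lemma continuous_slice_snd n (u : 'rV[R]_n.+1 -> R) (t : R) : continuous u ->
  continuous (fun y : 'rV[R]_n => u (rV_cons (t : RR, y))).
Proof.
by move=> cu y; apply: continuous_comp; [exact: continuous_rV_cons_snd|exact: cu].
Qed.

Lemma continuous_slice_fst n (u : 'rV[R]_n.+1 -> R) (y : 'rV[R]_n) : continuous u ->
  continuous (fun t : R => u (rV_cons (t : RR, y))).
Proof.
by move=> cu t; apply: continuous_comp; [exact: continuous_rV_cons_fst|exact: cu].
Qed.

(** By Fubini's theorem: along the first axis the inner integral vanishes in one dimension; any
    other direction is a direction of the slice, where the induction hypothesis applies. *)
Lemma Rintegral_partial n (b : 'I_n -> bool) M d (f : 'rV[R]_n -> R) i :
  C1 f -> boxed b M d f -> \int[leb n]_x partial i f x = 0.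
Proof.
elim: n b f i => [|n IHn] b f i; first by case: i.
move=> f1 fb; have cp := C1_partial_continuous (i := i) f1.
have pb := boxed_partial (i := i) fb; have ip := boxed_integrable cp pb.
have [iF ->] := integrable_rV_cons ip.
have [j ij|i0] := unliftP ord0 i; last first.
  have [|_ ->] := Rintegral_prod2 iF.
    move=> y /=; apply: (@integrable_compact_support _ _ M); first exact: continuous_slice_fst.
    by move=> t /(boxed_slice_fst pb)[].
  rewrite (@eq_Rintegral _ _ _ _ _ (fun _ : 'rV[R]_n => 0)).
    by rewrite /Rintegral integral0.
  move=> y _ /=; apply: (@Rintegral_derive_compact (fun t : R => f (rV_cons (t : RR, y))) _ M).
  - by move=> t; rewrite i0; exact: is_derive_slice_fst.
  - exact: continuous_slice_fst.
  - by move=> t /(boxed_slice_fst fb)[].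
  - by move=> t /(boxed_slice_fst pb)[].
have [|_ ->] := Rintegral_prod1 iF.
  move=> t /=; exact: boxed_integrable (continuous_slice_snd (t := t) cp) (boxed_slice_snd (t := t) pb).
rewrite (@eq_Rintegral _ _ _ _ _ (fun _ : RR => 0)).
  by rewrite /Rintegral integral0.
move=> t _ /=; have [g1 gE] := C1_slice_snd t f1.
rewrite -(IHn _ _ j g1 (boxed_slice_snd (t := t) fb)).
by apply: eq_Rintegral => y _; rewrite gE ij.
Qed.

Definition nprofile (b : bool) (c t : R) : R :=
  profile b c t / Num.sqrt (\int[mu]_s (profile b c s ^+ 2)).

Lemma square_integrable_nprofile b c : 0 < c ->
  square_integrable mu [set: RR] (nprofile b c).
Proof.
move=> c0; rewrite /nprofile; under eq_fun do rewrite mulrC.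
exact/square_integrableZ/square_integrable_profile.
Qed.

Lemma nprofile_sqnorm b c : 0 < c -> \int[mu]_t (nprofile b c t ^+ 2) = 1.
Proof.
move=> c0; have Z0 := profile_sqnorm_gt0 b c0.
set Z := \int[mu]_t (profile b c t ^+ 2) in Z0.
rewrite (@eq_Rintegral _ _ _ mu _ (fun t => Z^-1 * profile b c t ^+ 2)).
  rewrite RintegralZl// ?mulVf ?gt_eqF//.
  by case: (square_integrable_profile b c0).
by move=> t _; rewrite /nprofile -/Z expr_div_n sqr_sqrtr ?(ltW Z0)// mulrC.
Qed.

Lemma nprofile_gap (b : bool) (c M d : R) (f f' : R -> R) : 0 < c -> 0 < d ->
  (forall t : R, is_derive t (1 : R) f (f' t)) -> continuous f' ->
  (forall t, f t != 0 -> `|t| <= M /\ (b -> d <= t)) ->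
  (forall t, f' t != 0 -> `|t| <= M /\ (b -> d <= t)) ->
  4 * c * (\int[mu]_t (f t ^+ 2) - (\int[mu]_t (f t * nprofile b c t)) ^+ 2) <=
  \int[mu]_t (f' t ^+ 2 + ((2 * c * t) ^+ 2 - ground_energy b c) * f t ^+ 2).
Proof.
move=> c0 d0 df cf' fM f'M; have := profile_gap c0 d0 df cf' fM f'M.
have Z0 := profile_sqnorm_gt0 b c0.
set Z := \int[mu]_t (profile b c t ^+ 2) in Z0 *.
have cf : continuous f.
  by move=> t; apply/differentiable_continuous/derivable1_diffP; case: (df t).
have Lf : square_integrable mu [set: RR] f.
  split; first exact: continuous_measurable_RR.
  apply: (@integrable_compact_support _ _ M).
    by move=> t; apply: for_continuousX; exact: cf.
  by move=> t; rewrite sqrf_eq0 => /fM[].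
rewrite (@eq_Rintegral _ _ _ mu _ (fun t => (Num.sqrt Z)^-1 * (f t * profile b c t))
  (fun t => f t * nprofile b c t)); last by move=> t _; rewrite /nprofile -/Z; ring.
rewrite RintegralZl//; last first.
  exact: (square_integrable_dot measurableT Lf (square_integrable_profile b c0)).
by rewrite exprMn exprVn sqr_sqrtr ?(ltW Z0)// [_^-1 * _]mulrC.
Qed.

Definition ground_state n (b : 'I_n -> bool) (c : R) : 'rV[R]_n -> R :=
  tensor (fun i => nprofile (b i) c).

Lemma ground_state_cons n (b : 'I_n.+1 -> bool) c (z : RR * 'rV[R]_n) :
  ground_state b c (rV_cons z) =
  nprofile (b ord0) c z.1 * ground_state (fun j => b (lift ord0 j)) c z.2.
Proof. exact: tensor_cons. Qed.

Lemma square_integrable_ground_state n (b : 'I_n -> bool) c : 0 < c ->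
  square_integrable (leb n) setT (ground_state b c) /\
  \int[leb n]_x (ground_state b c x ^+ 2) = 1.
Proof.
move=> c0; have L i := square_integrable_nprofile (b i) c0.
have [] := integrable_tensorn (fun i => (L i).2).
have e x : tensor (fun i t => nprofile (b i) c t ^+ 2) x = ground_state b c x ^+ 2.
  by rewrite /tensor /ground_state prodrXl.
under eq_fun do rewrite e; under eq_Rintegral do rewrite e.
move=> i ->; split; last by rewrite big1// => j _; exact: nprofile_sqnorm.
by split=> //; apply: measurable_tensor => j; case: (L j).
Qed.

(** The density of the quadratic form of the [i]-th one-dimensional oscillator minus its ground
    energy. Shifted in this way, the forms of the coordinates simply add up. *)
Definition energy n (b : 'I_n -> bool) (c : R) (f : 'rV[R]_n -> R) (i : 'I_n) x :=
  partial i f x ^+ 2 + ((2 * c * x ord0 i) ^+ 2 - ground_energy (b i) c) * f x ^+ 2.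

Lemma continuous_energy n (b : 'I_n -> bool) c f i : C1 f -> continuous (energy b c f i).
Proof.
move=> f1 x; have [cf /(_ i)[_ cp]] := f1.
rewrite /energy; apply: (@for_continuousD R 'rV[R]_n); first by apply: (@for_continuousX R 'rV[R]_n); exact: cp.
apply: (@for_continuousM R 'rV[R]_n); last by apply: (@for_continuousX R 'rV[R]_n); exact: cf.
apply: (@for_continuousD R 'rV[R]_n); last exact: (@for_continuous_cst R 'rV[R]_n).
apply: (@for_continuousX R 'rV[R]_n); apply: (@for_continuousM R 'rV[R]_n); first exact: (@for_continuous_cst R 'rV[R]_n).
exact: coord_continuous.
Qed.

Lemma boxed_energy n (b b' : 'I_n -> bool) M d c f i : boxed b M d f ->
  boxed b M d (energy b' c f i).
Proof.
move=> fb x; rewrite /energy; have [fx0|fx0 _] := eqVneq (f x) 0; last exact: fb.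
have [px0|px0 _] := eqVneq (partial i f x) 0; last exact: (boxed_partial (i := i) fb).
by rewrite fx0 px0 expr0n/= mulr0 addr0 eqxx.
Qed.

Lemma boxed_sum n (b : 'I_n -> bool) M d I (s : seq I) (F : I -> 'rV[R]_n -> R) :
  (forall i, boxed b M d (F i)) -> boxed b M d (fun x => \sum_(i <- s) F i x).
Proof.
move=> Fb x; elim: s => [|i s IHs]; first by rewrite big_nil eqxx.
rewrite big_cons; have [Fx0|Fx0 _] := eqVneq (F i x) 0; last exact: (Fb i x Fx0).
by rewrite Fx0 add0r.
Qed.

Lemma continuous_sum n I (s : seq I) (F : I -> 'rV[R]_n -> R) :
  (forall i, continuous (F i)) -> continuous (fun x => \sum_(i <- s) F i x).
Proof.
move=> cF x; elim: s => [|i s IHs].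
  by under eq_fun do rewrite big_nil; exact: for_continuous_cst.
by under eq_fun do rewrite big_cons; apply: for_continuousD => //; exact: cF.
Qed.

Lemma boxed_square_integrable n (b : 'I_n -> bool) M d (f : 'rV[R]_n -> R) :
  continuous f -> boxed b M d f -> square_integrable (leb n) setT f.
Proof.
move=> cf fb; split; first exact: continuous_measurable_rV.
apply: (@boxed_integrable _ _ b M d) => [x|x]; first by apply: for_continuousX; exact: cf.
by rewrite sqrf_eq0; exact: fb.
Qed.

(** The gap in the first variable and the induction hypothesis on the slices, both integrated over
    the remaining variables, add up to [4 * c * (2 * N - X - Y)]. Tensorization bounds [X + Y] by
    [N + K ^+ 2], so the constant [4 * c] does not deteriorate with the dimension. In dimension 0
    both sides are 0. *)
Theorem orthant_gap n (b : 'I_n -> bool) (c M d : R) (f : 'rV[R]_n -> R) :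
  0 < c -> 0 < d -> C1 f -> boxed b M d f ->
  4 * c * (\int[leb n]_x (f x ^+ 2) - (\int[leb n]_x (f x * ground_state b c x)) ^+ 2) <=
  \int[leb n]_x (\sum_i energy b c f i x).
Proof.
move=> c0 d0; elim: n b f => [|n IHn] b f f1 fb; have cf := f1.1.
  have gE x : ground_state b c x = 1 by rewrite /ground_state /tensor big_ord0.
  under [X in _ - X ^+ 2]eq_Rintegral do rewrite gE mulr1.
  under [leRHS]eq_Rintegral do rewrite big_ord0.
  rewrite !Rintegral_rV0//; last by move=> x; apply: (@for_continuousX R 'rV[R]_0); exact: cf.
    by rewrite subrr mulr0.
  exact: cst_continuous.
pose b' j := b (lift ord0 j); pose g := nprofile (b ord0) c; pose h := ground_state b' c.
have Lg : square_integrable mu [set: RR] g := square_integrable_nprofile _ c0.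
have g1 : \int[mu]_t (g t ^+ 2) = 1 := nprofile_sqnorm _ c0.
have [Lh h1] := square_integrable_ground_state b' c0.
have Lf := boxed_square_integrable cf fb.
have Lgs := (square_integrable_ground_state b c0).1.
pose F (z : RR * 'rV[R]_n) := f (rV_cons z).
have [iF2 eF2] := integrable_rV_cons Lf.2.
have LF : square_integrable (mu \x leb n)%E setT F.
  split=> //; exact: (measurableT_comp (continuous_measurable_rV cf) (@measurable_rV_cons R n)).
have LF1 t : square_integrable (leb n) setT (fun y => F (t, y)).
  exact: boxed_square_integrable (continuous_slice_snd cf) (boxed_slice_snd (t := t) fb).
have LF2 y : square_integrable mu [set: RR] (fun t => F (t, y)).
  split; first exact: (continuous_measurable_RR (continuous_slice_fst cf)).
  apply: (@integrable_compact_support _ _ M).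
    by move=> t; apply: (@for_continuousX R R); exact: continuous_slice_fst.
  by move=> t; rewrite sqrf_eq0 => /(boxed_slice_fst fb)[].
have [Lchi _] := square_integrable_partial1 LF LF1 Lh h1.
have [Lpsi _] := square_integrable_partial2 LF LF2 Lg g1.
have := tensorization LF LF1 LF2 Lg Lh g1 h1.
have -> : \int[(mu \x leb n)%E]_z (F z * (g z.1 * h z.2)) =
    \int[leb n.+1]_x (f x * ground_state b c x).
  rewrite (integrable_rV_cons (square_integrable_dot measurableT Lf Lgs)).2.
  by apply: eq_Rintegral => z _; rewrite ground_state_cons.
rewrite -eF2; set K := \int[leb n.+1]_x (f x * _).
set N := \int[leb n.+1]_x (f x ^+ 2).
set X := \int[mu]_t _; set Y := \int[leb n]_y _ => tens.
pose E0 := energy b c f ord0; pose E' x := \sum_j energy b c f (lift ord0 j) x.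
have cE0 : continuous E0 by exact: continuous_energy.
have bE0 : boxed b M d E0 by exact: boxed_energy.
have cE' : continuous E' by apply: continuous_sum => j; exact: continuous_energy.
have bE' : boxed b M d E' by apply: boxed_sum => j; exact: boxed_energy.
have iE0 := boxed_integrable cE0 bE0; have iE' := boxed_integrable cE' bE'.
have -> : \int[leb n.+1]_x (\sum_i energy b c f i x) =
    \int[leb n.+1]_x E0 x + \int[leb n.+1]_x E' x.
  by rewrite -RintegralD//; apply: eq_Rintegral => x _; rewrite big_ord_recl.
have [iE0m eE0] := integrable_rV_cons iE0; have [iE'm eE'] := integrable_rV_cons iE'.
have step1 : 4 * c * (N - X) <= \int[leb n.+1]_x E' x.
  have [|iE'1 E'1] := Rintegral_prod1 iE'm.
    by move=> t /=; exact: boxed_integrable (continuous_slice_snd cE') (boxed_slice_snd (t := t) bE').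
  have [iF1 F1] := Rintegral_prod1 iF2 (fun t => (LF1 t).2).
  rewrite eE' E'1 /N eF2 F1 /X -RintegralB//; last exact: Lchi.2.
  rewrite -RintegralZl//; last exact: (integrable_subr measurableT iF1 Lchi.2).
  apply: le_Rintegral => //.
    exact: (integrable_scaler measurableT _ (integrable_subr measurableT iF1 Lchi.2)).
  move=> t _; have [s1 sE] := C1_slice_snd t f1.
  have := IHn b' _ s1 (boxed_slice_snd (t := t) fb).
  congr (_ <= _); apply: eq_Rintegral => y _; apply: eq_bigr => j _.
  by rewrite /energy sE rV_cons_lift.
have step2 : 4 * c * (N - Y) <= \int[leb n.+1]_x E0 x.
  have E0M y t : E0 (rV_cons (t : RR, y)) != 0 -> `|t| <= M.
    by move=> /(boxed_slice_fst bE0)[].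
  have [|iE01 E01] := Rintegral_prod2 iE0m.
    by move=> y /=; exact: integrable_compact_support (continuous_slice_fst cE0) (E0M y).
  have [iF1 F1] := Rintegral_prod2 iF2 (fun y => (LF2 y).2).
  rewrite eE0 E01 /N eF2 F1 /Y -RintegralB//; last exact: Lpsi.2.
  rewrite -RintegralZl//; last exact: (integrable_subr measurableT iF1 Lpsi.2).
  apply: le_Rintegral => //.
    exact: (integrable_scaler measurableT _ (integrable_subr measurableT iF1 Lpsi.2)).
  move=> y _.
  have := @nprofile_gap (b ord0) c M d (fun t : R => f (rV_cons (t : RR, y)))
    (fun t : R => partial ord0 f (rV_cons (t : RR, y))) c0 d0.
  have h2 : forall t : R, is_derive t (1 : R) (fun t : R => f (rV_cons (t : RR, y)))
      (partial ord0 f (rV_cons (t : RR, y))) by move=> t; exact: is_derive_slice_fst.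
  have h3 := continuous_slice_fst (y := y) (C1_partial_continuous (i := ord0) f1).
  move=> /(_ h2 h3 (boxed_slice_fst fb) (boxed_slice_fst (boxed_partial (i := ord0) fb))).
  congr (_ <= _); apply: eq_Rintegral => t _.
  by rewrite /E0 /energy rV_cons0.
move: step1 step2 tens; nra.
Qed.

End orthant_gap.

(** * Passage to the completion *)

Section square_integrable_more.
Context d (T : measurableType d) (R : realType).
Variables (mu : {measure set T -> \bar R}) (D : set T).
Hypothesis mD : measurable D.
Implicit Types (f g : T -> R).

Lemma square_integrable_subset f : square_integrable mu setT f ->
  square_integrable mu D f.
Proof.
move=> [mf if2]; split; first exact: measurable_funTS.
exact: integrableS if2.
Qed.

Lemma Rintegral_support f : (forall x, ~ D x -> f x = 0) ->
  \int[mu]_(x in D) f x = \int[mu]_x f x.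
Proof.
move=> fD; rewrite Rintegral_mkcond; apply: eq_Rintegral => x _.
by rewrite /patch; case: ifPn => //; rewrite notin_setE => /fD ->.
Qed.

(** Monotone convergence for the squares. It serves for an [f] not yet known to be square
    integrable, when increasing weights give norms bounded independently of [m]. *)
Lemma square_integrable_monotone_limit (w_ : nat -> T -> R) f K :
  measurable_fun D f -> (forall m, measurable_fun D (w_ m)) ->
  (forall m x, D x -> 0 <= w_ m x) ->
  (forall x, D x -> {homo w_ ^~ x : m m' / (m <= m')%N >-> m <= m'}) ->
  (forall x, D x -> \forall m \near \oo, w_ m x = 1) ->
  (forall m, square_integrable mu D (fun x => w_ m x * f x)) ->
  (forall m, \int[mu]_(x in D) ((w_ m x * f x) ^+ 2) <= K) ->
  square_integrable mu D f /\ \int[mu]_(x in D) (f x ^+ 2) <= K.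
Proof.
move=> mf mw w0 wnd w1 Lwf wK.
have lim : (\int[mu]_(x in D) ((f x ^+ 2)%:E) <= K%:E)%E.
  have cvgI := @cvg_monotone_convergence _ _ _ mu D mD
    (fun m x => ((w_ m x * f x) ^+ 2)%:E) _ _ _.
  have -> : (\int[mu]_(x in D) (f x ^+ 2)%:E =
     \int[mu]_(x in D) (fun x => limn (fun m => ((w_ m x * f x) ^+ 2)%:E)) x)%E.
    apply: eq_integral => x; rewrite inE => Dx; apply/esym/cvg_lim => //.
    apply: cvg_near_cst; have := w1 x Dx.
    by apply: filterS => m ->; rewrite mul1r.
  apply: (@cvge_le _ _ eventually_filter _
    (fun m => \int[mu]_(x in D) ((w_ m x * f x) ^+ 2)%:E)%E); last apply: cvgI.
  - apply: nearW => m; have := wK m; rewrite -lee_fin /Rintegral fineK//.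
    by apply: integrable_fin_num => //; case: (Lwf m).
  - by move=> m; apply/measurable_EFinP; apply: measurable_funX; case: (Lwf m).
  - by move=> m x _; rewrite lee_fin sqr_ge0.
  - move=> x Dx m m' mm'; rewrite lee_fin !exprMn ler_wpM2r ?sqr_ge0//.
    by rewrite lerXn2r ?nnegrE ?w0//; exact: wnd.
have if2 : mu.-integrable D (fun x => (f x ^+ 2)%:E).
  apply/integrableP; split; first by apply/measurable_EFinP; exact: measurable_funX.
  under eq_integral do rewrite /= ger0_norm ?sqr_ge0//.
  by rewrite (le_lt_trans lim) ?ltry.
split; first by [].
by rewrite -lee_fin /Rintegral fineK//; exact: integrable_fin_num.
Qed.

End square_integrable_more.

Section test_functions.
Context {R : realType} {n k : nat}.
Hypothesis kn : (1 <= k <= n)%N.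
Local Notation leb := (@lebesgue_rV R n).
Local Notation D := (@orthant R n k).
Implicit Types (f phi : 'rV[R]_n -> R).

Definition is_positive (i : 'I_n) : bool := (n - k <= i)%N.

Lemma measurable_orthant : measurable D.
Proof.
rewrite (_ : D = \bigcap_(i in [set i : 'I_n | is_positive i])
    ((fun x : 'rV[R]_n => x ord0 i) @^-1` `]0, +oo[%classic)); last first.
  by apply/seteqP; split => [x h i bi|x h i bi]; have := h i bi; rewrite /= in_itv/= andbT.
apply: fin_bigcap_measurable => // i _.
rewrite -[X in measurable X]setTI; by apply: measurable_coor.
Qed.

Lemma continuous_sum_coord : continuous (@sqnorm R n).
Proof.
apply: (@continuous_sum R n _ _ (fun i (x : 'rV[R]_n) => x ord0 i ^+ 2)) => i x.
by apply: (@for_continuousX R 'rV[R]_n); exact: coord_continuous.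
Qed.

Lemma smooth_C1 f : smooth f -> C1 f.
Proof.
move=> sf; have [c0 d0] := sf [::]; split=> // i; split; first exact: d0.
by have [] := sf [:: i].
Qed.

Lemma smooth_partial f i : smooth f -> smooth (partial i f).
Proof. by move=> sf s; have := sf (rcons s i); rewrite foldr_rcons. Qed.

Lemma test_fun_boxed phi : test_fun k phi ->
  exists M d : R, 0 < d /\ boxed is_positive M d phi.
Proof.
move=> [_ [K [cK KD phiK]]].
have [K0|/set0P K0'] := eqVneq K set0.
  by exists 0, 1; split=> // x; rewrite phiK ?eqxx// K0.
have cc i : {within K, continuous (fun x : 'rV[R]_n => x ord0 i)}.
  by apply: continuous_subspaceT => x; exact: coord_continuous.
have mn i : exists2 e : R, 0 < e & forall x, K x -> is_positive i -> e <= x ord0 i.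
  have [c] := compact_EVT_min K0' cK (cc i); rewrite inE => Kc cmin.
  have [bi|bi] := boolP (is_positive i); last by exists 1.
  exists (c ord0 i); first exact: KD.
  by move=> x Kx _; apply: cmin; rewrite inE.
have mx i : exists e : R, forall x, K x -> `|x ord0 i| <= e.
  have cn : {within K, continuous (fun x : 'rV[R]_n => `|x ord0 i|)}.
    have cnorm (T : topologicalType) (h : T -> R) t : {for t, continuous h} ->
        {for t, continuous (fun s => `|h s|)} by move=> ch; exact: cvg_norm.
    apply: continuous_subspaceT => x.
    by apply: (cnorm 'rV[R]_n); exact: coord_continuous.
  have [c] := compact_EVT_max K0' cK cn; rewrite inE => Kc cmax.
  by exists `|c ord0 i| => x Kx; apply: cmax; rewrite inE.
have [e e0 eK] : exists2 e : 'I_n -> R, (forall i, 0 < e i) &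
    forall i x, K x -> is_positive i -> e i <= x ord0 i.
  have /choice[e he] (i : 'I_n) : exists e : R, 0 < e /\ forall x, K x -> is_positive i -> e <= x ord0 i.
    by have [e e0 h] := mn i; exists e.
  by exists e => i; case: (he i).
have /choice[m hm] := mx.
exists (\big[Num.max/0]_i m i), (\big[Num.min/1]_i e i); split.
  by apply/bigmin_gtP; split.
move=> x phix i; have Kx : K x by apply: contrapT => /phiK /eqP; rewrite (negbTE phix).
split; first by apply: le_trans (hm i x Kx) _; exact: le_bigmax.
by move=> bi; apply: le_trans (eK i x Kx bi); exact: bigmin_le.
Qed.

Lemma boxed_orthant M d f : 0 < d -> boxed is_positive M d f ->
  forall x, ~ D x -> f x = 0.
Proof.
move=> d0 fb x; apply: contra_notP => /eqP /fb h i bi.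
by have [_ /(_ bi)] := h i; exact: lt_le_trans.
Qed.

Lemma sqnorm_ge0 (x : 'rV[R]_n) : 0 <= sqnorm x.
Proof. by apply: sumr_ge0 => i _; exact: sqr_ge0. Qed.

Lemma coord_le_sqnorm (x : 'rV[R]_n) i : x ord0 i ^+ 2 <= sqnorm x.
Proof.
rewrite /sqnorm (bigD1 i)//= lerDl.
by apply: sumr_ge0 => j _; exact: sqr_ge0.
Qed.

Lemma last_positive : exists i : 'I_n, is_positive i.
Proof.
have h : (n.-1 < n)%N by lia.
by exists (Ordinal h); rewrite /is_positive/=; lia.
Qed.

Lemma sqnorm_gt0 (x : 'rV[R]_n) : D x -> 0 < sqnorm x.
Proof.
move=> Dx; have [i bi] := last_positive.
by apply: lt_le_trans (coord_le_sqnorm x i); rewrite exprn_gt0// Dx.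
Qed.

Definition radius (x : 'rV[R]_n) := Num.sqrt (sqnorm x).

Lemma radius_sqr x : radius x ^+ 2 = sqnorm x.
Proof. by rewrite sqr_sqrtr// sqnorm_ge0. Qed.

Lemma radius_gt0 x : D x -> 0 < radius x.
Proof. by move=> Dx; rewrite sqrtr_gt0 sqnorm_gt0. Qed.

Lemma measurable_radius : measurable_fun [set: 'rV[R]_n] radius.
Proof.
apply: continuous_measurable_rV => x.
by apply: continuous_comp; [exact: continuous_sum_coord|exact: sqrt_continuous].
Qed.

Lemma ground_state_orthant c (x : 'rV[R]_n) : D x -> ground_state is_positive c x =
  (\prod_(i < n | (n - k <= i)%N) x ord0 i) *
  ((\prod_i (Num.sqrt (\int[lebesgue_measure]_s (profile (is_positive i) c s ^+ 2)))^-1)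
   * expR (- c * sqnorm x)).
Proof.
move=> Dx; rewrite /ground_state /tensor.
have e : expR (- c * sqnorm x) = \prod_i expR (- c * x ord0 i ^+ 2).
  by rewrite -expR_sum /sqnorm mulr_sumr.
rewrite e [in RHS]big_mkcond/= -big_split/= -big_split/=; apply: eq_bigr => i _.
rewrite /nprofile profile_pos; last exact: Dx.
by rewrite -/(is_positive i); case: (is_positive i); ring.
Qed.

Lemma ground_state_out c x : ~ D x -> ground_state is_positive c x = 0.
Proof.
move=> nDx; have [i [bi xi]] : exists i : 'I_n, is_positive i /\ x ord0 i <= 0.
  apply: contrapT => h; apply: nDx => i bi; rewrite ltNge; apply/negP => xi.
  by apply: h; exists i.
rewrite /ground_state /tensor (bigD1 i)//= /nprofile bi profile_le0//.
by rewrite !mul0r.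
Qed.

(** Each coordinate contributes [2 * c], and each of the [k] positive ones [4 * c] more. This is the
    origin of the constant [(n + 2 * k) / 2] in the deficit. *)
Lemma sum_ground_energy (c : R) : \sum_i ground_energy (is_positive i) c = 2 * c * (n + 2 * k)%:R.
Proof.
have e i : ground_energy (is_positive i) c = 2 * c + (if is_positive i then 4 * c else 0).
  by rewrite /ground_energy; case: is_positive; [ring|rewrite addr0].
under eq_bigr do rewrite e.
rewrite big_split/= sumr_const card_ord -big_mkcond/= sumr_const.
have -> : #|[pred i | is_positive i]| = k.
  have /andP[k1 kn'] := kn.
  rewrite -sum1_card.
  transitivity (\sum_(0 <= i < n | (n - k <= i)%N) 1)%N; first by rewrite big_mkord.
  rewrite (big_cat_nat _ (n := n - k))//=; last exact: leq_subr.
  rewrite big_nat_cond big1 ?add0n; last by move=> i /andP[/andP[_ ?]]; rewrite leqNgt => /negP.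
  rewrite big_nat_cond (eq_bigl (fun i => (n - k <= i < n)%N && true)); last first.
    by move=> i; case: (n - k <= i)%N; rewrite ?andbT//= andbF.
  by rewrite -big_nat_cond sum_nat_const_nat muln1 subKn.
by rewrite -[2 * c *+ n]mulr_natr -[4 * c *+ k]mulr_natr natrD natrM; ring.
Qed.

End test_functions.

Section finite_sums.
Context d (T : measurableType d) (R : realType).
Variables (mu : {measure set T -> \bar R}) (D : set T).
Hypothesis mD : measurable D.

Lemma Rintegral_sum I (s : seq I) (F : I -> T -> R) :
  (forall i, mu.-integrable D (fun x => (F i x)%:E)) ->
  mu.-integrable D (fun x => (\sum_(i <- s) F i x)%:E) /\
  \int[mu]_(x in D) (\sum_(i <- s) F i x) = \sum_(i <- s) \int[mu]_(x in D) F i x.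
Proof.
move=> iF; elim: s => [|i s [IH1 IH2]].
  under eq_fun do rewrite big_nil; under eq_Rintegral do rewrite big_nil.
  rewrite big_nil; split; first exact: integrable0.
  by rewrite /Rintegral integral0.
under eq_fun do rewrite big_cons; under eq_Rintegral do rewrite big_cons.
rewrite big_cons -IH2; split; first exact: integrable_addr.
by rewrite (RintegralD mD (iF i) IH1).
Qed.

Lemma cvg_bigsum I (s : seq I) (F : I -> nat -> R) (a : I -> R) :
  (forall i, F i @ \oo --> a i) ->
  (fun j => \sum_(i <- s) F i j) @ \oo --> \sum_(i <- s) a i.
Proof.
move=> Fa; elim: s => [|i s IHs].
  by under eq_fun do rewrite big_nil; rewrite big_nil; exact: cvg_cst.
by under eq_fun do rewrite big_cons; rewrite big_cons; exact: cvgD.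
Qed.

End finite_sums.

Section completion.
Context {R : realType} {n k : nat}.
Hypothesis kn : (1 <= k <= n)%N.
Local Notation leb := (@lebesgue_rV R n).
Local Notation D := (@orthant R n k).
Local Notation mD := (@measurable_orthant R n k).
Local Notation pos := (@is_positive n k).
Implicit Types (phi u : 'rV[R]_n -> R).

Lemma continuous_radius : continuous (@radius R n).
Proof.
move=> x; apply: (@continuous_comp _ _ _ (@sqnorm R n) Num.sqrt).
  exact: continuous_sum_coord.
exact: sqrt_continuous.
Qed.

Lemma test_fun_square_integrable phi : test_fun k phi ->
  [/\ square_integrable leb setT phi,
      forall i, square_integrable leb setT (partial i phi) &
      square_integrable leb setT (fun x => radius x * phi x)].
Proof.
move=> tphi; have [M [d [d0 fb]]] := test_fun_boxed tphi.
have f1 := smooth_C1 tphi.1; have cf := f1.1.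
split.
- exact: boxed_square_integrable cf fb.
- move=> i; apply: boxed_square_integrable (boxed_partial (i := i) fb).
  exact: C1_partial_continuous.
- apply: (@boxed_square_integrable _ _ pos M d).
    move=> x; apply: (@for_continuousM R 'rV[R]_n); last exact: cf.
    exact: continuous_radius.
  by move=> x; rewrite mulf_eq0 negb_or => /andP[_ /fb].
Qed.

Lemma test_fun_out phi : test_fun k phi -> forall x, ~ D x ->
  phi x = 0 /\ forall i, partial i phi x = 0.
Proof.
move=> tphi x Dx; have [M [d [d0 fb]]] := test_fun_boxed tphi; split.
  exact: boxed_orthant d0 fb x Dx.
by move=> i; exact: boxed_orthant d0 (boxed_partial (i := i) fb) x Dx.
Qed.

Lemma test_fun_gap phi c : test_fun k phi -> 0 < c ->
  (4 * c + 2 * c * (n + 2 * k)%:R) * \int[leb]_(x in D) (phi x ^+ 2) <=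
  \sum_i \int[leb]_(x in D) (partial i phi x ^+ 2) +
  4 * c ^+ 2 * \int[leb]_(x in D) ((radius x * phi x) ^+ 2) +
  4 * c * (\int[leb]_(x in D) (phi x * ground_state pos c x)) ^+ 2.
Proof.
move=> tphi c0; have [M [d [d0 fb]]] := test_fun_boxed tphi.
have [L0 L1 Lr] := test_fun_square_integrable tphi.
have out := test_fun_out tphi.
have e1 : \int[leb]_(x in D) (phi x ^+ 2) = \int[leb]_x (phi x ^+ 2).
  by apply: Rintegral_support => x /out[-> _]; rewrite expr0n.
have e2 : \int[leb]_(x in D) ((radius x * phi x) ^+ 2) = \int[leb]_x ((radius x * phi x) ^+ 2).
  by apply: Rintegral_support => x /out[-> _]; rewrite mulr0 expr0n.
have e3 : \int[leb]_(x in D) (phi x * ground_state pos c x) = \int[leb]_x (phi x * ground_state pos c x).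
  by apply: Rintegral_support => x /out[-> _]; rewrite mul0r.
have e4 : \sum_i \int[leb]_(x in D) (partial i phi x ^+ 2) = \sum_i \int[leb]_x (partial i phi x ^+ 2).
  by apply: eq_bigr => i _; apply: Rintegral_support => x /out[_ ->]; rewrite expr0n.
rewrite e1 e2 e3 e4.
have := orthant_gap c0 d0 (smooth_C1 tphi.1) fb.
have [iS ES] := Rintegral_sum measurableT (index_enum 'I_n) (fun i => (L1 i).2).
rewrite [leRHS](@eq_Rintegral _ _ _ _ _ (fun x => (\sum_i partial i phi x ^+ 2) +
  (4 * c ^+ 2 * ((radius x * phi x) ^+ 2) - 2 * c * (n + 2 * k)%:R * phi x ^+ 2))); last first.
  move=> x _; rewrite /energy big_split/=; congr (_ + _).
  rewrite -mulr_suml sumrB (sum_ground_energy kn) exprMn radius_sqr /sqnorm.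
  under eq_bigr do rewrite exprMn.
  rewrite -mulr_sumr; ring.
have iN := integrable_scaler measurableT (2 * c * (n + 2 * k)%:R) L0.2.
have iB := integrable_scaler measurableT (4 * c ^+ 2) Lr.2.
rewrite (RintegralD measurableT iS (integrable_subr measurableT iB iN)).
rewrite (RintegralB measurableT iB iN) (RintegralZl _ measurableT Lr.2).
rewrite (RintegralZl _ measurableT L0.2).
rewrite ES; lra.
Qed.

Lemma measurable_radius_inv : measurable_fun [set: 'rV[R]_n] (fun x => (radius x)^-1).
Proof.
under eq_fun do rewrite -powR_inv1 ?sqrtr_ge0//.
exact: measurableT_comp (measurable_powR _) measurable_radius.
Qed.

(** A positive coordinate is a factor of the ground state and is at most [|x|] in absolute value, so
    it cancels the singularity of [1 / |x|] at the origin; a tensor product of Gaussian type remains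
    as a majorant. *)
Lemma ground_state_over_radius c : 0 < c ->
  square_integrable leb D (fun x => ground_state pos c x / radius x).
Proof.
move=> c0; have [i0 bi0] := last_positive kn.
set Z := Num.sqrt (\int[lebesgue_measure]_s (profile true c s ^+ 2)).
(* The factors of the ground state, with the linear term dropped at [i0]. *)
pose h i (t : R) := if i == i0 then Z^-1 * expR (- c * t ^+ 2) else nprofile (pos i) c t.
have Lh i : square_integrable lebesgue_measure [set: measurableTypeR R] (h i).
  rewrite /h; case: eqP => [_|_]; last exact: square_integrable_nprofile.
  apply: square_integrableZ => //; split.
    by apply: continuous_measurable_RR; exact: continuous_gauss.
  have c2 : 0 < 2 * c by rewrite mulr_gt0.
  apply: eq_integrable (integrable_expRN_sqr c2) => // t _.
  by rewrite -expRM_natl; congr (expR _)%:E; ring.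
have Lth : square_integrable leb setT (tensor h).
  split; first by apply: measurable_tensor => i; case: (Lh i).
  have [] := integrable_tensorn (fun i => (Lh i).2).
  by under eq_fun do rewrite /tensor prodrXl.
have mG : measurable_fun [set: 'rV[R]_n] (ground_state pos c).
  by have [[]] := square_integrable_ground_state pos c0.
apply: (square_integrable_dominated _ _ (square_integrable_subset mD Lth)).
- exact: mD.
- by apply: measurable_funTS; apply: measurable_funM => //; exact: measurable_radius_inv.
- move=> x Dx; have r0 := radius_gt0 kn Dx.
  rewrite normrM normfV (gtr0_norm r0) ler_pdivrMr//.
  rewrite /ground_state /tensor (bigD1 i0)//= [in leRHS](bigD1 i0)//= {1}/h eqxx !normrM.
  have -> : \prod_(i < n | i != i0) h i (x ord0 i) = \prod_(i < n | i != i0) nprofile (pos i) c (x ord0 i).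
    by apply: eq_bigr => i /negbTE ii0; rewrite /h ii0.
  rewrite bi0 -/Z max_l; last by rewrite ltW ?Dx.
  have x0r : `|x ord0 i0| <= radius x.
    by rewrite /radius -sqrtr_sqr ler_sqrt ?sqnorm_ge0// coord_le_sqnorm.
  rewrite [leLHS](_ : _ = `|Z^-1| * `|expR (- c * x ord0 i0 ^+ 2)| *
    `|\prod_(i < n | i != i0) nprofile (pos i) c (x ord0 i)| * `|x ord0 i0|); last by ring.
  by rewrite ler_wpM2l// !mulr_ge0.
Qed.

Section limit.
Variables (u : 'rV[R]_n -> R) (G : 'rV[R]_n -> 'rV[R]_n).
Variable phi : nat -> 'rV[R]_n -> R.
Hypothesis mu_ : measurable_fun D u.
Hypothesis mG : measurable_fun D G.
Hypothesis tphi : forall j, test_fun k (phi j).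
Hypothesis phiG : (fun j => \int[leb]_(x in D) (sqnorm (grad (phi j) x - G x))%:E)%E @ \oo --> 0%E.
Hypothesis phiu : (fun j => \int[leb]_(x in D) (sqnorm x * (phi j x - u x) ^+ 2)%:E)%E @ \oo --> 0%E.

Let L0 j := square_integrable_subset mD (let: And3 h _ _ := test_fun_square_integrable (tphi j) in h).
Let L1 j i := square_integrable_subset mD (let: And3 _ h _ := test_fun_square_integrable (tphi j) in h i).
Let Lr j := square_integrable_subset mD (let: And3 _ _ h := test_fun_square_integrable (tphi j) in h).

Lemma measurable_sqnorm : measurable_fun [set: 'rV[R]_n] (@sqnorm R n).
Proof. exact: continuous_measurable_rV (@continuous_sum_coord R n). Qed.

Lemma gradient_limit i : square_integrable leb D (fun x => G x ord0 i) /\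
  (fun j => \int[leb]_(x in D) ((partial i (phi j) x - G x ord0 i) ^+ 2)) @ \oo --> 0.
Proof.
have mGi i' : measurable_fun D (fun x => G x ord0 i').
  exact: (measurableT_comp (measurable_coor i') mG).
apply: (@square_integrable_lim _ _ _ leb D mD (fun j => partial i (phi j)) _ (L1^~ i)
    (fun j x => sqnorm (grad (phi j) x - G x)) 1) => //.
- move=> j; apply: measurable_sum => i'.
  apply: measurable_funX; under eq_fun do rewrite !mxE.
  by apply: measurable_funB => //; case: (L1 j i').
- move=> j x _; rewrite mul1r; apply: le_trans (coord_le_sqnorm _ i).
  by rewrite !mxE.
- by move=> j x _; exact: sqnorm_ge0.
Qed.

Lemma weighted_limit (w : 'rV[R]_n -> R) c :
  measurable_fun [set: 'rV[R]_n] w -> 0 <= c ->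
  (forall x, w x ^+ 2 <= c * sqnorm x) ->
  (forall j, square_integrable leb D (fun x => w x * phi j x)) ->
  square_integrable leb D (fun x => w x * u x) /\
  (fun j => \int[leb]_(x in D) ((w x * phi j x - w x * u x) ^+ 2)) @ \oo --> 0.
Proof.
move=> mw c0 wc Lw; have mwD : measurable_fun D w by exact: measurable_funTS.
apply: (@square_integrable_lim _ _ _ leb D mD (fun j x => w x * phi j x) _ Lw
    (fun j x => sqnorm x * (phi j x - u x) ^+ 2) c) => //.
- exact: measurable_funM.
- move=> j; apply: measurable_funM; first by apply: measurable_funTS; exact: measurable_sqnorm.
  by apply: measurable_funX; apply: measurable_funB => //; case: (L0 j).
- by move=> j x _; rewrite -mulrBr exprMn mulrA ler_wpM2r ?sqr_ge0.
- by move=> j x _; rewrite mulr_ge0 ?sqr_ge0 ?sqnorm_ge0.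
Qed.

Lemma radius_limit : square_integrable leb D (fun x => radius x * u x) /\
  (fun j => \int[leb]_(x in D) ((radius x * phi j x - radius x * u x) ^+ 2)) @ \oo --> 0.
Proof.
apply: (weighted_limit measurable_radius ler01) => [x|]; last exact: Lr.
by rewrite radius_sqr mul1r.
Qed.

(** Only [radius * phi j] is known to converge in mean square, so the pairing is split into that
    function and [h / radius]. Besides the ground state, [h] will be a derivative of a function
    against which the weak gradient is tested. *)
Lemma ground_state_limit (h : 'rV[R]_n -> R) :
  square_integrable leb D (fun x => h x / radius x) ->
  (fun j => \int[leb]_(x in D) (phi j x * h x)) @ \oo --> \int[leb]_(x in D) (u x * h x).
Proof.
move=> Lh; have [Lu lim] := radius_limit.
have e (f : 'rV[R]_n -> R) : \int[leb]_(x in D) (f x * h x) =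
    \int[leb]_(x in D) ((radius x * f x) * (h x / radius x)).
  apply: eq_Rintegral => x; rewrite inE => Dx; field.
  by rewrite gt_eqF// (radius_gt0 kn).
by rewrite e; under eq_fun do rewrite e; exact: (cvg_dot mD Lr Lu lim Lh).
Qed.

(** The weight [w] is at most [m * |x|], so the weighted approximations converge in the norm of the
    completion, and at most 1, so inserting it on the left keeps the inequality for test
    functions. *)
Lemma limit_gap c m : 0 < c ->
  let w := fun x => Num.min (m%:R * radius x) 1 in
  square_integrable leb D (fun x => w x * u x) /\
  (4 * c + 2 * c * (n + 2 * k)%:R) * \int[leb]_(x in D) ((w x * u x) ^+ 2) <=
  \int[leb]_(x in D) (sqnorm (G x)) +
  4 * c ^+ 2 * \int[leb]_(x in D) (sqnorm x * u x ^+ 2) +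
  4 * c * (\int[leb]_(x in D) (u x * ground_state pos c x)) ^+ 2.
Proof.
move=> c0 w.
have w0 x : 0 <= w x by rewrite le_min ler01 mulr_ge0// sqrtr_ge0.
have w1 x : w x <= 1 by rewrite ge_min lexx orbT.
have mw : measurable_fun [set: 'rV[R]_n] w.
  apply: measurable_minr => //.
  by apply: measurable_funM => //; exact: measurable_radius.
have Lw j : square_integrable leb D (fun x => w x * phi j x).
  apply: (square_integrable_dominated mD _ (L0 j)).
    by apply: measurable_funM; [exact: measurable_funTS|case: (L0 j)].
  by move=> x _; rewrite normrM ger0_norm// ler_piMl.
have [Lwu limw] : square_integrable leb D (fun x => w x * u x) /\
  (fun j => \int[leb]_(x in D) ((w x * phi j x - w x * u x) ^+ 2)) @ \oo --> 0.
  apply: (weighted_limit mw (sqr_ge0 m%:R)) => // x.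
  rewrite -radius_sqr -exprMn lerXn2r ?nnegrE ?mulr_ge0 ?sqrtr_ge0//.
  by rewrite ge_min lexx.
split=> //.
have [Lu limr] := radius_limit.
have cA := cvg_bigsum (s := index_enum 'I_n) (fun i => cvg_sqnorm mD (L1^~ i) (gradient_limit i).1 (gradient_limit i).2).
have cB := cvg_sqnorm mD Lr Lu limr.
have cC := ground_state_limit (ground_state_over_radius c0).
have cW := cvg_sqnorm mD Lw Lwu limw.
have -> : \int[leb]_(x in D) (sqnorm (G x)) = \sum_i \int[leb]_(x in D) (G x ord0 i ^+ 2).
  by have [_ <-] := Rintegral_sum mD (index_enum 'I_n) (fun i => (gradient_limit i).1.2).
have -> : \int[leb]_(x in D) (sqnorm x * u x ^+ 2) = \int[leb]_(x in D) ((radius x * u x) ^+ 2).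
  by apply: eq_Rintegral => x _; rewrite exprMn radius_sqr.
apply: (@ler_cvg_to _ _ eventually_filter _ (fun j => (4 * c + 2 * c * (n + 2 * k)%:R) * \int[leb]_(x in D) ((w x * phi j x) ^+ 2))
  (fun j => \sum_i \int[leb]_(x in D) (partial i (phi j) x ^+ 2) +
    4 * c ^+ 2 * \int[leb]_(x in D) ((radius x * phi j x) ^+ 2) +
    4 * c * (\int[leb]_(x in D) (phi j x * ground_state pos c x)) ^+ 2)).
- by apply: cvgMr.
- apply: cvgD; first by apply: cvgD => //; apply: cvgMr.
  by apply: cvgMr; apply: cvgM.
- apply: nearW => j; apply: le_trans (test_fun_gap (tphi j) c0).
  have e0 : 0 <= 4 * c + 2 * c * (n + 2 * k)%:R :> R.
    by rewrite addr_ge0 ?mulr_ge0 ?(ltW c0).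
  apply: (ler_wpM2l e0).
  apply: le_Rintegral => //; [exact: mD|exact: (Lw j).2|exact: (L0 j).2|].
  by move=> x _; rewrite exprMn ler_piMl ?sqr_ge0// expr_le1.
Qed.

(** The right side of the truncated inequality does not depend on [m], and on the orthant the
    weights increase to 1. *)
Lemma limit_square_integrable : square_integrable leb D u /\ forall c, 0 < c ->
  (4 * c + 2 * c * (n + 2 * k)%:R) * \int[leb]_(x in D) (u x ^+ 2) <=
  \int[leb]_(x in D) (sqnorm (G x)) +
  4 * c ^+ 2 * \int[leb]_(x in D) (sqnorm x * u x ^+ 2) +
  4 * c * (\int[leb]_(x in D) (u x * ground_state pos c x)) ^+ 2.
Proof.
have H c : 0 < c -> square_integrable leb D u /\
  (4 * c + 2 * c * (n + 2 * k)%:R) * \int[leb]_(x in D) (u x ^+ 2) <=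
  \int[leb]_(x in D) (sqnorm (G x)) +
  4 * c ^+ 2 * \int[leb]_(x in D) (sqnorm x * u x ^+ 2) +
  4 * c * (\int[leb]_(x in D) (u x * ground_state pos c x)) ^+ 2.
  move=> c0; have e0 : 0 < 4 * c + 2 * c * (n + 2 * k)%:R.
    by rewrite ltr_wpDr ?mulr_ge0 ?mulr_gt0// ltW.
  rewrite mulrC -ler_pdivlMr//.
  apply: (square_integrable_monotone_limit mD (w_ := fun m x => Num.min (m%:R * radius x) 1)) => //.
  - move=> m; apply: measurable_funTS; apply: measurable_minr => //.
    by apply: measurable_funM => //; exact: measurable_radius.
  - by move=> m x _; rewrite le_min ler01 mulr_ge0// sqrtr_ge0.
  - move=> x _ m m' mm'; rewrite le_min !ge_min lexx orbT andbT; apply/orP; left.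
    by rewrite ler_wpM2r ?sqrtr_ge0// ler_nat.
  - move=> x Dx; have r0 := radius_gt0 kn Dx.
    have := @nbhs_infty_ger R (radius x)^-1; apply: filterS => m hm.
    by apply/min_idPr; rewrite -ler_pdivrMr// div1r.
  - by move=> m; case: (limit_gap m c0).
  - by move=> m; have [_] := limit_gap m c0; rewrite mulrC -ler_pdivlMr.
split; first by case: (H 1 ltr01).
by move=> c /H[].
Qed.

End limit.
End completion.

(** * From the spectral gap to the deficit *)

Section deficit.
Context {R : realType} {n k : nat}.
Hypothesis kn : (1 <= k <= n)%N.
Local Notation leb := (@lebesgue_rV R n).
Local Notation D := (@orthant R n k).
Local Notation mD := (@measurable_orthant R n k).
Local Notation pos := (@is_positive n k).
Implicit Types (phi u : 'rV[R]_n -> R).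

Lemma dist_Etilde_le u w : Etilde k w ->
  \int[leb]_(x in D) (u x ^+ 2) = \int[leb]_(x in D) (w x ^+ 2) ->
  dist_Etilde k u <= \int[leb]_(x in D) ((u x - w x) ^+ 2).
Proof.
move=> Ew uw; apply: ge_inf; last by exists w.
by exists 0 => _ [w' _ <-]; apply: Rintegral_ge0 => x _; exact: sqr_ge0.
Qed.

Lemma Etilde_ground_state c (a : R) : 0 < c -> exists w : 'rV[R]_n -> R,
  Etilde k w /\ forall x, D x -> w x = a * ground_state pos c x.
Proof.
move=> c0; eexists; split; first by exists (a * \prod_i
    (Num.sqrt (\int[lebesgue_measure]_s (profile (pos i) c s ^+ 2)))^-1), c.
by move=> x Dx /=; rewrite ground_state_orthant//; ring.
Qed.

Lemma ground_state_orthant_sqnorm c : 0 < c ->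
  square_integrable leb D (ground_state pos c) /\
  \int[leb]_(x in D) (ground_state pos c x ^+ 2) = 1.
Proof.
move=> c0; have [L e] := square_integrable_ground_state pos c0.
split; first by apply: (square_integrable_subset mD); exact: L.
by rewrite Rintegral_support// => x Dx; rewrite ground_state_out// expr0n.
Qed.

(* With [N = |u|^2] and [C] the coefficient of [u] on the normalized Gaussian,
   the nearest profile of the same norm is at squared distance
   [2 (N - sqrt N |C|)], and [N - C^2 >= N - sqrt N |C|]. *)
Lemma dist_Etilde_ground_state u c : 0 < c -> square_integrable leb D u ->
  2^-1 * dist_Etilde k u <= \int[leb]_(x in D) (u x ^+ 2) -
    (\int[leb]_(x in D) (u x * ground_state pos c x)) ^+ 2.
Proof.
move=> c0 Lu; have [Lg g1] := ground_state_orthant_sqnorm c0.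
set N := \int[leb]_(x in D) (u x ^+ 2).
set C := \int[leb]_(x in D) (u x * ground_state pos c x).
have N0 : 0 <= N by exact: Rintegral_sqr_ge0.
have CN : C ^+ 2 <= N by have := Rintegral_cauchy_schwarz mD Lu Lg; rewrite g1 mulr1.
have CsN : `|C| <= Num.sqrt N by rewrite -sqrtr_sqr ler_sqrt.
have sN : Num.sqrt N ^+ 2 = N by rewrite sqr_sqrtr.
(* Of the two multiples of the ground state that have the norm of [u], the sign [s] selects the one
   nearer to [u]. *)
pose s : R := if 0 <= C then 1 else -1.
have s2 : s ^+ 2 = 1 by rewrite /s; case: ifP => _; rewrite ?sqrrN expr1n.
have sC : s * C = `|C|.
  rewrite /s; case: ifPn => C0; first by rewrite mul1r ger0_norm.
  by rewrite mulN1r ltr0_norm// ltNge.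
have [w [Ew wE]] := Etilde_ground_state (s * Num.sqrt N) c0.
have wN : \int[leb]_(x in D) (w x ^+ 2) = N.
  rewrite (@eq_Rintegral _ _ _ _ _ (fun x => N * ground_state pos c x ^+ 2)); last first.
    by move=> x; rewrite inE => /wE ->; rewrite 2!exprMn s2 sN mul1r.
  by rewrite RintegralZl ?g1 ?mulr1//; [exact: mD|exact: Lg.2].
have := dist_Etilde_le Ew (esym wN).
have -> : \int[leb]_(x in D) ((u x - w x) ^+ 2) = 2 * (N - Num.sqrt N * `|C|).
  have := Rintegral_sqrB mD 1 (s * Num.sqrt N) Lu Lg.
  rewrite g1 -/C -/N => e; rewrite -sC.
  transitivity (\int[leb]_(x in D) ((1 * u x - s * Num.sqrt N * ground_state pos c x) ^+ 2)).
    by apply: eq_Rintegral => x; rewrite inE => /wE ->; rewrite mul1r.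
  rewrite e exprMn s2 sN; ring.
move=> h; apply: (@le_trans _ _ (N - Num.sqrt N * `|C|)).
  by rewrite ler_pdivrMl.
have -> : C ^+ 2 = `|C| ^+ 2 by rewrite real_normK// num_real.
rewrite lerD2l lerN2 expr2.
by rewrite ler_wpM2r.
Qed.

Lemma S_grad_pair u : S_space k u -> completion_pair k u (S_grad k u).
Proof. by move=> [G uG]; apply: (@xgetPex _ (fun=> 0) [set G | completion_pair k u G]); exists G. Qed.

Theorem rho1_ge u : S_space k u -> 2^-1 * dist_Etilde k u <= rho1 k u.
Proof.
move=> /S_grad_pair; rewrite /rho1; set G := S_grad k u.
move=> [mu_ mG [phi [tphi phiG phiu]]].
have [Lu H] := limit_square_integrable kn mu_ mG tphi phiG phiu.
set A := \int[leb]_(x in D) (sqnorm (G x)).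
set B := \int[leb]_(x in D) (sqnorm x * u x ^+ 2).
set N := \int[leb]_(x in D) (u x ^+ 2).
have [e0 e0E] : exists e0 : R, e0 = (n + 2 * k)%:R by eexists.
rewrite -e0E.
have A0 : 0 <= A by apply: Rintegral_ge0 => x _; exact: sqnorm_ge0.
have B0 : 0 <= B.
  by apply: Rintegral_ge0 => x _; rewrite mulr_ge0 ?sqr_ge0 ?sqnorm_ge0.
have N0 : 0 <= N by exact: Rintegral_sqr_ge0.
have e00 : 0 < e0 by rewrite e0E ltr0n; lia.
have gap c (c0 : 0 < c) := dist_Etilde_ground_state c0 Lu.
(* When [N = 0] the optimal [c] may not exist, but any [c] shows that the distance term is at most
   0, while the deficit is a product of square roots. *)
have [Ngt0|Nle0] := ltP 0 N; last first.
  have N_0 : N = 0 by apply/eqP; rewrite eq_le Nle0.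
  apply: (le_trans (gap 1 ltr01)); rewrite -/N N_0 mulr0 subr0 sub0r.
  by apply: (@le_trans _ _ 0); rewrite ?oppr_le0 ?sqr_ge0// mulr_ge0// sqrtr_ge0.
(* The uncertainty inequality for each [c], from the gap and [C ^+ 2 <= N]. A small [c] then
   excludes [A = 0], and a large one excludes [B = 0]. *)
have ABc c : 0 < c -> 2 * c * e0 * N <= A + 4 * c ^+ 2 * B.
  move=> c0; have := H c c0; rewrite -/A -/B -/N -e0E.
  have [Lg g1] := ground_state_orthant_sqnorm c0.
  have := Rintegral_cauchy_schwarz mD Lu Lg; rewrite g1 mulr1 -/N.
  set C := \int[leb]_(x in D) (u x * _) => CN.
  have : 4 * c * C ^+ 2 <= 4 * c * N by rewrite ler_wpM2l// mulr_ge0// ltW.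
  lra.
have eN : 0 < e0 * N by rewrite mulr_gt0.
have Agt0 : 0 < A.
  rewrite lt_neqAle A0 andbT; apply/eqP => A_0.
  have d0 : 0 < 4 * B + 1 by rewrite ltr_wpDl// mulr_ge0.
  have c0 : 0 < e0 * N / (4 * B + 1) by rewrite divr_gt0.
  have := ABc _ c0; rewrite -A_0 add0r.
  set c := e0 * N / _.
  have cB : c * (4 * B + 1) = e0 * N by rewrite /c divfK ?gt_eqF.
  rewrite -/c in c0; nra.
have Bgt0 : 0 < B.
  rewrite lt_neqAle B0 andbT; apply/eqP => B_0.
  have c0 : 0 < (A + 1) / (2 * (e0 * N)) by rewrite divr_gt0 ?mulr_gt0// ltr_wpDl.
  have := ABc _ c0; rewrite -B_0 mulr0 addr0.
  have -> : 2 * ((A + 1) / (2 * (e0 * N))) * e0 * N = A + 1.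
    by field; apply/andP; split; rewrite gt_eqF.
  lra.
have sA : 0 < Num.sqrt A by rewrite sqrtr_gt0.
have sB : 0 < Num.sqrt B by rewrite sqrtr_gt0.
have sA2 : Num.sqrt A ^+ 2 = A by rewrite sqr_sqrtr.
have sB2 : Num.sqrt B ^+ 2 = B by rewrite sqr_sqrtr.
move: sA sB sA2 sB2; set a := Num.sqrt A; set b := Num.sqrt B => a0 b0 a2 b2.
(* This choice makes [A] equal to [4 * c ^+ 2 * B], so their sum is [4 * c * (a * b)], the equality
   case of the inequality of arithmetic and geometric means. *)
pose c := a / (2 * b).
have c0 : 0 < c by rewrite divr_gt0 ?mulr_gt0.
apply: (le_trans (gap c c0)); rewrite -/N.
have := H c c0; rewrite -/A -/B -/N -e0E.
set C := \int[leb]_(x in D) (u x * _).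
have -> : A + 4 * c ^+ 2 * B + 4 * c * C ^+ 2 = 2 * (2 * c) * (a * b + C ^+ 2).
  by rewrite -a2 -b2 /c; field; rewrite gt_eqF.
have -> : (4 * c + 2 * c * e0) * N = 2 * (2 * c) * ((1 + e0 / 2) * N) by field.
have c2 : 0 < 2 * (2 * c) by lra.
by rewrite (ler_pM2l c2); lra.
Qed.

End deficit.

(** * A smooth step function *)

Section smooth_step.
Context {R : realType}.
Implicit Types (s t y : R) (p q : {poly R}) (f g h : R -> R).

(** For [p = 1] this is the classical smooth function that is flat at 0. A polynomial factor in
    [s^-1] makes the family closed under differentiation. *)
Definition flat p s : R := if 0 < s then p.[s^-1] * expR (- s^-1) else 0.

Lemma expr_le_expR m : exists2 K, 0 <= K & forall y, 0 <= y -> y ^+ m <= K * expR y.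
Proof.
case: m => [|m].
  by exists 1 => // y y0; rewrite expr0 mul1r -expR0 ler_expR.
exists (m.+1%:R ^+ m.+1); first by rewrite exprn_ge0.
move=> y y0; have N0 : 0 < m.+1%:R :> R by rewrite ltr0n.
have -> : expR y = expR (y / m.+1%:R) ^+ m.+1.
  by rewrite -expRM_natl mulrC divfK// gt_eqF.
rewrite -exprMn lerXn2r ?nnegrE ?mulr_ge0 ?expR_ge0//.
rewrite -ler_pdivrMl// mulrC; apply: le_trans (expR_ge1Dx _).
by rewrite lerDr.
Qed.

Lemma poly_le_expR p m : exists2 K, 0 <= K &
  forall y, 0 <= y -> `|p.[y]| * y ^+ m <= K * expR y.
Proof.
elim/poly_ind: p m => [|p c IHp] m.
  by exists 0 => // y _; rewrite horner0 normr0 !mul0r.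
have [K1 K10 H1] := IHp m.+1; have [K2 K20 H2] := expr_le_expR m.
exists (K1 + `|c| * K2); first by rewrite addr_ge0// mulr_ge0.
move=> y y0; rewrite hornerMXaddC.
have ym : 0 <= y ^+ m by rewrite exprn_ge0.
apply: (@le_trans _ _ ((`|p.[y]| * y + `|c|) * y ^+ m)).
  rewrite ler_wpM2r//; apply: le_trans (ler_normD _ _) _.
  by rewrite lerD2r normrM (ger0_norm y0).
rewrite !mulrDl -(mulrA `|p.[y]|) -exprS; apply: lerD; first exact: H1.
by rewrite -mulrA ler_wpM2l// H2.
Qed.

Lemma flat_bound p m : exists2 K, 0 <= K & forall s, 0 < s -> `|flat p s| <= K * s ^+ m.
Proof.
have [K K0 H] := poly_le_expR p m; exists K => // s s0; rewrite /flat s0.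
have i0 : 0 <= s^-1 by rewrite invr_ge0 ltW.
have := H _ i0; rewrite exprVn expRN normrM normfV (ger0_norm (expR_ge0 _)) => h.
rewrite ler_pdivrMr ?expR_gt0// mulrAC.
by rewrite -ler_pdivrMr ?exprn_gt0.
Qed.

Lemma flat_le0 p s : s <= 0 -> flat p s = 0.
Proof. by move=> s0; rewrite /flat ltNge s0. Qed.

Lemma flat_continuous0 p : {for (0 : R), continuous (flat p)}.
Proof.
have [K K0 H] := flat_bound p 1.
apply/cvgrPdist_le => e e0; rewrite (flat_le0 p (lexx 0)).
have K1 : 0 < K + 1 by rewrite ltr_wpDl.
apply/nbhs_ballP; exists (e / (K + 1)); first by rewrite /= divr_gt0.
move=> s; rewrite /ball/= !sub0r !normrN => se.
have [s0|s0] := ltP 0 s; last by rewrite flat_le0// normr0 ltW.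
apply: (le_trans (H s s0)); rewrite expr1; rewrite (gtr0_norm s0) in se.
apply: (@le_trans _ _ ((K + 1) * s)); first by rewrite ler_wpM2r ?(ltW s0)// lerDl.
by rewrite mulrC -ler_pdivlMr// ltW.
Qed.

Lemma is_derive_flat p s :
  is_derive s (1 : R) (flat p) (flat ((p - p^`()) * 'X^2) s).
Proof.
have [s0|s0|->] := ltgtP s 0.
- rewrite (flat_le0 _ (ltW s0)); apply: (@near_eq_is_derive _ _ _ (fun _ : R => 0 : R)).
  have : \forall z \near s, z < 0 by exact: lt_nbhsl.
  by apply: filterS => z z0; rewrite flat_le0// ltW.
- have sn : s != 0 by rewrite gt_eqF.
  apply: (@near_eq_is_derive _ _ _ (fun z : R => p.[z^-1] * expR (- z^-1))).
    have : \forall z \near s, 0 < z by exact: lt_nbhsr.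
    by apply: filterS => z z0; rewrite /flat z0.
  have d1 : is_derive s (1 : R) (fun z : R => z^-1) (- (1 / s ^+ 2)).
    exact: (@is_derive_inv _ _ id _ _ _ sn (is_derive_id s 1)).
  have d2 : is_derive s (1 : R) (fun z : R => p.[z^-1]) (p^`().[s^-1] * - (1 / s ^+ 2)).
    exact: (is_derive_comp1 d1 (is_derive_poly p _)).
  have d3 : is_derive s (1 : R) (fun z : R => expR (- z^-1)) (expR (- s^-1) * - - (1 / s ^+ 2)).
    exact: (is_derive_comp1 (is_derive_opp d1) (is_derive_expR _)).
  apply: (is_derive_eq (is_derive_mul d2 d3)).
  rewrite /flat s0 hornerM hornerD hornerN hornerXn; field.
  exact: sn.
(* At 0 the difference quotient is again a member of the family, for [p * 'X], and it tends to 0. *)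
- rewrite flat_le0//; apply/is_derive1_caratheodory; exists (flat (p * 'X)); split.
  + move=> z; rewrite (flat_le0 p (lexx 0)) !subr0 /flat; case: ifPn => z0; last by rewrite mul0r.
    by rewrite hornerMX mulrAC mulfVK// gt_eqF.
  + exact: flat_continuous0.
  + by rewrite flat_le0.
Qed.

(** A class of expressions closed under differentiation. Smoothness, which concerns all iterated
    derivatives, thereby reduces to a single derivative computed by induction on the expression. *)
Inductive smooth1 : (R -> R) -> Prop :=
| smooth1_cst c : smooth1 (fun=> c)
| smooth1_id : smooth1 (fun t => t)
| smooth1_gauss c : smooth1 (fun t => expR (- c * t ^+ 2))
| smooth1_flat p a b : smooth1 (fun t => flat p (a * t + b))
| smooth1_add f g : smooth1 f -> smooth1 g -> smooth1 (fun t => f t + g t)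
| smooth1_mul f g : smooth1 f -> smooth1 g -> smooth1 (fun t => f t * g t)
| smooth1_inv f : smooth1 f -> (forall t, f t != 0) -> smooth1 (fun t => (f t)^-1).

Lemma is_derive_affine (a b t : R) : is_derive t (1 : R) (fun t : R => a * t + b) a.
Proof.
apply: (is_derive_eq (is_derive_add (is_derive_linear a t) (is_derive_cst b t 1))).
by rewrite addr0.
Qed.

Lemma smooth1_derive f : smooth1 f ->
  exists2 f', smooth1 f' & forall t : R, is_derive t (1 : R) f (f' t).
Proof.
elim=> [c||c|p a b|g h _ [g' sg' dg] _ [h' sh' dh]|g h sg [g' sg' dg] sh [h' sh' dh]|g sg [g' sg' dg] g0].
- by exists (fun=> 0); [exact: smooth1_cst|move=> t; exact: is_derive_cst].
- by exists (fun=> 1); [exact: smooth1_cst|move=> t; exact: is_derive_id].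
- exists (fun t => expR (- c * t ^+ 2) * (- c * (2 * t))).
    apply: smooth1_mul; first exact: smooth1_gauss.
    apply: smooth1_mul; first exact: smooth1_cst.
    by apply: smooth1_mul; [exact: smooth1_cst|exact: smooth1_id].
  by move=> t; exact: is_derive_gauss.
- exists (fun t => flat ((p - p^`()) * 'X^2) (a * t + b) * a).
    by apply: smooth1_mul; [exact: smooth1_flat|exact: smooth1_cst].
  by move=> t; exact: (is_derive_comp1 (is_derive_affine a b t) (is_derive_flat p _)).
- exists (fun t => g' t + h' t); first exact: smooth1_add.
  by move=> t; exact: is_derive_add.
- exists (fun t => g' t * h t + g t * h' t).
    by apply: smooth1_add; exact: smooth1_mul.
  by move=> t; exact: is_derive_mul.
- exists (fun t => -1 * (g' t * ((g t)^-1 * (g t)^-1))).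
    apply: smooth1_mul; first exact: smooth1_cst.
    apply: smooth1_mul => //; apply: smooth1_mul; exact: smooth1_inv.
  move=> t; apply: (is_derive_eq (is_derive_inv (g0 t) (dg t))).
  by field; exact: g0.
Qed.

Lemma smooth1_continuous f : smooth1 f -> continuous f.
Proof.
move=> /smooth1_derive[f' _ df] t.
by apply/differentiable_continuous/derivable1_diffP; case: (df t).
Qed.

Definition step s : R := flat 1 s / (flat 1 s + flat 1 (1 - s)).

Lemma flat1_ge0 s : 0 <= flat 1 s.
Proof. by rewrite /flat; case: ifP => // _; rewrite hornerC mul1r expR_ge0. Qed.

Lemma flat1_gt0 s : 0 < s -> 0 < flat 1 s.
Proof. by move=> s0; rewrite /flat s0 hornerC mul1r expR_gt0. Qed.

Lemma step_denominator_gt0 s : 0 < flat 1 s + flat 1 (1 - s).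
Proof.
have [s0|s0] := ltP 0 s; first by rewrite ltr_pwDl ?flat1_gt0 ?flat1_ge0.
by rewrite ltr_wpDl ?flat1_ge0 ?flat1_gt0// subr_gt0 (le_lt_trans s0).
Qed.

Lemma step_le0 s : s <= 0 -> step s = 0.
Proof. by move=> s0; rewrite /step flat_le0// mul0r. Qed.

Lemma step_ge1 s : 1 <= s -> step s = 1.
Proof.
move=> s1; rewrite /step (@flat_le0 _ (1 - s)) ?subr_le0// addr0 divff// gt_eqF//.
by rewrite flat1_gt0// (lt_le_trans ltr01).
Qed.

Lemma step_ge0 s : 0 <= step s.
Proof. by rewrite divr_ge0 ?flat1_ge0// ltW// step_denominator_gt0. Qed.

Lemma step_le1 s : step s <= 1.
Proof. by rewrite ler_pdivrMr ?step_denominator_gt0// mul1r lerDl flat1_ge0. Qed.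

Lemma smooth1_step a b : smooth1 (fun t => step (a * t + b)).
Proof.
apply: smooth1_mul; first exact: smooth1_flat.
apply: smooth1_inv; last by move=> t; rewrite gt_eqF ?step_denominator_gt0.
apply: smooth1_add; first exact: smooth1_flat.
have -> : (fun t => flat 1 (1 - (a * t + b))) = fun t => flat 1 (- a * t + (1 - b)).
  by apply/funext => t; congr flat; ring.
exact: smooth1_flat.
Qed.

Lemma step_derive : exists step' K, [/\ 0 <= K,
  forall s : R, is_derive s (1 : R) step (step' s),
  forall s, `|step' s| <= K & forall s, s < 0 \/ 1 < s -> step' s = 0].
Proof.
have s1 : smooth1 step.
  have := smooth1_step 1 0; congr smooth1; apply/funext => t.
  by rewrite mul1r addr0.
have [step' ss' ds] := smooth1_derive s1; have cs' := smooth1_continuous ss'.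
have out s : s < 0 \/ 1 < s -> step' s = 0.
  move=> h; have [_ <-] := ds s; case: h => h.
    rewrite (@near_eq_derive _ _ _ _ (cst (0 : R))) ?derive_cst//.
    have : \forall z \near s, z < 0 by exact: lt_nbhsl.
    by apply: filterS => z z0; rewrite step_le0// ltW.
  rewrite (@near_eq_derive _ _ _ _ (cst (1 : R))) ?derive_cst//.
  have : \forall z \near s, 1 < z by exact: lt_nbhsr.
  by apply: filterS => z z1; rewrite step_ge1// ltW.
have cn : {within `[0, 1], continuous (fun s : R => `|step' s|)}.
  by apply: continuous_subspaceT => t; apply: cvg_norm; exact: cs'.
have [c _ hc] := EVT_max ler01 cn.
exists step', `|step' c|; split=> // s.
have [s0|s0] := ltP s 0; first by rewrite out ?normr0//; left.
have [s1'|s1'] := ltP 1 s; first by rewrite out ?normr0//; right.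
by apply: hc; rewrite in_itv/= s0.
Qed.

End smooth_step.

(** * Tensor products of smooth functions *)

Section tensor_calculus.
Context {R : realType} {n : nat}.
Implicit Types (h : 'I_n -> R -> R) (x : 'rV[R]_n).

Lemma continuous_tensor h : (forall i, continuous (h i)) -> continuous (tensor h).
Proof.
move=> ch x; rewrite /tensor; elim: (index_enum _) => [|i s IHs].
  by under eq_fun do rewrite big_nil; exact: for_continuous_cst.
under eq_fun do rewrite big_cons.
apply: (@for_continuousM R 'rV[R]_n) => //.
by apply: continuous_comp; [exact: coord_continuous|exact: ch].
Qed.

Definition set_factor h i g : 'I_n -> R -> R := fun l => if l == i then g else h l.

Lemma tensor_set_factor h i g x :
  tensor (set_factor h i g) x = g (x ord0 i) * \prod_(l | l != i) h l (x ord0 l).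
Proof.
rewrite /tensor (bigD1 i)//= {1}/set_factor eqxx; congr (_ * _).
by apply: eq_bigr => l /negbTE li; rewrite /set_factor li.
Qed.

Lemma is_derive_tensor h i g x : is_derive (x ord0 i) (1 : R) (h i) (g (x ord0 i)) ->
  is_derive x (delta_mx ord0 i) (tensor h) (tensor (set_factor h i g) x).
Proof.
move=> dh; pose c := \prod_(l | l != i) h l (x ord0 l).
have dhc : is_derive (x ord0 i) (1 : R) (fun t => h i t * c) (g (x ord0 i) * c).
  apply: (is_derive_eq (is_derive_mul dh (is_derive_cst c _ _))).
  by rewrite mulr0 addr0.
have e (t : R) : tensor h (t *: delta_mx ord0 i + x) = h i (t *: (1 : R) + x ord0 i) * c.
  rewrite /tensor (bigD1 i)//= !mxE !eqxx; congr (_ * _).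
  by apply: eq_bigr => l /negbTE li; rewrite !mxE li andbF mulr0 add0r.
have e0 : tensor h x = h i (x ord0 i) * c by have := e 0; rewrite !scale0r !add0r.
have eq : (fun t : R => t^-1 *: (tensor h (t *: delta_mx ord0 i + x) - tensor h x)) =
    (fun t : R => t^-1 *: (h i (t *: (1 : R) + x ord0 i) * c - h i (x ord0 i) * c)).
  by apply/funext => t; rewrite e e0.
rewrite tensor_set_factor -/c; case: dhc => d1 d2.
apply: DeriveDef; first by move: d1; rewrite /derivable /= eq.
by rewrite -d2 /derive; congr (lim _); rewrite /= eq.
Qed.

Lemma partial_tensor h (h' : R -> R) i : (forall t : R, is_derive t (1 : R) (h i) (h' t)) ->
  partial i (tensor h) = tensor (set_factor h i h').
Proof. by move=> dh; apply/funext => x; have [] := is_derive_tensor (dh (x ord0 i)). Qed.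

(** A partial derivative replaces one factor by its derivative, so all iterated derivatives are
    again tensor products of factors in the class. *)
Lemma smooth_tensor h : (forall i, smooth1 (h i)) -> smooth (tensor h).
Proof.
move=> sh s /=.
have [g [sg ->]] : exists g, (forall i, smooth1 (g i)) /\
    foldr partial (tensor h) s = tensor g.
  elim: s => [|i s [g [sg /= ->]]]; first by exists h.
  have [g' sg' dg'] := smooth1_derive (sg i).
  exists (set_factor g i g'); split; last exact: partial_tensor.
  by move=> l; rewrite /set_factor; case: ifP.
split; first by apply: continuous_tensor => i; exact: smooth1_continuous.
move=> i x; have [g' sg' dg'] := smooth1_derive (sg i).
by have [] := is_derive_tensor (dg' (x ord0 i)).
Qed.

Lemma tensor_norm_le h (Q : R -> R) x : (forall i, `|h i (x ord0 i)| <= Q (x ord0 i)) ->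
  `|tensor h x| <= tensor (fun=> Q) x.
Proof.
by move=> hQ; rewrite /tensor normr_prod; apply: ler_prod => i _; rewrite normr_ge0/=.
Qed.

(** Majorizing the weight by a product lets weighted integrals factor over the coordinates. The
    induction needs the stronger bound with [1 +] in front of the sum. *)
Lemma sqnorm_le_tensor x : sqnorm x <= tensor (fun=> fun t => 1 + t ^+ 2) x.
Proof.
rewrite /sqnorm /tensor.
suff [_] : 0 <= \sum_i x ord0 i ^+ 2 /\ 1 + \sum_i x ord0 i ^+ 2 <= \prod_i (1 + x ord0 i ^+ 2).
  by apply: le_trans; rewrite lerDr.
elim/big_rec2 : _ => [|i y z _ []]; first by rewrite addr0.
by have := sqr_ge0 (x ord0 i); move: (x ord0 i ^+ 2) => a a0 z0 zy; split; nra.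
Qed.

End tensor_calculus.

(** * Cutoffs to compact subsets of the orthant *)

Section cutoff.
Context {R : realType}.
Implicit Types (b : bool) (j : nat) (t : R).

(* Equal to [1] on [[2/J, J-1]] (if [b]) or [[-J+1, J-1]], and supported in
   [[1/J, J]] or [[-J, J]], where [J = j+1]. *)
Definition cutoff b j t : R := step (- 1 * t + j.+1%:R) *
  (if b then step (j.+1%:R * t + - 1) else step (1 * t + j.+1%:R)).

Lemma smooth1_cutoff b j : smooth1 (cutoff b j).
Proof. by apply: smooth1_mul; [|case: b]; exact: smooth1_step. Qed.

Lemma cutoff_ge0 b j t : 0 <= cutoff b j t.
Proof. by rewrite mulr_ge0 ?step_ge0//; case: b; exact: step_ge0. Qed.

Lemma cutoff_le1 b j t : cutoff b j t <= 1.
Proof.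
rewrite mulr_ile1 ?step_ge0 ?step_le1//; first by case: b; exact: step_ge0.
by case: b; exact: step_le1.
Qed.

Lemma cutoff_support b j t : cutoff b j t != 0 ->
  `|t| <= j.+1%:R /\ (b -> j.+1%:R^-1 <= t).
Proof.
have J0 : 0 < j.+1%:R :> R by rewrite ltr0n.
have J1 : 1 <= j.+1%:R :> R by rewrite ler1n.
rewrite mulf_eq0 negb_or => /andP[h1 h2].
have t1 : t <= j.+1%:R.
  by rewrite leNgt; apply: contra h1 => h; rewrite step_le0//; lra.
case: b h2 => h2.
  have t2 : j.+1%:R^-1 <= t.
    rewrite leNgt; apply: contra h2 => h; rewrite step_le0//.
    by rewrite -(@ltr_pM2l _ j.+1%:R)// divff ?gt_eqF// in h; lra.
  split=> //; rewrite ger0_norm//; apply: le_trans t2.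
  by rewrite invr_ge0 ltW.
split=> //; rewrite ler_norml t1 andbT leNgt; apply: contra h2 => h.
by rewrite step_le0//; lra.
Qed.

(** At a wall the derivative has size [j.+1], but only where [t] is at most [2 / j.+1]; multiplied
    by [|t|] it stays bounded uniformly in [j]. The functions to be cut off vanish linearly at the
    walls and supply this factor. *)
Lemma cutoff_derive : exists (cutoff' : bool -> nat -> R -> R) K, [/\ 0 <= K,
  forall b j t, is_derive t (1 : R) (cutoff b j) (cutoff' b j t),
  forall b j t, (b -> 0 < t) -> (if b then `|t| else 1) * `|cutoff' b j t| <= K * (1 + t ^+ 2) &
  forall b t, (b -> 0 < t) -> \forall j \near \oo, cutoff b j t = 1 /\ cutoff' b j t = 0].
Proof.
have [step' [K [K0 ds bs zs]]] := @step_derive R.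
pose c' b j t := (step' (- 1 * t + j.+1%:R) * - 1) *
    (if b then step (j.+1%:R * t + - 1) else step (1 * t + j.+1%:R)) +
  step (- 1 * t + j.+1%:R) *
    (if b then step' (j.+1%:R * t + - 1) * j.+1%:R else step' (1 * t + j.+1%:R) * 1).
have dstep (a e t : R) : is_derive t (1 : R) (fun t => step (a * t + e)) (step' (a * t + e) * a).
  exact: (is_derive_comp1 (is_derive_affine a e t) (ds _)).
exists c', (4 * K); split.
- by rewrite mulr_ge0.
- by move=> b j t; apply: is_derive_mul => //; case: b.
- move=> b j t bt; rewrite /c'; set P := step' (- 1 * t + _); set S := step (- 1 * t + _).
  have hP : `|P| <= K by exact: bs.
  have hS : `|S| <= 1 by rewrite ger0_norm ?step_ge0// step_le1.
  have J0 : 0 < j.+1%:R :> R by rewrite ltr0n.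
  clearbody P S; case: b bt => [/(_ isT) t0|_].
    rewrite (gtr0_norm t0).
    set S2 := step _; have hS2 : `|S2| <= 1 by rewrite ger0_norm ?step_ge0// step_le1.
    have hP2 : `|t * (step' (j.+1%:R * t + - 1) * j.+1%:R)| <= 2 * K.
      have [h|h] := leP (j.+1%:R * t + - 1) 1; last by rewrite zs ?mul0r ?mulr0 ?normr0 ?mulr_ge0//; right.
      rewrite [X in `|X|](_ : _ = (j.+1%:R * t) * step' (j.+1%:R * t + - 1)); last by ring.
      rewrite normrM; apply: ler_pM => //.
      by rewrite gtr0_norm ?mulr_gt0//; lra.
    set P2 := _ * j.+1%:R in hP2 *; clearbody S2 P2.
    apply: (@le_trans _ _ (t * K + 2 * K)).
      rewrite -[in leLHS](gtr0_norm t0) -normrM mulrDr; apply: le_trans (ler_normD _ _) _.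
      apply: lerD.
        rewrite normrM (gtr0_norm t0) ler_wpM2l ?(ltW t0)// !normrM normrN1 mulr1.
        by rewrite -[leRHS]mulr1; apply: ler_pM.
      rewrite mulrCA normrM -[leRHS]mul1r; exact: ler_pM.
    have : 0 <= (t - 1) ^+ 2 by exact: sqr_ge0.
    have : 0 <= K * t by rewrite mulr_ge0// ltW.
    by nra.
  set S2 := step _; have hS2 : `|S2| <= 1 by rewrite ger0_norm ?step_ge0// step_le1.
  set P2 := step' _; have hP2 : `|P2| <= K by exact: bs.
  clearbody S2 P2; rewrite mul1r; apply: (@le_trans _ _ (K + K)).
    apply: le_trans (ler_normD _ _) _; rewrite !normrM normrN1 !mulr1 normr1 mulr1.
    apply: lerD; first by rewrite -[leRHS]mulr1; apply: ler_pM.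
    by rewrite -[leRHS]mul1r; apply: ler_pM.
  by have := sqr_ge0 t; nra.
- move=> b t bt.
  have h1 : \forall j \near \oo, 2 + `|t| < j.+1%:R.
    near=> j; rewrite (@lt_le_trans _ _ j%:R)//; last by rewrite ler_nat.
    by near: j; exact: nbhs_infty_gtr.
  have h2 : \forall j \near \oo, 3 * t^-1 < j.+1%:R.
    near=> j; rewrite (@lt_le_trans _ _ j%:R)//; last by rewrite ler_nat.
    by near: j; exact: nbhs_infty_gtr.
  apply: filterS2 h1 h2 => j h1 h2.
  have t1 := ler_norm t; have t2 := lerNnormlW (lexx `|t|).
  have e1 : 1 < - 1 * t + j.+1%:R by lra.
  rewrite /cutoff /c' (step_ge1 (ltW e1)) (zs _ (or_intror e1)).
  case: b bt => [/(_ isT) t0|_].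
    have e2 : 1 < j.+1%:R * t + - 1.
      by rewrite ltr_pdivrMr// in h2; lra.
    by rewrite (step_ge1 (ltW e2)) (zs _ (or_intror e2)) !mul0r !mulr0 mulr1 addr0.
  have e2 : 1 < 1 * t + j.+1%:R by lra.
  by rewrite (step_ge1 (ltW e2)) (zs _ (or_intror e2)) !mul0r !mulr0 mulr1 addr0.
Unshelve. all: by end_near. Qed.

End cutoff.

(** * Tensor products as limits of test functions *)

Section tensor_completion.
Context {R : realType} {n k : nat}.
Local Notation leb := (@lebesgue_rV R n).
Local Notation RR := (measurableTypeR R).
Local Notation D := (@orthant R n k).
Local Notation mD := (@measurable_orthant R n k).
Local Notation pos := (@is_positive n k).

Definition envelope (t : R) := (1 + t ^+ 2) * expR (- 2^-1 * t ^+ 2).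

Lemma envelope_ge0 t : 0 <= envelope t.
Proof. by rewrite mulr_ge0 ?expR_ge0// addr_ge0// sqr_ge0. Qed.

Lemma integrable_envelope_tensor (K : R) : leb.-integrable setT
  (fun x => (tensor (fun=> fun t => (1 + t ^+ 2) * (K * ((1 + t ^+ 2) * envelope t)) ^+ 2) x)%:E).
Proof.
apply: (integrable_tensorn _).1 => _.
(* Five factors [1 + t ^+ 2]: the one in front, and two from each copy of the squared term, of which
   [envelope] contributes one. *)
apply: (@integrable_gaussian_bound _ _ (K ^+ 2) 1 5) => //.
  apply: continuous_measurable_RR.
  have ct (t : R) : {for t, continuous (fun s : R => 1 + s ^+ 2)}.
    by apply: for_continuousD; [exact: for_continuous_cst|exact: exprn_continuous].
  have ce (t : R) : {for t, continuous envelope}.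
    by apply: for_continuousM => //; exact: continuous_gauss.
  suff c t : {for t, continuous (fun t : R => (1 + t ^+ 2) * (K * ((1 + t ^+ 2) * envelope t)) ^+ 2)} by [].
  apply: for_continuousM => //; apply: for_continuousX.
  by apply: for_continuousM; [exact: for_continuous_cst|exact: for_continuousM].
move=> t; rewrite ger0_norm; last by rewrite mulr_ge0 ?sqr_ge0// addr_ge0 ?sqr_ge0.
rewrite /envelope (_ : - 1 * t ^+ 2 = 2%:R * (- 2^-1 * t ^+ 2)); last by field.
by rewrite expRM_natl le_eqVlt; apply/orP; left; apply/eqP; ring.
Qed.

Lemma cvg_integral_dominated0 (f_ : nat -> 'rV[R]_n -> R) (g : 'rV[R]_n -> R) :
  (forall j, measurable_fun D (f_ j)) ->
  (forall x, D x -> \forall j \near \oo, f_ j x = 0) ->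
  leb.-integrable D (fun x => (g x)%:E) ->
  (forall j x, D x -> `|f_ j x| <= g x) ->
  (fun j => \int[leb]_(x in D) (f_ j x)%:E)%E @ \oo --> 0%E.
Proof.
move=> mf f0 ig fg.
rewrite [X in _ --> X](_ : _ = (\int[leb]_(x in D) cst 0 x)%E); last by rewrite integral0.
apply: (@dominated_cvg _ _ _ leb D mD (fun j x => (f_ j x)%:E) (cst 0%E) (fun x => (g x)%:E)) => //.
- by move=> j; apply/measurable_EFinP.
- move=> x Dx; apply: cvg_near_cst.
  by apply: filterS (f0 x Dx) => j ->.
Qed.

Variables q q' : 'I_n -> R -> R.
Hypothesis sq : forall i, smooth1 (q i).
Hypothesis dq : forall i (t : R), is_derive t (1 : R) (q i) (q' i t).
Hypothesis bq : forall i t, `|q i t| <= (if pos i then `|t| else 1) * envelope t.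
Hypothesis bq' : forall i t, `|q' i t| <= envelope t.

Lemma continuous_factor' i : continuous (q' i).
Proof.
have [g sg dg] := smooth1_derive (sq i).
rewrite (_ : q' i = g); first exact: smooth1_continuous.
by apply/funext => t; have [_ <-] := dq i t; have [_ <-] := dg t.
Qed.

(** The factors are multiplied by cutoffs. At each point of the orthant the cut-off product and its
    gradient eventually coincide with the original ones, and dominated convergence gives both
    limits. The bound on [q] by [|t|] at positive coordinates compensates for the steep cutoffs at
    the walls. *)
Lemma tensor_completion : completion_pair k (tensor q) (grad (tensor q)).
Proof.
have [cutoff' [K [K0 dc bc zc]]] := @cutoff_derive R.
(* One majorant for [q], [q'], the cut-off factors and, inside the orthant, their derivatives. *)
pose Q t := (1 + K) * ((1 + t ^+ 2) * envelope t).
have Q0 t : 0 <= Q t by rewrite !mulr_ge0 ?envelope_ge0 ?addr_ge0 ?sqr_ge0.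
have t2 (t : R) : `|t| <= 1 + t ^+ 2.
  have := sqr_ge0 (`|t| - 1); have := normr_ge0 t; rewrite -(real_normK (num_real t)); nra.
have eQ t : envelope t <= Q t.
  have := envelope_ge0 t; have := sqr_ge0 t; rewrite /Q; move: (envelope t) (t ^+ 2) => a b b0 a0.
  have : 0 <= a * b by rewrite mulr_ge0.
  by nra.
have qQ i t : `|q i t| <= Q t.
  apply: (le_trans (bq i t)); case: ifP => _; last by rewrite mul1r.
  apply: (@le_trans _ _ ((1 + t ^+ 2) * envelope t)); first by rewrite ler_wpM2r ?envelope_ge0.
  by rewrite ler_peMl ?mulr_ge0 ?envelope_ge0 ?addr_ge0 ?sqr_ge0// lerDl.
have q'Q i t : `|q' i t| <= Q t by apply: le_trans (eQ t).
pose p j i t := q i t * cutoff (pos i) j t.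
pose p' j i t := q' i t * cutoff (pos i) j t + q i t * cutoff' (pos i) j t.
have sp j i : smooth1 (p j i) by apply: smooth1_mul => //; exact: smooth1_cutoff.
have dp j i (t : R) : is_derive t (1 : R) (p j i) (p' j i t) by exact: is_derive_mul.
have pQ j i t : `|p j i t| <= Q t.
  apply: le_trans (qQ i t); rewrite normrM ler_piMr// ger0_norm ?cutoff_ge0//.
  exact: cutoff_le1.
have p'Q j i t : (pos i -> 0 < t) -> `|p' j i t| <= Q t.
  move=> it; apply: le_trans (ler_normD _ _) _; rewrite (normrM (q' i t)) (normrM (q i t)).
  apply: (@le_trans _ _ (envelope t + envelope t * (K * (1 + t ^+ 2)))).
    apply: lerD.
      apply: le_trans (bq' i t).
      by rewrite ler_piMr// ger0_norm ?cutoff_ge0// cutoff_le1.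
    apply: (@le_trans _ _ (((if pos i then `|t| else 1) * envelope t) * `|cutoff' (pos i) j t|)).
      by rewrite ler_wpM2r.
    by rewrite mulrAC mulrC ler_wpM2l ?envelope_ge0// bc.
  have := envelope_ge0 t; have := sqr_ge0 t; rewrite /Q.
  move: (envelope t) (t ^+ 2) => a b b0 a0.
  have : 0 <= a * b by rewrite mulr_ge0.
  by nra.
have set_factorQ (h : 'I_n -> R -> R) i (g : R -> R) (x : 'rV[R]_n) : (forall l, `|h l (x ord0 l)| <= Q (x ord0 l)) ->
    `|g (x ord0 i)| <= Q (x ord0 i) -> `|tensor (set_factor h i g) x| <= tensor (fun=> Q) x.
  move=> hQ gQ; apply: tensor_norm_le => l; rewrite /set_factor.
  by case: (l =P i) => [->|_].
have phi_ev x : D x -> \forall j \near \oo, tensor (p j) x = tensor q x /\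
    forall i, tensor (set_factor (p j) i (p' j i)) x = tensor (set_factor q i (q' i)) x.
  move=> Dx.
  have : \forall j \near \oo, forall i, cutoff (pos i) j (x ord0 i) = 1 /\
      cutoff' (pos i) j (x ord0 i) = 0.
    by apply: filter_forall => i; apply: zc; exact: Dx.
  apply: filterS => j h; split.
    by apply: eq_bigr => i _; rewrite /p (h i).1 mulr1.
  move=> i; apply: eq_bigr => l _; rewrite /set_factor; case: ifP => li.
    by move/eqP: li => <-; rewrite /p' (h l).1 (h l).2 mulr1 mulr0 addr0.
  by rewrite /p (h l).1 mulr1.
have partial_q i : partial i (tensor q) = tensor (set_factor q i (q' i)).
  by apply: partial_tensor; exact: dq.
have partial_p j i : partial i (tensor (p j)) = tensor (set_factor (p j) i (p' j i)).
  by apply: partial_tensor; exact: dp.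
have diffQ (a b B : R) : `|a| <= B -> `|b| <= B -> (a - b) ^+ 2 <= 4 * B ^+ 2.
  by rewrite !ler_norml => /andP[? ?] /andP[? ?]; nra.
(* The extra [1 + t ^+ 2] in each factor absorbs the weight [|x|^2]. *)
pose W := tensor (fun _ : 'I_n => fun t => (1 + t ^+ 2) * Q t ^+ 2).
have TQ (x : 'rV[R]_n) : tensor (fun=> Q) x ^+ 2 = tensor (fun=> fun t => Q t ^+ 2) x.
  by rewrite /tensor prodrXl.
have W1 (x : 'rV[R]_n) : sqnorm x * tensor (fun=> Q) x ^+ 2 <= W x.
  have -> : W x = tensor (fun=> fun t => 1 + t ^+ 2) x * tensor (fun=> fun t => Q t ^+ 2) x.
    exact: big_split.
  by rewrite -TQ ler_wpM2r ?sqr_ge0// sqnorm_le_tensor.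
have W2 (x : 'rV[R]_n) : tensor (fun=> Q) x ^+ 2 <= W x.
  rewrite TQ; apply: ler_prod => i _.
  by rewrite sqr_ge0/= ler_peMl ?sqr_ge0// lerDl sqr_ge0.
have iW (c : R) : leb.-integrable D (fun x => (c * W x)%:E).
  apply: integrable_scaler => //; first exact: mD.
  by apply: integrableS (integrable_envelope_tensor (1 + K)) => //; exact: mD.
have cq i : continuous (q i) by exact: smooth1_continuous.
have mq : measurable_fun [set: 'rV[R]_n] (tensor q).
  by apply: continuous_measurable_rV; exact: continuous_tensor.
have mG : measurable_fun [set: 'rV[R]_n] (grad (tensor q)).
  apply: measurable_fun_rVP => i.
  under eq_fun do rewrite mxE partial_q.
  apply: continuous_measurable_rV; apply: continuous_tensor => l.
  by rewrite /set_factor; case: ifP => _; [exact: continuous_factor'|exact: cq].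
have tp j : test_fun k (tensor (p j)).
  split; first exact: smooth_tensor.
  exists [set v | forall i, `[(if pos i then j.+1%:R^-1 else - j.+1%:R), j.+1%:R]%classic (v ord0 i)].
  split.
  - apply: (@rV_compact R n (fun i => `[(if pos i then j.+1%:R^-1 else - j.+1%:R), j.+1%:R]%classic)) => i.
    exact: segment_compact.
  - move=> x xJ i pi; have := xJ i; rewrite /= in_itv/= /is_positive pi => /andP[+ _].
    by apply: lt_le_trans; rewrite invr_gt0 ltr0n.
  - move=> x /= nx; apply/eqP; apply: contrapT => /negP px; apply: nx => i.
    have ci : cutoff (pos i) j (x ord0 i) != 0.
      apply: contra px => /eqP ci; rewrite /tensor (bigD1 i)//= /p ci mulr0 mul0r//.
    have [h1 h2] := cutoff_support ci.
    move: h1; rewrite in_itv/= ler_norml => /andP[h3 ->]; rewrite andbT.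
    by case: ifP h2 => // _; exact.
split; [exact: measurable_funTS|exact: measurable_funTS|].
exists (fun j => tensor (p j)); split=> //.
- apply: (@cvg_integral_dominated0 _ (fun x => (4 * n%:R) * W x)) => //.
  + move=> j; apply: measurable_funTS; apply: measurable_sum => i.
    apply: measurable_funX; under eq_fun do rewrite !mxE partial_q partial_p.
    apply: measurable_funB; apply: continuous_measurable_rV; apply: continuous_tensor => l;
      rewrite /set_factor; case: ifP => _ //; [|exact: smooth1_continuous|exact: continuous_factor'].
    move=> t; have [g sg dg] := smooth1_derive (sp j i).
    rewrite (_ : p' j i = g); first exact: smooth1_continuous.
    by apply/funext => s; have [_ <-] := dp j i s; have [_ <-] := dg s.
  + move=> x Dx; apply: filterS (phi_ev x Dx) => j [_ h].
    by rewrite /sqnorm big1// => i _; rewrite !mxE partial_q partial_p h subrr expr0n.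
  + move=> j x Dx; rewrite ger0_norm ?sqnorm_ge0//.
    apply: (@le_trans _ _ (\sum_(i < n) 4 * W x)); last first.
      by rewrite -mulr_suml sumr_const card_ord -[4 *+ n]mulr_natr.
    apply: ler_sum => i _; rewrite !mxE partial_q partial_p.
    apply: (@le_trans _ _ (4 * tensor (fun=> Q) x ^+ 2)); last by rewrite ler_wpM2l.
    by apply: diffQ; apply: set_factorQ => //; apply: p'Q; exact: Dx.
- apply: (@cvg_integral_dominated0 _ (fun x => 4 * W x)) => //.
  + move=> j; apply: measurable_funTS; apply: measurable_funM; first exact: measurable_sqnorm.
    apply: measurable_funX; apply: measurable_funB => //.
    by apply: continuous_measurable_rV; apply: continuous_tensor => i; exact: smooth1_continuous.
  + move=> x Dx; apply: filterS (phi_ev x Dx) => j [h _].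
    by rewrite h subrr expr0n mulr0.
  + move=> j x Dx; rewrite ger0_norm; last by apply: mulr_ge0; [exact: sqnorm_ge0|exact: sqr_ge0].
    apply: (@le_trans _ _ (sqnorm x * (4 * tensor (fun=> Q) x ^+ 2))).
      rewrite ler_wpM2l ?sqnorm_ge0//; apply: diffQ; exact: tensor_norm_le.
    by rewrite mulrCA ler_wpM2l.
Qed.

End tensor_completion.

(** * Weak gradients *)

Lemma C1_mul {R : realType} n (f g : 'rV[R]_n -> R) : C1 f -> C1 g ->
  C1 (fun x => f x * g x) /\
  forall i, partial i (fun x => f x * g x) = fun x => partial i f x * g x + f x * partial i g x.
Proof.
move=> f1 g1.
have d i x : is_derive x (delta_mx ord0 i) (fun x => f x * g x)
    (partial i f x * g x + f x * partial i g x).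
  apply: is_derive_mul; apply: DeriveDef => //; [exact: (f1.2 i).1|exact: (g1.2 i).1].
have e i : partial i (fun x => f x * g x) = fun x => partial i f x * g x + f x * partial i g x.
  by apply/funext => x; have [] := d i x.
split=> //; split; first by move=> x; apply: for_continuousM; [exact: f1.1|exact: g1.1].
move=> i; split; first by move=> x; have [] := d i x.
rewrite e => x; apply: (@for_continuousD R 'rV[R]_n); apply: (@for_continuousM R 'rV[R]_n).
- exact: (f1.2 i).2.
- exact: g1.1.
- exact: f1.1.
- exact: (g1.2 i).2.
Qed.

Section weak_gradient.
Context {R : realType} {n k : nat}.
Hypothesis kn : (1 <= k <= n)%N.
Local Notation leb := (@lebesgue_rV R n).
Local Notation D := (@orthant R n k).
Local Notation mD := (@measurable_orthant R n k).
Local Notation pos := (@is_positive n k).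
Implicit Types (phi u : 'rV[R]_n -> R) (G : 'rV[R]_n -> 'rV[R]_n).

Lemma test_fun_partial phi eta i : test_fun k phi -> C1 eta ->
  \int[leb]_(x in D) (partial i phi x * eta x) =
  - \int[leb]_(x in D) (phi x * partial i eta x).
Proof.
move=> tphi e1; have [M [d [d0 fb]]] := test_fun_boxed tphi.
have f1 := smooth_C1 tphi.1.
have [fe1 fe] := C1_mul f1 e1.
have boxM (f g : 'rV[R]_n -> R) : boxed pos M d f -> boxed pos M d (fun x => f x * g x).
  by move=> bf x; rewrite mulf_eq0 negb_or => /andP[/bf].
have b1 := boxM _ eta (boxed_partial (i := i) fb).
have b2 := boxM _ (partial i eta) fb.
have -> : \int[leb]_(x in D) (partial i phi x * eta x) = \int[leb]_x (partial i phi x * eta x).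
  by apply: Rintegral_support; exact: boxed_orthant d0 b1.
have -> : \int[leb]_(x in D) (phi x * partial i eta x) = \int[leb]_x (phi x * partial i eta x).
  by apply: Rintegral_support; exact: boxed_orthant d0 b2.
have := Rintegral_partial i fe1 (boxM _ eta fb).
rewrite fe RintegralD//; first by move/eqP; rewrite addr_eq0 => /eqP.
- apply: boxed_integrable b1 => x.
  by apply: (@for_continuousM R 'rV[R]_n); [exact: (f1.2 i).2|exact: e1.1].
- apply: boxed_integrable b2 => x.
  by apply: (@for_continuousM R 'rV[R]_n); [exact: f1.1|exact: (e1.2 i).2].
Qed.

(** Integration by parts for the approximating test functions, passed to the limit. The components
    of [G] are limits in mean square, so [eta] must be square integrable; on the other side only
    [radius * u] is such a limit, so [partial i eta] has to be divided by the radius. *)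
Lemma weak_gradient u G eta i : completion_pair k u G -> C1 eta ->
  square_integrable leb D eta ->
  square_integrable leb D (fun x => partial i eta x / radius x) ->
  \int[leb]_(x in D) (G x ord0 i * eta x) = - \int[leb]_(x in D) (u x * partial i eta x).
Proof.
move=> [mu_ mG [phi [tphi phiG phiu]]] e1 Le Ler.
have Lp j : square_integrable leb D (partial i (phi j)).
  apply: (square_integrable_subset mD).
  by have [_ h _] := test_fun_square_integrable (tphi j); exact: h.
have [LG limG] := gradient_limit mG tphi phiG i.
have c1 := cvg_dot mD Lp LG limG Le.
have c2 := ground_state_limit kn mu_ tphi phiu Ler.
have : (fun j => \int[leb]_(x in D) (partial i (phi j) x * eta x)) @ \oo -->
    - \int[leb]_(x in D) (u x * partial i eta x).
  under eq_fun do rewrite (test_fun_partial i (tphi _) e1).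
  exact: cvgN.
by move=> /(cvg_unique _ c1); apply.
Qed.

Lemma partial_over_radius psi i j : test_fun k psi ->
  square_integrable leb D (fun x => partial i (partial j psi) x / radius x).
Proof.
move=> tpsi; have [M [d [d0 fb]]] := test_fun_boxed tpsi.
have s2 := smooth_partial i (smooth_partial j tpsi.1).
have b2 := boxed_partial (i := i) (boxed_partial (i := j) fb).
have L := square_integrable_subset mD (boxed_square_integrable (smooth_C1 s2).1 b2).
apply: (square_integrable_dominated mD _ (square_integrableZ mD d^-1 L)).
  apply: measurable_funTS; apply: measurable_funM; last exact: measurable_radius_inv.
  by apply: continuous_measurable_rV; exact: (smooth_C1 s2).1.
move=> x Dx; rewrite mulrC !normrM; have [->|nz] := eqVneq (partial i (partial j psi) x) 0.
  by rewrite normr0 !mulr0.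
rewrite ler_wpM2r// !normfV (gtr0_norm d0) (gtr0_norm (radius_gt0 kn Dx)) lef_pV2 ?posrE ?(radius_gt0 kn Dx)//.
have [i0 pi0] := last_positive kn.
have [_ /(_ pi0) dx] := b2 x nz i0.
apply: le_trans dx _; apply: le_trans (ler_norm _) _.
by rewrite /radius -sqrtr_sqr ler_sqrt ?sqnorm_ge0// coord_le_sqnorm.
Qed.

(** Any two gradients [H1], [H2] of [u] have the same pairing with the derivatives of test
    functions. Along a sequence of such derivatives tending to the [i]-th component of [H1], this
    equates its squared norm with its pairing with that of [H2]; exchanging the roles gives equal
    norms. It makes the choice hidden in [S_grad] harmless. *)
Lemma completion_gradient_sqnorm u G G' i :
  completion_pair k u G -> completion_pair k u G' ->
  \int[leb]_(x in D) (G x ord0 i ^+ 2) = \int[leb]_(x in D) (G' x ord0 i ^+ 2).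
Proof.
have key H1 H2 : completion_pair k u H1 -> completion_pair k u H2 ->
    \int[leb]_(x in D) (H1 x ord0 i ^+ 2) = \int[leb]_(x in D) (H2 x ord0 i * H1 x ord0 i).
  move=> p1 p2; have [_ mH [phi [tphi phiG _]]] := p1.
  have [_ mH2 [phi2 [tphi2 phiG2 _]]] := p2.
  have Lp j : square_integrable leb D (partial i (phi j)).
    apply: (square_integrable_subset mD).
    by have [_ h _] := test_fun_square_integrable (tphi j); exact: h.
  have [L1 lim1] := gradient_limit mH tphi phiG i.
  have [L2 _] := gradient_limit mH2 tphi2 phiG2 i.
  have c1 := cvg_dot mD Lp L1 lim1 L1.
  have c2 := cvg_dot mD Lp L1 lim1 L2.
  have e : (fun j => \int[leb]_(x in D) (partial i (phi j) x * H1 x ord0 i)) =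
      (fun j => \int[leb]_(x in D) (partial i (phi j) x * H2 x ord0 i)).
    apply/funext => j.
    have s1 := smooth_C1 (smooth_partial i (tphi j).1).
    have o1 := partial_over_radius i i (tphi j).
    have w1 := weak_gradient p1 s1 (Lp j) o1.
    have w2 := weak_gradient p2 s1 (Lp j) o1.
    by rewrite [LHS]Rintegral_dotC w1 -w2 [RHS]Rintegral_dotC.
  rewrite e in c1; have := cvg_unique _ c1 c2.
  by rewrite [in RHS]Rintegral_dotC; apply.
by move=> p1 p2; rewrite (key _ _ p1 p2) Rintegral_dotC -(key _ _ p2 p1).
Qed.

End weak_gradient.

(** * Equality *)

Section hermite.
Context {R : realType}.
Local Notation mu := (@lebesgue_measure R).
Local Notation RR := (measurableTypeR R).
Implicit Types (b : bool) (t : R).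

(** The two lowest eigenfunctions, for eigenvalues 1 and 3, of the oscillator with potential
    [t ^+ 2], the case [c = 1/2]. The odd one is also the ground state of the half line; unlike
    [profile] it is not cut off, hence smooth. *)
Definition hermite b t : R := (if b then t else 1) * expR (- 2^-1 * t ^+ 2).

Definition hermite' b t : R := (if b then 1 - t ^+ 2 else - t) * expR (- 2^-1 * t ^+ 2).

Lemma smooth1_hermite b : smooth1 (hermite b).
Proof.
by apply: smooth1_mul; [case: b; [exact: smooth1_id|exact: smooth1_cst]|exact: smooth1_gauss].
Qed.

Lemma is_derive_hermite b t : is_derive t (1 : R) (hermite b) (hermite' b t).
Proof.
have dg := is_derive_gauss 2^-1 t; case: b.
  apply: (is_derive_eq (is_derive_mul (is_derive_id t 1) dg)).
  by rewrite /hermite'; field.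
apply: (is_derive_eq (is_derive_mul (is_derive_cst (1 : R) t (1 : R)) dg)).
by rewrite /hermite' /=; field.
Qed.

Lemma is_derive_hermite' b t : is_derive t (1 : R) (hermite' b)
  ((t ^+ 2 - (if b then 3 else 1)) * hermite b t).
Proof.
have dg := is_derive_gauss 2^-1 t; case: b.
  have dq : is_derive t (1 : R) (fun s : R => 1 - 1 * s ^+ 2) (0 - 2 * t).
    apply: (is_derive_eq (is_derive_add (is_derive_cst (1 : R) t (1 : R)) (is_derive_opp (is_derive_quadratic 1 t)))).
    by rewrite mul1r.
  have -> : hermite' true = fun s => (1 - 1 * s ^+ 2) * expR (- 2^-1 * s ^+ 2).
    by apply/funext => s; rewrite mul1r.
  by apply: (is_derive_eq (is_derive_mul dq dg)); rewrite /hermite; field.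
by apply: (is_derive_eq (is_derive_mul (is_derive_opp (is_derive_id t 1)) dg)); rewrite /hermite; field.
Qed.

Lemma hermite_le b t : `|hermite b t| <= (if b then `|t| else 1) * envelope t.
Proof.
rewrite normrM (ger0_norm (expR_ge0 _)) /envelope.
have -> : `|if b then t else 1| = (if b then `|t| else 1) by case: b; rewrite ?normr1.
apply: ler_wpM2l; first by case: b.
by rewrite ler_peMl ?expR_ge0// lerDl sqr_ge0.
Qed.

Lemma hermite_le_envelope b t : `|hermite b t| <= envelope t.
Proof.
rewrite normrM (ger0_norm (expR_ge0 _)) /envelope ler_wpM2r ?expR_ge0//.
case: b; last by rewrite normr1 lerDl sqr_ge0.
by rewrite ler_norml; apply/andP; split; nra.
Qed.

Lemma hermite'_le b t : `|hermite' b t| <= envelope t.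
Proof.
rewrite normrM (ger0_norm (expR_ge0 _)) /envelope ler_wpM2r ?expR_ge0//.
by case: b; rewrite ler_norml; apply/andP; split; nra.
Qed.

Lemma square_integrable_hermite b : square_integrable mu [set: RR] (hermite b).
Proof.
have ch : continuous (hermite b) by apply: smooth1_continuous; exact: smooth1_hermite.
split; first exact: continuous_measurable_RR.
apply: (@integrable_gaussian_bound _ _ 1 1 2) => //.
  apply: continuous_measurable_RR.
  suff c t : {for t, continuous (fun t : R => hermite b t ^+ 2)} by [].
  by apply: for_continuousX; exact: ch.
move=> t; rewrite mul1r normrX.
have -> : (1 + t ^+ 2) ^+ 2 * expR (- 1 * t ^+ 2) = envelope t ^+ 2.
  rewrite exprMn -expRM_natl; congr (_ * expR _); by field.
by rewrite lerXn2r ?nnegrE ?envelope_ge0// hermite_le_envelope.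
Qed.

Lemma hermite_sqnorm_gt0 : 0 < \int[mu]_t (hermite true t ^+ 2).
Proof.
have h0 : 0 < 2^-1 :> R by rewrite invr_gt0.
apply: lt_le_trans (profile_sqnorm_gt0 true h0) _.
apply: le_Rintegral => //.
- exact: (square_integrable_profile true h0).2.
- exact: (square_integrable_hermite true).2.
- move=> t _; rewrite /profile /hermite !exprMn ler_wpM2r ?sqr_ge0//.
  have [t0|t0] := leP t 0; last by [].
  by rewrite expr0n sqr_ge0.
Qed.

Lemma hermite_orthogonal c : 0 < c -> \int[mu]_t (hermite true t * nprofile false c t) = 0.
Proof.
move=> c0; apply: Rintegral_odd.
  by apply: square_integrable_dot => //; [exact: square_integrable_hermite|exact: square_integrable_nprofile].
by move=> t; rewrite /hermite /nprofile /profile sqrrN; ring.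
Qed.

End hermite.

Lemma square_integrable_tensorn {R : realType} n (h : 'I_n -> R -> R) :
  (forall i, square_integrable (@lebesgue_measure R) [set: measurableTypeR R] (h i)) ->
  square_integrable (lebesgue_rV n) setT (tensor h) /\
  \int[lebesgue_rV n]_x (tensor h x ^+ 2) = \prod_i \int[lebesgue_measure]_t (h i t ^+ 2).
Proof.
move=> Lh; have e : (fun x => tensor h x ^+ 2) = tensor (fun i t => h i t ^+ 2).
  by apply/funext => x; rewrite /tensor prodrXl.
have [i1 i2] := integrable_tensorn (fun i => (Lh i).2).
split; last by rewrite -i2; congr Rintegral; exact: e.
split; first by apply: measurable_tensor => i; case: (Lh i).
by move: i1; rewrite -e.
Qed.

(** * The first excited state *)

Section excited_state.
Context {R : realType} {n k : nat}.
Hypothesis kn : (1 <= k <= n)%N.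
Variable i1 : 'I_n.
Local Notation leb := (@lebesgue_rV R n).
Local Notation mu := (@lebesgue_measure R).
Local Notation D := (@orthant R n k).
Local Notation mD := (@measurable_orthant R n k).
Local Notation pos := (@is_positive n k).
Hypothesis pi1 : ~~ pos i1.

(* On the orthant, the ground state for [c = 1/2], not normalized, times the
   coordinate [i1]. *)
Definition excited : 'rV[R]_n -> R := tensor (fun i => hermite (pos i || (i == i1))).

Let h2 : 0 < 2^-1 :> R. Proof. by rewrite invr_gt0. Qed.

(** [excited] does not vanish outside the orthant. With the cut-off profiles at the positive
    coordinates, integrals over the orthant become integrals over the whole space and factor. *)
Let trunc i (t : R) := if i == i1 then hermite true t else profile (pos i) 2^-1 t.

Let Ltrunc i : square_integrable mu [set: measurableTypeR R] (trunc i).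
Proof.
rewrite /trunc; case: eqP => _; first exact: square_integrable_hermite.
exact: square_integrable_profile.
Qed.

Let excited_trunc x : D x -> excited x = tensor trunc x.
Proof.
move=> Dx; apply: eq_bigr => i _; rewrite /trunc.
have [->|ii1] := eqVneq i i1; first by rewrite orbT.
by rewrite orbF profile_pos//; exact: Dx.
Qed.

Let trunc_out x : ~ D x -> tensor trunc x = 0.
Proof.
move=> nDx; have [i [bi xi]] : exists i : 'I_n, pos i /\ x ord0 i <= 0.
  apply: contrapT => h; apply: nDx => i bi; rewrite ltNge; apply/negP => xi.
  by apply: h; exists i.
rewrite /tensor (bigD1 i)//= /trunc.
by case: eqP => [ii1|_]; [move: pi1; rewrite -ii1 bi|rewrite bi profile_le0// mul0r].
Qed.

Lemma square_integrable_excited : square_integrable leb D excited.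
Proof.
have L := square_integrable_subset mD (square_integrable_tensorn Ltrunc).1.
apply: (square_integrable_dominated mD _ L); last by move=> x /excited_trunc ->.
by apply: measurable_funTS; apply: measurable_tensor => i; exact: (square_integrable_hermite _).1.
Qed.

Lemma excited_sqnorm_gt0 : 0 < \int[leb]_(x in D) (excited x ^+ 2).
Proof.
rewrite (@eq_Rintegral _ _ _ _ _ (fun x => tensor trunc x ^+ 2)); last first.
  by move=> x; rewrite inE => /excited_trunc ->.
rewrite Rintegral_support; last by move=> x /trunc_out ->; rewrite expr0n.
rewrite (square_integrable_tensorn Ltrunc).2; apply: prodr_gt0 => i _; rewrite /trunc.
case: eqP => _; first exact: hermite_sqnorm_gt0.
exact: profile_sqnorm_gt0.
Qed.

(** Along [i1] the excited state is odd and the ground state even, whatever the frequency; one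
    parameter [c] per element of [Etilde] is therefore no obstruction. *)
Lemma excited_orthogonal c : 0 < c ->
  \int[leb]_(x in D) (excited x * ground_state pos c x) = 0.
Proof.
move=> c0; rewrite Rintegral_support; last by move=> x /ground_state_out ->; rewrite mulr0.
pose h i (t : R) := hermite (pos i || (i == i1)) t * nprofile (pos i) c t.
have ih i : mu.-integrable [set: measurableTypeR R] (fun t => (h i t)%:E).
  by apply: square_integrable_dot => //; [exact: square_integrable_hermite|exact: square_integrable_nprofile].
rewrite (@eq_Rintegral _ _ _ _ _ (tensor h)); last by move=> x _; rewrite /tensor /h big_split.
rewrite (integrable_tensorn ih).2 (bigD1 i1)//= /h eqxx orbT (negbTE pi1).
by rewrite hermite_orthogonal// mul0r.
Qed.

Lemma excited_pair : completion_pair k excited (grad excited).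
Proof.
apply: (@tensor_completion _ _ _ _ (fun i => hermite' (pos i || (i == i1)))).
- by move=> i; exact: smooth1_hermite.
- by move=> i t; exact: is_derive_hermite.
- move=> i t; case: (pos i); first exact: hermite_le.
  by rewrite mul1r; exact: hermite_le_envelope.
- by move=> i t; exact: hermite'_le.
Qed.

Lemma smooth_excited : smooth excited.
Proof. by apply: smooth_tensor => i; exact: smooth1_hermite. Qed.

(** The eigenvalue equation, one coordinate at a time. The extra 2 at [i1] is the gap [4 * c] for
    [c = 1/2]. *)
Lemma excited_second_derivative i x : partial i (partial i excited) x =
  (x ord0 i ^+ 2 - (ground_energy (pos i) 2^-1 + (if i == i1 then 2 else 0))) * excited x.
Proof.
pose q l := @hermite R (pos l || (l == i1)).
have -> : partial i excited = tensor (set_factor q i (hermite' (pos i || (i == i1)))).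
  by apply: partial_tensor => t; exact: is_derive_hermite.
have -> : partial i (tensor (set_factor q i (hermite' (pos i || (i == i1))))) =
    tensor (set_factor (set_factor q i (hermite' (pos i || (i == i1)))) i
      (fun t => (t ^+ 2 - (if pos i || (i == i1) then 3 else 1)) * q i t)).
  by apply: partial_tensor => t; rewrite /set_factor eqxx; exact: is_derive_hermite'.
rewrite tensor_set_factor /excited /tensor [in RHS](bigD1 i)//= -[LHS]mulrA.
have -> : ground_energy (pos i) 2^-1 + (if i == i1 then 2 else 0) =
    (if pos i || (i == i1) then 3 else 1) :> R.
  rewrite /ground_energy; have [->|_] := eqVneq i i1.
    by rewrite (negbTE pi1)/=; field.
  by rewrite orbF addr0; case: (pos i); field.
congr (_ * (_ * _)); apply: eq_bigr => l /negbTE li.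
by rewrite /set_factor li.
Qed.

(** Here the factor that cancels [1 / |x|] is the coordinate [i1], which leaves the product of the
    ground profiles. *)
Lemma excited_over_radius : square_integrable leb D (fun x => excited x / radius x).
Proof.
have L := square_integrable_subset mD
  (square_integrable_tensorn (fun i => square_integrable_profile (pos i) h2)).1.
apply: (square_integrable_dominated mD _ L).
  apply: measurable_funM; first by case: square_integrable_excited.
  by apply: measurable_funTS; exact: measurable_radius_inv.
move=> x Dx; have r0 := radius_gt0 kn Dx.
rewrite normrM normfV (gtr0_norm r0) ler_pdivrMr// excited_trunc//.
rewrite /tensor (bigD1 i1)//= [in leRHS](bigD1 i1)//= {1}/trunc eqxx.
rewrite (_ : \prod_(i < n | i != i1) trunc i (x ord0 i) =
  \prod_(i < n | i != i1) profile (pos i) 2^-1 (x ord0 i)); last first.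
  by apply: eq_bigr => i /negbTE ii; rewrite /trunc ii.
rewrite (negbTE pi1) /hermite /profile mul1r !normrM.
have x0r : `|x ord0 i1| <= radius x.
  by rewrite /radius -sqrtr_sqr ler_sqrt ?sqnorm_ge0// coord_le_sqnorm.
by rewrite -[leLHS]mulrA [leLHS]mulrC ler_wpM2l// mulr_ge0.
Qed.

(** The weak gradient identity with [eta] the derivative [partial i excited] itself turns the
    eigenvalue equation into an energy balance; the eigenvalues of the coordinates sum to
    [n + 2 * k + 2]. *)
Lemma excited_virial :
  \sum_i \int[leb]_(x in D) (partial i excited x ^+ 2) =
  (n + 2 * k + 2)%:R * \int[leb]_(x in D) (excited x ^+ 2) -
  \int[leb]_(x in D) (sqnorm x * excited x ^+ 2).
Proof.
have [_ mG [phi [tphi phiG phiu]]] := excited_pair.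
have Lu := square_integrable_excited; have Lur := excited_over_radius.
have [mu_ _] := Lu.
have [Lru _] := radius_limit mu_ tphi phiu.
pose e i : R := ground_energy (pos i) 2^-1 + (if i == i1 then 2 else 0).
have Lxu i : square_integrable leb D (fun x => x ord0 i * excited x).
  apply: (square_integrable_dominated mD _ Lru).
    by apply: measurable_funM => //; apply: measurable_funTS; exact: measurable_coor.
  move=> x Dx; rewrite !normrM ler_wpM2r// (gtr0_norm (radius_gt0 kn Dx)).
  by rewrite /radius -sqrtr_sqr ler_sqrt ?sqnorm_ge0// coord_le_sqnorm.
have Lxxr i : square_integrable leb D (fun x => x ord0 i ^+ 2 * excited x / radius x).
  apply: (square_integrable_dominated mD _ Lru).
    apply: measurable_funM; last by apply: measurable_funTS; exact: measurable_radius_inv.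
    by apply: measurable_funM => //; apply: measurable_funTS; apply: measurable_funX; exact: measurable_coor.
  move=> x Dx; have r0 := radius_gt0 kn Dx.
  rewrite normrM normfV (gtr0_norm r0) ler_pdivrMr// (normrM (radius x)) (gtr0_norm r0).
  rewrite [leRHS]mulrAC -expr2 radius_sqr (normrM (x ord0 i ^+ 2)) ler_wpM2r//.
  by rewrite ger0_norm ?sqr_ge0// coord_le_sqnorm.
have parts i : \int[leb]_(x in D) (partial i excited x ^+ 2) =
    e i * \int[leb]_(x in D) (excited x ^+ 2) -
    \int[leb]_(x in D) ((x ord0 i * excited x) ^+ 2).
  have [LG _] := gradient_limit mG tphi phiG i.
  have LG' : square_integrable leb D (partial i excited).
    by move: LG; congr square_integrable; apply/funext => x; rewrite mxE.
  have L2 : square_integrable leb D (fun x => partial i (partial i excited) x / radius x).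
    have := square_integrableB mD (Lxxr i) (square_integrableZ mD (e i) Lur).
    congr square_integrable; apply/funext => x.
    by rewrite excited_second_derivative -/(e i); ring.
  have := weak_gradient kn excited_pair (smooth_C1 (smooth_partial i smooth_excited)) LG' L2.
  rewrite (@eq_Rintegral _ _ _ _ _ (fun x => partial i excited x ^+ 2)); last first.
    by move=> x _; rewrite mxE.
  move=> ->; rewrite (@eq_Rintegral _ _ _ _ _ (fun x : 'rV[R]_n => (x ord0 i * excited x) ^+ 2 - e i * excited x ^+ 2)); last first.
    by move=> x _; rewrite excited_second_derivative -/(e i); ring.
  rewrite RintegralB//; [|exact: mD|exact: (Lxu i).2|]; last first.
    by apply: integrable_scaler; [exact: mD|exact: Lu.2].
  by rewrite RintegralZl; [ring|exact: mD|exact: Lu.2].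
under eq_bigr do rewrite parts.
rewrite sumrB -mulr_suml; congr (_ * _ - _).
  rewrite big_split/= (sum_ground_energy kn) -big_mkcond/= big_pred1_eq natrD.
  by field.
have [_ <-] := Rintegral_sum mD (index_enum 'I_n) (fun i => (Lxu i).2).
apply: eq_Rintegral => x _; rewrite /sqnorm mulr_suml.
by apply: eq_bigr => i _; rewrite exprMn.
Qed.

Lemma rho1_excited_le : rho1 k excited <= \int[leb]_(x in D) (excited x ^+ 2).
Proof.
have pS : completion_pair k excited (S_grad k excited).
  by apply: S_grad_pair; exists (grad excited); exact: excited_pair.
have [_ mG [phi [tphi phiG _]]] := pS.
have eA : \int[leb]_(x in D) sqnorm (S_grad k excited x) =
    \sum_i \int[leb]_(x in D) (partial i excited x ^+ 2).
  have [_ ->] := Rintegral_sum mD (index_enum 'I_n) (fun i => (gradient_limit mG tphi phiG i).1.2).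
  apply: eq_bigr => i _; rewrite (completion_gradient_sqnorm kn i pS excited_pair).
  by apply: eq_Rintegral => x _; rewrite mxE.
rewrite /rho1 eA excited_virial.
set N := \int[leb]_(x in D) (excited x ^+ 2).
set B := \int[leb]_(x in D) (sqnorm x * _).
set A := _ - B.
have A0 : 0 <= A.
  by rewrite /A /N /B -excited_virial; apply: sumr_ge0 => i _; exact: Rintegral_sqr_ge0.
have B0 : 0 <= B.
  by apply: Rintegral_ge0 => x _; apply: mulr_ge0; [exact: sqnorm_ge0|exact: sqr_ge0].
(* Half of [A + B] is [(n + 2 * k + 2) / 2] times [N]; subtracting the ground energy term of the
   deficit leaves exactly [N]. *)
have amgm : 2 * (Num.sqrt A * Num.sqrt B) <= A + B.
  rewrite -[in leRHS](sqr_sqrtr A0) -[in leRHS](sqr_sqrtr B0).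
  have := sqr_ge0 (Num.sqrt A - Num.sqrt B); nra.
move: amgm; rewrite {2}/A natrD; lra.
Qed.

Lemma Etilde_multiple (w : 'rV[R]_n -> R) : Etilde k w -> exists a c : R, 0 < c /\
  forall x, D x -> w x = a * ground_state pos c x.
Proof.
move=> [a [c [c0 ->]]].
exists (a * \prod_i Num.sqrt (\int[mu]_s (profile (pos i) c s ^+ 2))), c; split=> // x Dx.
rewrite ground_state_orthant// prodfV; field.
by apply/prodf_neq0 => i _; rewrite gt_eqF// sqrtr_gt0; exact: profile_sqnorm_gt0.
Qed.

Lemma excited_orthogonal_Etilde w : Etilde k w ->
  square_integrable leb D w /\ \int[leb]_(x in D) (excited x * w x) = 0.
Proof.
move=> /Etilde_multiple[a [c [c0 wE]]].
have [Lg _] := @ground_state_orthant_sqnorm R n k c c0.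
have e : {in D, (fun x => a * ground_state pos c x) =1 w}.
  by move=> x; rewrite inE => /wE.
split.
  apply: (square_integrable_dominated mD _ (square_integrableZ mD a Lg)).
    by apply: eq_measurable_fun e _; case: (square_integrableZ mD a Lg).
  by move=> x /wE ->.
rewrite (@eq_Rintegral _ _ _ _ _ (fun x => a * (excited x * ground_state pos c x))); last first.
  by move=> x /e <-; ring.
rewrite RintegralZl ?excited_orthogonal ?mulr0//; first exact: mD.
by apply: square_integrable_dot => //; [exact: mD|exact: square_integrable_excited].
Qed.

(** By orthogonality all admissible [w] are at the same squared distance, so the infimum is over a
    singleton. An explicit [w] of parameter 1 shows that the set is not empty. *)
Lemma dist_excited : dist_Etilde k excited = 2 * \int[leb]_(x in D) (excited x ^+ 2).
Proof.
set N := \int[leb]_(x in D) (excited x ^+ 2).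
have N0 : 0 <= N by exact: Rintegral_sqr_ge0.
rewrite /dist_Etilde -/N (_ : [set _ | _ in _] = [set 2 * N]) ?inf1//.
have distE w : Etilde k w -> N = \int[leb]_(x in D) (w x ^+ 2) ->
    \int[leb]_(x in D) ((excited x - w x) ^+ 2) = 2 * N.
  move=> /excited_orthogonal_Etilde[Lw ow] Nw.
  have := Rintegral_sqrB mD 1 1 square_integrable_excited Lw.
  under eq_Rintegral do rewrite !mul1r.
  by rewrite ow -Nw -/N => ->; ring.
apply/seteqP; split => [_ [w [Ew Nw] <-]|_ ->]; first exact: distE.
have [w [Ew wE]] := @Etilde_ground_state R n k 1 (Num.sqrt N) ltr01.
have Nw : N = \int[leb]_(x in D) (w x ^+ 2).
  have [Lg g1] := @ground_state_orthant_sqnorm R n k 1 ltr01.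
  rewrite (@eq_Rintegral _ _ _ _ _ (fun x => N * ground_state pos 1 x ^+ 2)); last first.
    by move=> x; rewrite inE => /wE ->; rewrite exprMn sqr_sqrtr.
  by rewrite RintegralZl ?g1 ?mulr1//; [exact: mD|exact: Lg.2].
by exists w; [split|exact: distE].
Qed.

(** A function equal almost everywhere to one orthogonal to it has norm 0. Equality is taken almost
    everywhere because elements of the completion are classes of functions. *)
Lemma excited_notin_Etilde :
  ~ exists w, Etilde k w /\ {ae leb, forall x, D x -> excited x = w x}.
Proof.
move=> [w [Ew uw]]; have [Lw ow] := excited_orthogonal_Etilde Ew.
have := excited_sqnorm_gt0.
suff -> : \int[leb]_(x in D) (excited x ^+ 2) = \int[leb]_(x in D) (excited x * w x).
  by rewrite ow ltxx.
have [mu_ _] := square_integrable_excited; have [mw _] := Lw.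
congr fine; apply: ae_eq_integral; first exact: mD.
- by apply/measurable_EFinP; exact: measurable_funX.
- by apply/measurable_EFinP; exact: measurable_funM.
- by move: uw; apply: filterS => x h Dx; rewrite expr2 -h.
Qed.

End excited_state.

Theorem theorem5p2 (R : realType) (n k : nat) (hn : (1 <= n)%N)
    (hk : (1 <= k <= n)%N) :
  (forall u : 'rV[R]_n -> R, S_space k u ->
     rho1 k u >= 2^-1 * dist_Etilde k u) /\
  ((k < n)%N ->
     (forall C : R, 2^-1 < C -> exists u : 'rV[R]_n -> R,
        S_space k u /\ rho1 k u < C * dist_Etilde k u) /\
     (exists u : 'rV[R]_n -> R,
        [/\ S_space k u,
            ~ (exists w, Etilde k w /\
                 {ae lebesgue_rV n, forall x, orthant k x -> u x = w x}) &
            rho1 k u = 2^-1 * dist_Etilde k u])).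

Proof.
split; first by move=> u; exact: rho1_ge.
move=> kn; pose i1 := Ordinal hn.
have pi1 : ~~ @is_positive n k i1 by rewrite /is_positive -ltnNge subn_gt0.
pose u := @excited R n k i1.
have Su : S_space k u by exists (grad u); exact: excited_pair.
have N0 : 0 < \int[lebesgue_rV n]_(x in orthant k) (u x ^+ 2) by exact: excited_sqnorm_gt0.
have le := @rho1_excited_le R n k hk i1 pi1; rewrite -/u in le.
have dE := @dist_excited R n k i1 pi1; rewrite -/u in dE.
(* One [u] serves both claims: half its distance term is its squared norm, which is positive and is
   an upper bound for the deficit. *)
split=> [C hC|]; exists u.
  by split=> //; rewrite dE mulrA; apply: le_lt_trans le _; rewrite ltr_pMl//; lra.
split=> //; first exact: excited_notin_Etilde.
by apply/eqP; rewrite eq_le rho1_ge// andbT dE mulKf.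
Qed.
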